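(* Let $k,n$ be two integers, $k \geq 1$, $n\geq 2$. Then, for a function $f \colon \mathbb{R}^n \to \mathbb{R}$, the following conditions are equivalent: (a) $f$ is regular on $\mathbb{R}^n$. (b) The restriction of $f$ to every irreducible algebraic curve in $\mathbb{R}^n$ is a regular function. (c) The restriction of $f$ to every algebraic curve, which is either a Euclidean circle in $\mathbb{R}^n$ or is in the collection $\mathcal{G}^k(\mathbb{R}^n)$, is a regular function. (d) The restriction of $f$ to every Euclidean circle in $\mathbb{R}^n$ is a regular function, and the restriction of $f$ to every algebraic curve in the collection $\mathcal{G}^k(\mathbb{R}^n)$ is a real analytic function. (e) The restriction of $f$ to every algebraic curve, which is either an affine line parallel to one of the coordinate axes of $\mathbb{R}^n$ or is in the collection $\mathcal{H}^k(\mathbb{R}^n)$, is a regular function. (f) The restriction of $f$ to every affine line parallel to one of the coordinate axes of $\mathbb{R}^n$ is a regular function, and the restriction of $f$ to every algebraic curve in the collection $\mathcal{H}^k(\mathbb{R}^n)$ is a real analytic function.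
   Context: An algebraic set in $\mathbb{R}^n$ is the common zero set of a family of real polynomials; an algebraic curve is an algebraic set of dimension 1. Regular functions: for $A\subset\mathbb{R}^n$, a function $f\colon A\to\mathbb{R}$ is regular at $a\in A$ if there are polynomial functions $\varphi,\psi\colon\mathbb{R}^n\to\mathbb{R}$ with $\psi(a)\neq 0$ and $f(x)=\varphi(x)/\psi(x)$ for all $x\in A$ with $\psi(x)\neq0$; $f$ is regular on $A$ if it is regular at every point of $A$. Real analytic functions: for $A\subset\mathbb{R}^n$, a function $g\colon A\to\mathbb{R}$ is real analytic if for every $a\in A$ there are an open neighborhood $U\subset\mathbb{R}^n$ of $a$ and a real analytic function $G\colon U\to\mathbb{R}$ (in the usual sense) such that $G$ and $g$ agree on $A\cap U$. A Euclidean circle in $\mathbb{R}^n$ is a set of the form $\{x\in\mathbb{R}^n:\|x-x_0\|=r\}\cap Q$, where $Q$ is an affine $2$-plane in $\mathbb{R}^n$, $x_0\in Q$ and $r>0$. For a positive integer $k$, $\Lambda^k$ denotes the set of pairs $(p,q)$ of prime numbers with $pk<q$. For primes $p<q$ put $$E_{p,q}=\{(x,y)\in\mathbb{R}^2: x^p-y^q=0\},\qquad C_{p,q}=\{(x,y)\in\mathbb{R}^2: x^p-y^q+x^{2q}+y^{2q}=0\}.$$ A translate of a set $E\subset\mathbb{R}^2$ is a set $(a,b)+E$ with $(a,b)\in\mathbb{R}^2$. For every affine $2$-plane $Q$ in $\mathbb{R}^n$ an affine-linear isomorphism $\varphi_Q\colon Q\to\mathbb{R}^2$ is chosen arbitrarily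 once and for all (if $n=2$, then $Q=\mathbb{R}^2$ and $\varphi_{\mathbb{R}^2}$ is chosen to be the identity map). Then $\mathcal{H}^k(\mathbb{R}^n)$ (resp. $\mathcal{G}^k(\mathbb{R}^n)$) is the collection of all algebraic curves $C$ in $\mathbb{R}^n$ for which there exist an affine $2$-plane $Q$ in $\mathbb{R}^n$ containing $C$ and a pair $(p,q)\in\Lambda^k$ such that $\varphi_Q(C)$ is a translate of $E_{p,q}$ (resp. of $C_{p,q}$). *)

(* Defs.v *)
From mathcomp Require Import all_boot all_order all_algebra.
From mathcomp Require Import finmap.
From mathcomp Require Import all_classical all_reals all_analysis.
From mathcomp Require summability.
(* Not imported: the notations of mpoly clash with those of analysis. *)
From mathcomp Require mpoly.

Set Implicit Arguments.
Unset Strict Implicit.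
Unset Printing Implicit Defensive.

Import Order.TTheory GRing.Theory Num.Theory.
Import numFieldNormedType.Exports.

Local Open Scope classical_set_scope.
Local Open Scope ring_scope.

Section Definitions.
Context {R : realType}.

Section Space.
Context {n : nat}.
Implicit Types (A C L V Q U : set 'rV[R]_n) (f g G : 'rV[R]_n -> R).
Implicit Types (a x : 'rV[R]_n).

Definition peval (P : mpoly.mpoly n R) x : R := mpoly.meval (fun i => x 0 i) P.

Definition algebraic_set V :=
  exists S : set (mpoly.mpoly n R), V = [set x | forall P, S P -> peval P x = 0].

Definition irreducible_algebraic V :=
  [/\ algebraic_set V, V !=set0 &
    forall V1 V2, algebraic_set V1 -> algebraic_set V2 ->
      V = V1 `|` V2 -> V = V1 \/ V = V2].

Definition irreducible_chain V (d : nat) (Z : nat -> set 'rV[R]_n) :=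
  (forall i, (i <= d)%N -> irreducible_algebraic (Z i) /\ Z i `<=` V) /\
  (forall i, (i < d)%N -> Z i `<` Z i.+1).

(* Krull dimension for the Zariski topology: the largest d for which there is a
   chain Z 0 < ... < Z d of irreducible algebraic subsets of V. *)
Definition has_dim V (d : nat) :=
  (exists Z, irreducible_chain V d Z) /\
  (forall e, (exists Z, irreducible_chain V e Z) -> (e <= d)%N).

Definition algebraic_curve C := algebraic_set C /\ has_dim C 1%N.

Definition irreducible_curve C := algebraic_curve C /\ irreducible_algebraic C.

(* Functions on a subset A are represented by total functions; the predicates
   regular_on A and real_analytic_on A depend only on their values on A. *)
Definition regular_at A f a :=
  exists phi psi : mpoly.mpoly n R, peval psi a != 0 /\
    forall x, A x -> peval psi x != 0 -> f x = peval phi x / peval psi x.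

Definition regular_on A f := forall a, A a -> regular_at A f a.

Definition monomial (m : {ffun 'I_n -> nat}) x : R := \prod_i x 0 i ^+ m i.

(* Near a, G is the sum of a power series centered at a; the sum over the
   multi-indices is unconditional (limit along the finite sets of
   multi-indices), that is, absolute. *)
Definition analytic_at G a :=
  exists c : {ffun 'I_n -> nat} -> R, \forall x \near a,
    summability.partial_sum (fun m => c m * monomial m (x - a))
      @ summability.totally --> G x.

Definition real_analytic_on A g :=
  forall a, A a -> exists (U : set 'rV[R]_n) (G : 'rV[R]_n -> R),
    [/\ open_nbhs a U, forall b, U b -> analytic_at G b &
        forall x, (A `&` U) x -> G x = g x].

(* The norm of 'rV[R]_n in the library is the sup norm. *)
Definition euclidean_norm x : R := Num.sqrt (\sum_i x 0 i ^+ 2).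

Definition affine_plane Q :=
  exists (x0 : 'rV[R]_n) (B : 'M[R]_(2, n)), row_free B /\
    Q = [set x0 + t *m B | t in [set: 'rV[R]_2]].

Definition euclidean_circle C :=
  exists Q (x0 : 'rV[R]_n) (r : R), [/\ affine_plane Q, Q x0, 0 < r &
    C = [set x | euclidean_norm (x - x0) = r] `&` Q].

Definition axis_parallel_line L :=
  exists (a : 'rV[R]_n) (i : 'I_n),
    L = [set a + t *: delta_mx 0 i | t in [set: R]].

(* An affine-linear map on Q is the restriction of one on the whole space. *)
Definition affine_iso_on Q (h : 'rV[R]_n -> 'rV[R]_2) :=
  (exists (M : 'M[R]_(n, 2)) (b : 'rV[R]_2), forall x, Q x -> h x = x *m M + b) /\
  set_bij Q [set: 'rV[R]_2] h.

(* The choice of an isomorphism phi Q for each affine plane Q; the values of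
   phi Q outside Q, and phi Q when Q is not an affine plane, are irrelevant. *)
Definition plane_charts (phi : set 'rV[R]_n -> 'rV[R]_n -> 'rV[R]_2) :=
  (forall Q, affine_plane Q -> affine_iso_on Q (phi Q)) /\
  (forall (e : n = 2%N) x, phi [set: 'rV[R]_n] x = castmx (erefl 1%N, e) x).

End Space.

Definition Lambda (k : nat) : set (nat * nat) :=
  [set pq | [/\ prime pq.1, prime pq.2 & (pq.1 * k < pq.2)%N]].

Definition E_curve (p q : nat) : set 'rV[R]_2 :=
  [set v : 'rV[R]_2 | v 0 0 ^+ p - v 0 1 ^+ q = 0].

Definition C_curve (p q : nat) : set 'rV[R]_2 :=
  [set v : 'rV[R]_2 |
    v 0 0 ^+ p - v 0 1 ^+ q + v 0 0 ^+ (2 * q) + v 0 1 ^+ (2 * q) = 0].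

Definition is_translate (E D : set 'rV[R]_2) :=
  exists c : 'rV[R]_2, D = [set c + v | v in E].

Section Collections.
Context {n : nat}.
Variables (phi : set 'rV[R]_n -> 'rV[R]_n -> 'rV[R]_2) (k : nat).

Definition planar_collection (F : nat -> nat -> set 'rV[R]_2) :
    set (set 'rV[R]_n) :=
  [set C | algebraic_curve C /\ exists Q p q,
    [/\ affine_plane Q, C `<=` Q, Lambda k (p, q) &
        is_translate (F p q) (phi Q @` C)]].

Definition H_collection := planar_collection E_curve.
Definition G_collection := planar_collection C_curve.

End Collections.
End Definitions.

(* Main.v *)
From mathcomp Require Import all_boot all_order all_algebra.
From mathcomp Require Import finmap zify ring lra.
From mathcomp Require Import all_classical all_reals all_analysis.
From mathcomp Require mpoly.
Import -(notations) mpoly.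
Require Import Defs.
Set Implicit Arguments.
Unset Strict Implicit.
Unset Printing Implicit Defensive.
Import Order.TTheory GRing.Theory Num.Theory.
Import numFieldNormedType.Exports.
Local Open Scope classical_set_scope.
Local Open Scope ring_scope.

(** Only two implications have content: a function whose restrictions to the
    axis-parallel lines (resp. the circles) are regular and whose restrictions
    to the cuspidal curves of the collection are analytic is regular. The
    others need that regular functions are analytic ([regular_real_analytic]),
    that the lines, circles and cuspidal curves have dimension one
    ([planar_algebraic_curve]), and that the lines and the curves
    [x ^ p = y ^ q], which have polynomial parametrizations, are irreducible.

    Rationality. A function whose restrictions to the axis-parallel lines are
    rational without poles is a quotient of polynomials
    ([separately_rational_is_rational]): as the real numbers are not countable,
    the degrees are bounded on a dense set of lines, and interpolation at
    finitely many points in one variable gives the fraction. For circles, the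
    inversion turns the circles through the origin into lines, which gives a
    fraction on an orthant; circles through a given point and the orthant carry
    the equation [Q * f = P] to the whole space ([orthant_spreads]).

    Local divisibility. Let [Q * f = P], and consider the curve [x ^ p = y ^ q]
    or its perturbation in a plane through a point [a]. It contains, up to high
    order, the arc [(t ^ q, t ^ p)]. If [T] is a Taylor polynomial of an
    analytic extension of [f] from the curve, then [P - Q * T] vanishes to the
    order [p * q] along the arc. Since the monomials of degree below [p] have
    distinct orders below [p * q] on it, they do not occur in [P - Q * T]: on
    the plane, [P] is a multiple of [Q] modulo the terms of degree [p], and [p]
    is as large as desired ([curve_quotient]).

    Regularity. Write [f = P / Q] near [a] in lowest terms, by unique
    factorization in polynomial rings ([poly_factorial]). A combination of [P]
    and [Q] is then a nonzero polynomial [r] that does not involve the last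
    variable ([coprime_bezout]). In a plane through [a] that contains the
    direction of the last axis and where [r] is not zero, local divisibility
    makes [r] a multiple of [Q] modulo a high power of the maximal ideal. If
    [Q] vanished at [a] this would be impossible, because [Q] does not vanish
    identically on the last axis ([no_local_relation]). Hence [Q] is not zero
    at [a], and [f] is regular there ([regular_of_planes]). *)

(** * Unique factorization in polynomial rings *)

Definition divides (A : idomainType) (x y : A) := exists z, y = x * z.

Definition prime_elt (A : idomainType) (x : A) :=
  [/\ x != 0, ~ divides x 1 &
      forall y z, divides x (y * z) -> divides x y \/ divides x z].

(** A unique factorization domain, with an additive size that makes every
    descent terminate. For iterated polynomial rings the size is the sum of the
    degrees of the successive leading coefficients. *)
Definition factorial (A : idomainType) := exists delta : A -> nat,
  [/\ forall a b : A, a != 0 -> b != 0 -> delta (a * b) = (delta a + delta b)%N,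
      forall a : A, a != 0 -> delta a = 0%N -> divides a 1 &
      forall a : A, a != 0 -> ~ divides a 1 ->
        exists2 x, prime_elt x & divides x a].

Lemma exists_minimal (T : Type) (P : T -> Prop) (m : T -> nat) x : P x ->
  exists y, P y /\ forall z, P z -> (m y <= m z)%N.
Proof.
have [k] := ubnP (m x); elim: k x => // k IH x; rewrite ltnS => hk Px.
have [[y [Py lt]]|n] := pselect (exists y, P y /\ (m y < m x)%N).
  by apply: IH Py; apply: leq_trans lt hk.
exists x; split=> // z Pz; rewrite leqNgt; apply/negP => lt.
by apply: n; exists z.
Qed.

Section Divides.
Variable A : idomainType.
Implicit Types x y z : A.

Lemma divides_refl x : divides x x.
Proof. by exists 1; rewrite mulr1. Qed.

Lemma divides_trans y x z : divides x y -> divides y z -> divides x z.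
Proof. by move=> [u ->] [v ->]; exists (u * v); rewrite mulrA. Qed.

Lemma divides_mulr x y z : divides x y -> divides x (y * z).
Proof. by move=> [u ->]; exists (u * z); rewrite mulrA. Qed.

Lemma divides_mull x y z : divides x y -> divides x (z * y).
Proof. by rewrite mulrC; apply: divides_mulr. Qed.

Lemma dividesD x y z : divides x y -> divides x z -> divides x (y + z).
Proof. by move=> [u ->] [v ->]; exists (u + v); rewrite mulrDr. Qed.

Lemma dividesN x y : divides x y -> divides x (- y).
Proof. by move=> [u ->]; exists (- u); rewrite mulrN. Qed.

Lemma divides0 x : divides x 0.
Proof. by exists 0; rewrite mulr0. Qed.

Lemma divides_sum x (I : Type) (r : seq I) (P : pred I) F :
  (forall i, P i -> divides x (F i)) -> divides x (\sum_(i <- r | P i) F i).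
Proof.
by move=> h; elim/big_ind: _ => //; [exact: divides0 | exact: dividesD].
Qed.

End Divides.

Section PolyFactorial.
Import Pdiv.CommonIdomain Pdiv.Idomain.
Variable A : idomainType.
Hypothesis facA : factorial A.
Implicit Types (f g h u v : {poly A}) (a b c x : A).

Definition primitive g := forall x, prime_elt x -> ~ divides x%:P g.

Lemma divides_polyC x f : (forall i, divides x f`_i) -> divides x%:P f.
Proof.
move=> h; have [F hF] : exists F : nat -> A, forall i, (i < size f)%N ->
  f`_i = x * F i.
  elim: (size f) => [|n [F IH]]; first by exists (fun=> 0).
  have [z hz] := h n; exists (fun i => if i == n then z else F i) => i.
  by rewrite ltnS leq_eqVlt; case: eqP => [-> _ //|_ /= /IH].
exists (\poly_(i < size f) F i); apply/polyP => i; rewrite coefCM coef_poly.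
by case: ltnP => [/hF//|hi]; rewrite mulr0 nth_default.
Qed.

Lemma divides_coef x f i : divides x%:P f -> divides x f`_i.
Proof. by move=> [g ->]; rewrite coefCM; exists g`_i. Qed.

(** The first coefficients of [f] and [g] not divisible by [x] meet in a single
    coefficient of [f * g]. *)
Lemma prime_polyC x : prime_elt x -> prime_elt x%:P.
Proof.
move=> [x0 x1 xp]; split; first by rewrite polyC_eq0.
  by move=> [g /(congr1 (fun p : {poly A} => p`_0))];
    rewrite coef1 coefCM /= => h; apply: x1; exists g`_0.
move=> f g dfg.
have first_coef h : divides x%:P h \/
    exists i, ~ divides x h`_i /\ forall j, (j < i)%N -> divides x h`_j.
  have [d|n] := pselect (divides x%:P h); first by left.
  right; have [i hi] : exists i, ~ divides x h`_i.
    by apply: contra_notP n => /forallNP hn; apply: divides_polyC => i; apply: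
      contra_notP (hn i).
  elim/ltn_ind: i hi => i IH hi.
  have [[j [ji hj]]|hn] := pselect (exists j, (j < i)%N /\ ~ divides x h`_j);
    first exact: IH ji hj.
  by exists i; split=> // j ji; apply: contra_notP hn => nj; exists j.
have [|[i [ni hi]]] := first_coef f; first by left.
have [|[j [nj hj]]] := first_coef g; first by right.
suff : divides x (f`_i * g`_j) by case/xp => [/ni|/nj].
have := divides_coef (i + j) dfg; rewrite coefM (bigD1 (inord i)) //=.
rewrite inordK ?ltnS ?leq_addr // addKn => h.
rewrite -[X in divides _ X](addrK (\sum_(k < (i + j).+1 | k != inord i) f`_k *
  g`_(i + j - k))).
apply: dividesD => //; apply/dividesN/divides_sum => k /eqP nk.
have [ki|ik|e] := ltngtP k i; last 1 first.
- by case: nk; apply: val_inj; rewrite /= inordK // ltnS leq_addr.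
- by apply: divides_mulr; apply: hi.
by apply/divides_mull/hj; have := ltn_ord k; rewrite ltnS; lia.
Qed.

Lemma primitive_part f : f != 0 ->
  exists c g, [/\ c != 0, f = c%:P * g & primitive g].
Proof.
have [delta [dM d0 dP]] := facA.
have [k] := ubnP (delta (lead_coef f)).
elim: k f => // k IH f; rewrite ltnS => hk f0.
have [pf|npf] := pselect (primitive f).
  by exists 1, f; rewrite oner_neq0 mul1r.
have [x [xp [f' ef]]] : exists x, prime_elt x /\ divides x%:P f.
  by apply: contra_notP npf => h x xp dx; apply: h; exists x.
have [x0 x1 _] := xp.
have f'0 : f' != 0 by apply: contraNneq f0 => e; rewrite ef e mulr0.
have [|c [g [c0 eg pg]]] := IH f' _ f'0.
  have : delta (lead_coef f) = (delta x + delta (lead_coef f'))%N.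
    by rewrite ef lead_coefM lead_coefC dM // lead_coef_eq0.
  have : delta x <> 0%N by move=> /(d0 _ x0)/x1.
  by lia.
by exists (x * c), g; rewrite mulf_neq0 // ef eg polyCM mulrA.
Qed.

(** The prime factors of the constant divide [w] one by one, since none of them
    divides [g]. *)
Lemma cancel_constant c g h w : primitive g -> c != 0 ->
  c%:P * h = g * w -> divides g h.
Proof.
have [delta [dM d0 dP]] := facA; move=> pg.
have [k] := ubnP (delta c).
elim: k c w => // k IH c w; rewrite ltnS => hk c0 e.
have [[z ez]|nu] := pselect (divides c 1).
  exists (z%:P * w); rewrite mulrCA -e mulrA -polyCM mulrC.
  by rewrite [z * c]mulrC -ez mulr1.
have [x xp [c' ec]] := dP c c0 nu; have [x0 x1 _] := xp.
have c'0 : c' != 0 by apply: contraNneq c0 => e'; rewrite ec e' mulr0.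
have [_ _ xP] := prime_polyC xp.
have : divides x%:P (g * w) by rewrite -e ec polyCM -mulrA; exists (c'%:P * h).
case/xP => [/(pg _ xp)//|[w' ew]].
apply: (IH c' w') => //.
  have : delta x <> 0%N by move=> /(d0 _ x0)/x1.
  by move: hk; rewrite ec dM //; lia.
have xC0 : x%:P != 0 :> {poly A} by rewrite polyC_eq0.
by apply: (mulfI xC0); rewrite mulrA -polyCM -ec e ew mulrCA.
Qed.

(** Take a nonzero combination [c%:P * m] of minimal degree. By pseudo-division
    it divides constant multiples of [u] and [v]; its primitive part [m] then
    divides [u] and [v] themselves. *)
Lemma quasi_gcd u v : v != 0 -> exists c m al be,
  [/\ c != 0, m != 0, c%:P * m = al * u + be * v, divides m u & divides m v].
Proof.
move=> v0.
pose I m := m != 0 /\ exists al be, m = al * u + be * v.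
have [m [[m0 [al [be em]]] minm]] :
    exists m, I m /\ forall m', I m' -> (size m <= size m')%N.
  apply: (@exists_minimal _ I (fun m => size m) v).
  by split=> //; exists 0, 1; rewrite mul0r add0r mul1r.
have [c [g [c0 eg pg]]] := primitive_part m0.
have dvd_comb w : (exists al be, w = al * u + be * v) -> divides g w.
  move=> [al' [be' ew]].
  have := divp_eq w m; set l := lead_coef m ^+ _; set r := (w %% m) => e.
  have r0 : r = 0.
    apply/eqP; apply: contraT => r0.
    have : (size m <= size r)%N.
      apply: minm; split=> //;
        exists (l%:P * al' - w %/ m * al), (l%:P * be' - w %/ m * be).
      have -> : r = l%:P * w - w %/ m * m by rewrite mul_polyC e addrC addKr.
      by rewrite {1}ew {2}em; ring.
    by rewrite leqNgt ltn_modpN0.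
  move: e; rewrite r0 addr0 {2}eg -mul_polyC => e.
  apply: (@cancel_constant l g w (w %/ m * c%:P)) => //.
    by rewrite expf_neq0 // lead_coef_eq0.
  by rewrite e; ring.
have g0 : g != 0 by apply: contraNneq m0 => e; rewrite eg e mulr0.
exists c, g, al, be; split=> //; first by rewrite -eg.
  by apply: dvd_comb; exists 1, 0; rewrite mul0r addr0 mul1r.
by apply: dvd_comb; exists 0, 1; rewrite mul0r add0r mul1r.
Qed.

Lemma divides_size g f : f != 0 -> divides g f -> (size g <= size f)%N.
Proof.
move=> f0 [h e]; move: f0; rewrite e mulf_eq0 negb_or => /andP[g0 h0].
rewrite size_mul //; have := size_poly_gt0 h; rewrite h0; lia.
Qed.

Lemma not_unit_poly f : (1 < size f)%N -> ~ divides f 1.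
Proof.
move=> h d; have := divides_size (oner_neq0 _) d.
by rewrite size_poly1; lia.
Qed.

(** A primitive divisor [g] of minimal positive degree is prime: the quasi-gcd
    of [g] and [u] is either associated with [g], or a constant, and in the
    latter case [g] divides a constant multiple of [v]. *)
Lemma poly_prime_divisor f : (1 < size f)%N ->
  exists2 g, prime_elt g & divides g f.
Proof.
move=> szf; have f0 : f != 0 by rewrite -size_poly_gt0; lia.
pose I g := (1 < size g)%N /\ divides g f.
have [g1 [[szg1 dg1] ming]] :
    exists g, I g /\ forall g', I g' -> (size g <= size g')%N.
  apply: (@exists_minimal _ I (fun m => size m) f).
  by split=> //; exact: divides_refl.
have g10 : g1 != 0 by rewrite -size_poly_gt0; lia.
have [c [g [c0 eg pg]]] := primitive_part g10.
have szg : size g = size g1 by rewrite eg mul_polyC size_scale.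
have dg : divides g f by apply: divides_trans dg1; rewrite eg mulrC;
  exists c%:P.
have g0 : g != 0 by rewrite -size_poly_gt0; lia.
exists g => //; split=> //; first by apply: not_unit_poly; rewrite szg.
move=> u v [w ew].
have [c' [m [al [be [c'0 m0 em dmu dmg]]]]] := quasi_gcd u g0.
have [lt1|le1] := ltnP 1 (size m).
  (* m has the degree of g by minimality, and g is primitive: g divides m *)
  left; apply: divides_trans dmu.
  have [s es] := dmg.
  have s0 : s != 0 by apply: contraNneq g0 => e; rewrite es e mulr0.
  have : (size g <= size m)%N.
    by rewrite szg; apply: ming; split=> //; apply: divides_trans dg.
  rewrite {1}es size_mul // => le.
  have /size1_polyC es1 : (size s <= 1)%N by lia.
  apply: (@cancel_constant s`_0 g m 1) => //.
    by rewrite -polyC_eq0 -es1.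
  by rewrite -es1 mulr1 mulrC es.
have em1 := size1_polyC le1.
right; apply: (@cancel_constant (c' * m`_0) g v (al * w + be * v)) => //.
  by rewrite mulf_neq0 // -polyC_eq0 -em1.
rewrite polyCM -em1 em mulrDl -[al * u * v]mulrA ew; ring.
Qed.

Lemma poly_factorial : factorial {poly A}.
Proof.
have [delta [dM d0 dP]] := facA.
have d1 : delta 1 = 0%N.
  by have := dM 1 1 (oner_neq0 _) (oner_neq0 _); rewrite mulr1; lia.
exists (fun f => ((size f).-1 + delta (lead_coef f))%N); split.
- move=> f g f0 g0; rewrite lead_coefM size_mul // dM ?lead_coef_eq0 //.
  by move: f0 g0; rewrite -!size_poly_gt0; lia.
- move=> f f0 e; have [sz dl] : (size f <= 1)%N /\ delta (lead_coef f) = 0%N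
    by lia.
  have ef := size1_polyC sz; move: dl f0;
    rewrite ef lead_coefC polyC_eq0 => dl f0.
  by have [z ez] := d0 _ f0 dl; exists z%:P; rewrite -polyCM -ez.
move=> f f0 nu; have [/poly_prime_divisor//|le1] := ltnP 1 (size f).
have ef := size1_polyC le1; move: f0 nu; rewrite ef polyC_eq0 => f0 nu.
have [|x xp [z ez]] := dP f`_0 f0.
  by move=> [z ez]; apply: nu; exists z%:P; rewrite -polyCM -ez.
by exists x%:P; [apply: prime_polyC | exists z%:P; rewrite -polyCM -ez].
Qed.

(** Thus [u] and [v] have no common zero over the points of the base where [r]
    does not vanish. *)
Lemma coprime_bezout u v : v != 0 ->
  (forall g, prime_elt g -> divides g u -> divides g v -> False) ->
  exists al be r, r != 0 /\ al * u + be * v = r%:P.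
Proof.
move=> v0 cop; have [c [m [al [be [c0 m0 em du dv]]]]] := quasi_gcd u v0.
have le1 : (size m <= 1)%N.
  rewrite leqNgt; apply/negP => /poly_prime_divisor[g gp dg].
  by apply: (cop g gp); [apply: divides_trans du | apply: divides_trans dv].
have e1 := size1_polyC le1.
exists al, be, (c * m`_0); split; last by rewrite -em {1}e1 polyCM.
by rewrite mulf_neq0 // -polyC_eq0 -e1.
Qed.

End PolyFactorial.

Lemma reduce_fraction (A : idomainType) (facA : factorial A) (u v : A) :
  v != 0 ->
  exists d u' v', [/\ u = d * u', v = d * v', d != 0 &
    forall x, prime_elt x -> divides x u' -> divides x v' -> False].
Proof.
have [delta [dM d0 dP]] := facA.
have [k] := ubnP (delta v).
elim: k u v => // k IH u v; rewrite ltnS => hk v0.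
have [[x [xp [u1 eu] [v1 ev]]]|n] :=
    pselect (exists x, [/\ prime_elt x, divides x u & divides x v]); last first.
  by exists 1, u, v; rewrite !mul1r oner_neq0; split=> // x *; apply: n;
    exists x.
have [x0 x1 _] := xp.
have v10 : v1 != 0 by apply: contraNneq v0 => e; rewrite ev e mulr0.
have [|d [u' [v' [eu1 ev1 dn0 cop]]]] := IH u1 v1 _ v10.
  have : delta x <> 0%N by move=> /(d0 _ x0)/x1.
  by move: hk; rewrite ev dM //; lia.
rewrite eu ev eu1 ev1; exists (x * d), u', v'; rewrite !mulrA mulf_neq0 //.
Qed.

(** * Iterated polynomials *)

Section Ipoly.
Variable R : realType.

(** Polynomials in the variables of index below [n], the last one outermost.
    Points are sequences [nat -> R], so that all the dimensions share one type
    of points. *)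
Fixpoint ipoly (n : nat) : idomainType :=
  if n is m.+1 then {poly ipoly m} else R.

Lemma ipoly_factorial n : factorial (ipoly n).
Proof.
elim: n => [|n IH] /=; last exact: poly_factorial.
exists (fun=> 0%N); split=> // [a a0 _|a a0 na].
  by exists a^-1; rewrite mulfV.
by case: na; exists a^-1; rewrite mulfV.
Qed.

(** The evaluation has values in an arbitrary commutative ring [B], so that it
    also provides substitutions and restrictions to curves and planes. *)
Section Eval.
Variables (B : comNzRingType) (h : {rmorphism R -> B}) (e : nat -> B).

Fixpoint iev (n : nat) : {rmorphism ipoly n -> B} :=
  if n is m.+1 then
    horner_morph (fun a => mulrC (e m) (iev m a) : GRing.comm (e m) (iev m a))
  else h.

Lemma iev_polyC n (c : ipoly n) : iev n.+1 c%:P = iev n c.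
Proof. exact: horner_morphC. Qed.

Lemma iev_polyX n : iev n.+1 'X = e n.
Proof. exact: horner_morphX. Qed.

Lemma iev_poly n (p : {poly ipoly n}) : iev n.+1 p = (map_poly (iev n) p).[e n].
Proof. by []. Qed.
End Eval.

Lemma iev_comp (B B' : comNzRingType) (h : {rmorphism R -> B})
   (h' : {rmorphism R -> B'}) (g : {rmorphism B -> B'}) (e : nat -> B)
   (e' : nat -> B') n (p : ipoly n) :
   (forall c, g (h c) = h' c) -> (forall i, (i < n)%N -> g (e i) = e' i) ->
  g (iev h e n p) = iev h' e' n p.
Proof.
move=> gh; elim: n p => [|n IH] p ge /=; first exact: gh.
rewrite /horner_morph -horner_map ge // -map_poly_comp; congr (_.[_]).
by apply: eq_map_poly => a /=; apply: IH => i hi; apply: ge; lia.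
Qed.

Definition ieval (e : nat -> R) n : {rmorphism ipoly n -> R} := iev idfun e n.

Lemma ieval_comp (B : comNzRingType) (h : {rmorphism R -> B})
   (g : {rmorphism B -> R}) (s : nat -> B) e n (p : ipoly n) :
   (forall c, g (h c) = c) -> (forall i, (i < n)%N -> g (s i) = e i) ->
  g (iev h s n p) = ieval e n p.
Proof. by move=> gh ge; apply: iev_comp. Qed.

Lemma eq_ieval e e' n (p : ipoly n) :
  (forall i, (i < n)%N -> e i = e' i) -> ieval e n p = ieval e' n p.
Proof. exact: (@iev_comp _ _ idfun idfun idfun). Qed.

Definition upd (e : nat -> R) i t := fun j => if j == i then t else e j.

Lemma ieval_upd e n t (p : {poly ipoly n}) :
  ieval (upd e n t) n.+1 p = (map_poly (ieval e n) p).[t].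
Proof.
rewrite /ieval iev_poly /upd eqxx; congr (_.[_]); apply: eq_map_poly => a.
by apply: eq_ieval => i hi; case: eqP => // ein; move: hi; rewrite ein ltnn.
Qed.

Fixpoint iconst n : {rmorphism R -> ipoly n} :=
  if n is m.+1 then polyC \o iconst m else idfun.

Lemma ieval_iconst e n c : ieval e n (iconst n c) = c.
Proof. by elim: n => //= n IH; rewrite /ieval iev_polyC. Qed.

Fixpoint ivar n i : ipoly n :=
  if n is m.+1 then (if i == m then 'X else (ivar m i)%:P) else 0.

Lemma ieval_ivar e n i : (i < n)%N -> ieval e n (ivar n i) = e i.
Proof.
elim: n => // n IH; rewrite ltnS leq_eqVlt [ivar _ _]/=.
case: eqP => [-> _|_ /= hi]; first exact: iev_polyX.
by rewrite /ieval iev_polyC; apply: IH.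
Qed.

Definition isubst n (s : nat -> ipoly n) m : ipoly m -> ipoly n :=
  iev (iconst n) s m.

Lemma ieval_isubst e n s m (p : ipoly m) :
  ieval e n (isubst s p) = ieval (fun i => ieval e n (s i)) m p.
Proof. by apply: ieval_comp => // c; exact: ieval_iconst. Qed.

Lemma roots_finite (p : {poly R}) : p != 0 -> finite_set [set x | p.[x] = 0].
Proof.
move=> p0; apply: contrapT => /(infinite_set_fset (size p))[F FS].
rewrite leqNgt cardfE => /negP; apply; rewrite -cardfE.
apply: max_poly_roots => //; last exact: fset_uniq.
by apply/allP => x xF; apply/rootP/FS.
Qed.

Lemma interval_uncountable (D : set R) : `[1, 2] `<=` D -> ~ countable D.
Proof.
move=> sub cD; have : countable (`[1, 2] : set R).
  by apply: sub_countable cD; exact: subset_card_le.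
move/countable_lebesgue_measure0; rewrite lebesgue_measure_itv /= lte_fin.
rewrite ltr1n /= -EFinD => /eqP; rewrite eqe => /eqP; lra.
Qed.

Lemma uncountable_infinite T (D : set T) : ~ countable D -> infinite_set D.
Proof. by move=> nD fD; apply: nD; exact: finite_set_countable. Qed.

(** Choose the coordinates one after the other: the leading coefficients of the
    [c d] do not vanish at the first ones, by induction, and each [c d] then
    excludes finitely many values of the last one. *)
Lemma avoid_zeros (D : set R) n (c : nat -> ipoly n) : ~ countable D ->
  (forall d, c d != 0) ->
  exists e, (forall i, D (e i)) /\ forall d, ieval e n (c d) != 0.
Proof.
move=> uD; elim: n c => [|n IH] c c0.
  have [t Dt] := infinite_setN0 (uncountable_infinite uD).
  by exists (fun=> t); split.
have [|e [De le]] := IH (fun d => lead_coef (c d)).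
  by move=> d; rewrite lead_coef_eq0.
have p0 d : map_poly (ieval e n) (c d) != 0.
  apply: contraNneq (le d) => /(congr1 (fun p :
    {poly R} => p`_(size (c d)).-1)).
  by rewrite coef_map coef0 => <-.
have [t [Dt ht]] : exists t, D t /\ forall d, (map_poly (ieval e n) (c d)).[t]
  != 0.
  apply: contrapT => nt; apply: uD.
  apply: (@sub_countable _ _ _
    (\bigcup_(d in [set: nat]) [set t | (map_poly (ieval e n) (c d)).[t] = 0])).
    apply: subset_card_le => t Dt; apply: contrapT => nd; apply: nt.
    exists t; split=> // d; apply/eqP => hd; apply: nd; by exists d.
  apply: bigcup_countable => // d _; apply: finite_set_countable.
  exact: roots_finite.
exists (upd e n t); split=> [i|d]; first by rewrite /upd; case: eqP.
by rewrite ieval_upd.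
Qed.

Lemma ieval_neq0 n (p : ipoly n) : p != 0 -> exists e, ieval e n p != 0.
Proof.
move=> p0; have [||e [_ he]] := @avoid_zeros [set: R] n (fun=> p).
- exact: interval_uncountable.
- by [].
by exists e; exact: (he 0%N).
Qed.

(** Clearing denominators. The morphisms [g] are the evaluations: the numerator
    [b] is the same at all the points. *)
Lemma ieval_fraction (B : comNzRingType) (h : {rmorphism R -> B}) (s : nat -> B)
    (w : B) n (p : ipoly n) : exists N b, forall g : {rmorphism B -> R},
  (forall c, g (h c) = c) -> g w != 0 ->
  g b = g w ^+ N * ieval (fun i => g (s i) / g w) n p.
Proof.
elim: n p => [|n IH] p.
  by exists 0%N, (h p) => g gh _; rewrite expr0 mul1r gh.
elim/poly_ind: p => [|p c [N [b hb]]].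
  by exists 0%N, 0 => g gh gw; rewrite !rmorph0 mulr0.
have [M [d hd]] := IH c.
exists (N + M).+1, (w ^+ M * b * s n + w ^+ N.+1 * d) => g gh gw.
rewrite rmorphD !rmorphM !rmorphXn hb // hd // rmorphD rmorphM /=.
rewrite {2}/ieval iev_polyX {2}/ieval iev_polyC -/(ieval _ _).
rewrite !exprS exprD; field.
exact: gw.
Qed.
End Ipoly.
(* Unification is not to unfold the recursive evaluation. *)
#[global] Opaque iev ieval.

(** * Polynomial functions on row vectors *)
Section Mpoly.
Variables (R : realType) (n : nat).

Definition coords (x : 'rV[R]_n) : nat -> R :=
  fun j => if insub j is Some i then x 0 i else 0.

Definition row_of (e : nat -> R) : 'rV[R]_n := \row_i e i.

Lemma coordsE x (i : 'I_n) : coords x i = x 0 i.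
Proof. by rewrite /coords valK. Qed.

Lemma coordsK : cancel coords row_of.
Proof. by move=> x; apply/rowP => i; rewrite mxE coordsE. Qed.

Lemma coords_row e i : (i < n)%N -> coords (row_of e) i = e i.
Proof. by move=> hi; rewrite (coordsE _ (Ordinal hi)) mxE. Qed.

Definition ipoly_mpoly (p : ipoly R n) : mpoly.mpoly n R :=
  @iev R (mpoly.mpoly n R) (@mpoly.mpolyC n R) (fun i => if insub i is Some j
    then mpoly.mpolyX R (mpoly.mnm1 j) else 0) n p.

Lemma peval_ipoly p x : peval (ipoly_mpoly p) x = ieval (coords x) n p.
Proof.
rewrite /peval /ipoly_mpoly; apply: ieval_comp => [c|i hi] /=.
  by rewrite mpoly.mevalC.
by rewrite insubT /= mpoly.mevalXU (coordsE _ (Sub i hi)).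
Qed.

(** Evaluation of a multivariate polynomial in a commutative ring [B]. *)
Definition mpoly_eval (B : comNzRingType) (h : {rmorphism R -> B})
    (s : nat -> B) (P : mpoly.mpoly n R) : B :=
  mpoly.mmap h (fun i : 'I_n => s i) P.

Lemma mpoly_evalP (B : comNzRingType) (h : {rmorphism R -> B})
    (s : nat -> B) (g : {rmorphism B -> R}) P :
  (forall c, g (h c) = c) ->
  g (mpoly_eval h s P) = peval P (row_of (fun i => g (s i))).
Proof.
move=> gh; rewrite /mpoly_eval /peval /mpoly.meval /mpoly.mmap rmorph_sum.
apply: eq_bigr => m _; rewrite rmorphM gh; congr (_ * _).
rewrite /mpoly.mmap1 rmorph_prod; apply: eq_bigr => i _.
by rewrite rmorphXn mxE.
Qed.

Definition mpoly_ipoly (P : mpoly.mpoly n R) : ipoly R n :=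
  mpoly_eval (iconst R n) (ivar R n) P.

Lemma ieval_mpoly P e : ieval e n (mpoly_ipoly P) = peval P (row_of e).
Proof.
rewrite /mpoly_ipoly mpoly_evalP; last exact: ieval_iconst.
by congr peval; apply/rowP => i; rewrite !mxE ieval_ivar.
Qed.

End Mpoly.

(** * Separately rational functions *)

Section SeparatelyRational.
Variables (R : realType) (D : set R).
Hypothesis uD : ~ countable D.

Definition box n (e : nat -> R) := forall i, (i < n)%N -> D (e i).

Definition separately_rational n (g : (nat -> R) -> R) :=
  forall e i, (i < n)%N -> box n e -> exists p q : {poly R}, forall t, D t ->
    q.[t] != 0 /\ q.[t] * g (upd e i t) = p.[t].

Definition depends_below n (g : (nat -> R) -> R) :=
  forall e e', (forall i, (i < n)%N -> e i = e' i) -> g e = g e'.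

Lemma poly_eq_on (A : set R) (p q : {poly R}) : infinite_set A ->
  (forall t, A t -> p.[t] = q.[t]) -> p = q.
Proof.
move=> iA h; apply/eqP; rewrite -subr_eq0; apply: contraT => /roots_finite fr.
case: iA; apply: sub_finite_set fr => t At /=.
by rewrite hornerD hornerN h ?subrr.
Qed.

Lemma upd_box n e y : D y -> box n e -> box n.+1 (upd e n y).
Proof.
move=> Dy be i; rewrite ltnS leq_eqVlt /upd; case: eqP => // _ /=.
exact: be.
Qed.

Lemma separately_rational_slice n g y : D y ->
  separately_rational n.+1 g -> separately_rational n (fun e => g (upd e n y)).
Proof.
move=> Dy sg e i hi be.
have [||p [q h]] := sg (upd e n y) i; [lia | exact: upd_box |].
exists p, q => t Dt; have [q0 <-] := h t Dt; split=> //.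
congr (_ * g _); apply/funext => j; rewrite /upd.
by case: eqP => // ->; case: eqP => // ni; move: hi; rewrite ni ltnn.
Qed.

Lemma depends_below_slice n g y :
  depends_below n.+1 g -> depends_below n (fun e => g (upd e n y)).
Proof.
move=> dg e e' h; apply: dg => i; rewrite ltnS leq_eqVlt /upd.
by case: eqP => // _ /=; exact: h.
Qed.

Lemma ieval_slice n e y (p : {poly ipoly R n}) :
  ieval e n p.[iconst R n y] = ieval (upd e n y) n.+1 p.
Proof. by rewrite -horner_map ieval_iconst ieval_upd. Qed.

Lemma slice_line n e t (p : {poly ipoly R n}) :
  (map_poly (ieval e n) p).[t] = ieval (upd e n t) n.+1 p.
Proof. by rewrite ieval_upd. Qed.

(** By induction, the identity holds on the slices of the box on which [W] does
    not vanish identically. They meet every line parallel to the last axis in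
    infinitely many points, which suffices for a rational function. *)
Lemma identity_spreads n g (W F1 F2 : ipoly R n) :
  separately_rational n g -> depends_below n g -> W != 0 ->
  (forall e, box n e -> ieval e n W != 0 ->
     ieval e n F1 * g e = ieval e n F2) ->
  forall e, box n e -> ieval e n F1 * g e = ieval e n F2.
Proof.
elim: n g W F1 F2 => [|n IH] g W F1 F2 sg dg W0 h e be; first exact: h.
have [e0 he0] := ieval_neq0 W0.
have slice y : D y -> (map_poly (ieval e0 n) W).[y] != 0 ->
    forall e, box n e ->
    ieval (upd e n y) n.+1 F1 * g (upd e n y) = ieval (upd e n y) n.+1 F2.
  move=> Dy Wy e1 be1; rewrite -!ieval_slice.
  apply: (IH (fun e => g (upd e n y)) W.[iconst R n y]) be1.
  - exact: separately_rational_slice.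
  - exact: depends_below_slice.
  - by apply: contraNneq Wy => e2; rewrite slice_line -ieval_slice e2 rmorph0.
  - move=> e2 be2; rewrite !ieval_slice => hW; apply: h => //.
    exact: upd_box.
have [p [q hpq]] := sg e n (ltnSn n) be.
have en : upd e n (e n) = e by apply/funext => j; rewrite /upd; case:
  eqP => // ->.
have iG : infinite_set (D `\` [set y | (map_poly (ieval e0 n) W).[y] = 0]).
  apply: infinite_setD; first exact: (uncountable_infinite uD).
  apply: roots_finite; apply: contraNneq he0 => e1.
  have -> : e0 = upd e0 n (e0 n) by apply/funext => j; rewrite /upd; case:
    eqP => // ->.
  by rewrite -slice_line e1 horner0.
have /(congr1 (fun p : {poly R} => p.[e n])) :
    map_poly (ieval e n) F1 * p = map_poly (ieval e n) F2 * q.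
  apply: (poly_eq_on iG) => t [Dt /eqP Wt]; have [q0 e1] := hpq t Dt.
  rewrite hornerM (hornerM _ q) -e1 slice_line slice_line mulrCA slice //.
    by rewrite mulrC.
  by move=> i hi; apply: be; lia.
have Den : D (e n) by exact: be.
have [q0] := hpq _ Den; rewrite hornerM (hornerM _ q) slice_line slice_line en
  => <-.
by rewrite mulrCA mulrC => /(mulIf q0).
Qed.

(** Otherwise the sets of parameters with a given bound for the degrees would
    lie on hypersurfaces, and countably many hypersurfaces do not cover [D^n].
    *)
Lemma bounded_degree n g : separately_rational n.+1 g -> exists d,
  forall c : ipoly R n, c != 0 -> exists e, [/\ box n e, ieval e n c != 0 &
    exists p q : {poly R}, [/\ (size p <= d)%N, (size q <= d)%N &
      forall t, D t -> q.[t] != 0 /\ q.[t] * g (upd e n t) = p.[t]]].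
Proof.
move=> sg; apply: contrapT => nd.
have {}nd d : exists c : ipoly R n, c != 0 /\ forall e, box n e ->
  ieval e n c != 0 ->
    ~ exists p q : {poly R}, [/\ (size p <= d)%N, (size q <= d)%N &
      forall t, D t -> q.[t] != 0 /\ q.[t] * g (upd e n t) = p.[t]].
  apply: contrapT => hc; apply: nd; exists d => c c0.
  apply: contrapT => he; apply: hc; exists c; split=> // e be ce pq.
  by apply: he; exists e.
have [c hc] := choice nd.
have [e [De ce]] := avoid_zeros uD (fun d => (hc d).1).
have [p [q hpq]] := sg e n (ltnSn n) (fun i _ => De i).
have [_ /(_ e)] := hc (maxn (size p) (size q)); case=> //.
by exists p, q; rewrite leq_maxl leq_maxr.
Qed.
(** The [d + d.+1] coefficients of [u] and [w] are subject to [d + d] linear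
    equations. *)
Lemma rational_interpolation (A : idomainType) d (a P Q : nat -> A) :
  exists u w : {poly A}, [/\ (size u <= d)%N, (size w <= d.+1)%N,
    (u != 0) || (w != 0) &
    forall i, (i < d + d)%N -> u.[a i] * P i = w.[a i] * Q i].
Proof.
pose U := \matrix_(j < d, i < d + d.+1)
  (if (i < d + d)%N then P i * a i ^+ j else 0).
pose V := \matrix_(j < d.+1, i < d + d.+1)
  (if (i < d + d)%N then - (Q i * a i ^+ j) else 0).
have : \det (col_mx U V) == 0.
  have lt : (d + d < d + d.+1)%N by rewrite addnS.
  rewrite (expand_det_col _ (Ordinal lt)) big1 // => j _.
  rewrite [X in X * _](_ : _ = 0) ?mul0r // mxE.
  by case: splitP => k _; rewrite mxE /= ltnn.
case/det0P => v v0 vM; rewrite -[v]hsubmxK in v0 vM.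
move: (lsubmx v) (rsubmx v) v0 vM => x y v0; rewrite mul_row_col => vM.
have hE k (z : 'rV[A]_k) t : (rVpoly z).[t] = \sum_(j < k) z 0 j * t ^+ j.
  rewrite (@horner_coef_wide _ k) ?size_poly //.
  by apply: eq_bigr => j _; rewrite coef_rVpoly_ord.
exists (rVpoly x), (rVpoly y); split; [exact: size_poly.. | |].
  apply: contraNT v0; rewrite negb_or !negbK => /andP[/eqP x0 /eqP y0].
  by rewrite -[x]rVpolyK -[y]rVpolyK x0 y0 !linear0 row_mx0.
move=> i hi; have hi' : (i < d + d.+1)%N by rewrite addnS ltnW.
move/rowP: vM => /(_ (Ordinal hi')); rewrite !mxE => /eqP.
under eq_bigr do rewrite mxE /= hi.
under [X in _ + X]eq_bigr do rewrite mxE /= hi mulrN.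
rewrite sumrN subr_eq0 => /eqP e; rewrite !hE !mulr_suml.
rewrite (eq_bigr (fun j => x 0 j * (P i * a i ^+ j))) => [|j _]; last by ring.
by rewrite e; apply: eq_bigr => j _; ring.
Qed.

(** Fix [2 d] values [y i] of the last variable. By induction [g] is a rational
    function of the other variables at each of them. Interpolate these
    functions by a fraction [w / u] of degree [d] in the last variable: where
    the partial function of [g] has degree at most [d], it agrees with [w / u]
    at [2 d] points, hence everywhere, and such parameters are Zariski dense.
    *)
Theorem separately_rational_is_rational n g :
  separately_rational n g -> depends_below n g ->
  exists Q P : ipoly R n, Q != 0 /\
    forall e, box n e -> ieval e n Q * g e = ieval e n P.
Proof.
elim: n g => [|n IH] g sg dg.
  exists 1, (g (fun=> 0)); rewrite oner_neq0; split=> // e _.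
  by rewrite rmorph1 mul1r; apply: dg.
have slice t : exists PQ : ipoly R n * ipoly R n, D t -> PQ.2 != 0 /\
    forall e, box n e -> ieval e n PQ.2 * g (upd e n t) = ieval e n PQ.1.
  have [Dt|nD] := pselect (D t); last by exists (0, 0).
  have [|Q [P hQ]] := IH _ (separately_rational_slice Dt sg).
    exact: depends_below_slice.
  by exists (P, Q).
have [PQ hPQ] := choice slice.
have [d hd] := bounded_degree sg.
have [s [us szs sD]] : exists s : seq R,
    [/\ uniq s, size s = (d + d)%N & forall t, t \in s -> D t].
  have [F FD szF] := infinite_set_fset (d + d) (uncountable_infinite uD).
  exists (take (d + d) (enum_fset F)); split.
  - exact/take_uniq/fset_uniq.
  - by rewrite size_takel.
  - by move=> t /mem_take tF; apply: FD.
pose y i : R := nth 0 s i.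
have Dy i : (i < d + d)%N -> D (y i) by move=> hi; apply/sD/mem_nth;
  rewrite szs.
have [u [w [szu szw uw0 huw]]] := rational_interpolation d
  (fun i => iconst R n (y i)) (fun i => (PQ (y i)).1) (fun i => (PQ (y i)).2).
(* the points where the interpolating pair survives, off the denominators *)
pose c := (if u != 0 then lead_coef u else lead_coef w) *
  \prod_(i < d + d) (PQ (y i)).2.
have c0 : c != 0.
  apply: mulf_neq0.
    by case: ifP uw0 => [u0 _|_ /= w0]; rewrite lead_coef_eq0.
  by apply/prodf_neq0 => i _; have [] := hPQ _ (Dy i (ltn_ord i)).
have key e : box n e -> ieval e n c != 0 ->
   (exists p q : {poly R}, [/\ (size p <= d)%N, (size q <= d)%N &
      forall t, D t -> q.[t] != 0 /\ q.[t] * g (upd e n t) = p.[t]]) ->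
   map_poly (ieval e n) u != 0 /\ forall t, D t ->
     ieval (upd e n t) n.+1 u * g (upd e n t) = ieval (upd e n t) n.+1 w.
  move=> be ce [p [q [szp szq hpq]]].
  have eq_uw : map_poly (ieval e n) u * p = map_poly (ieval e n) w * q.
    apply/eqP; rewrite -subr_eq0; apply: contraT => /max_poly_roots.
    move=> /(_ s) nroots.
    have : (size s < size (map_poly (ieval e n) u * p -
        map_poly (ieval e n) w * q)%R)%N.
      apply: nroots => //; apply/allP => t ts; apply/rootP.
      have hi : (index t s < d + d)%N by rewrite -szs index_mem.
      have := huw _ hi; have := hPQ _ (Dy _ hi); rewrite /y nth_index //.
      case=> Q0 /(_ e be) hg /(congr1 (ieval e n)).
      rewrite !rmorphM ieval_slice ieval_slice -hg => e1.
      have Qe : ieval e n (PQ t).2 != 0.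
        move: ce; rewrite /c rmorphM rmorph_prod mulf_eq0 negb_or => /andP[_].
        move/prodf_neq0 => /(_ (Ordinal hi) isT) /=.
        by rewrite /y nth_index.
      have [q0 hq] := hpq t (sD t ts).
      rewrite hornerD hornerN hornerM (hornerM _ q) -hq.
      rewrite slice_line slice_line; apply/eqP.
      rewrite subr_eq0; apply/eqP/(mulfI Qe).
      transitivity (q.[t] * (ieval (upd e n t) n.+1 u *
        (ieval e n (PQ t).2 * g (upd e n t)))); first by ring.
      by rewrite e1; ring.
    rewrite szs ltnNge => /negP; case.
    have hm k (v : {poly ipoly R n}) : (size v <= k)%N ->
        (size (map_poly (ieval e n) v) <= k)%N.
      by apply: leq_trans; exact: size_poly.
    apply: leq_trans (size_polyD _ _) _; rewrite size_polyN geq_max.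
    apply/andP; split; apply: leq_trans (size_polyMleq _ _) _.
      by apply: leq_trans (leq_pred _) _; apply: leq_add szp; exact: hm.
    by rewrite -subn1 leq_subLR add1n -addSn; apply: leq_add szq; exact: hm.
  split=> [|t Dt].
    apply: contraTneq ce => u0.
    have w0 : map_poly (ieval e n) w = 0.
      move/eqP: eq_uw; rewrite u0 mul0r eq_sym mulf_eq0 => /orP[/eqP//|/eqP q0].
      have [t /hpq[]] := infinite_setN0 (uncountable_infinite uD).
      by rewrite q0 horner0 eqxx.
    have l0 (v : {poly ipoly R n}) : map_poly (ieval e n) v = 0 ->
        ieval e n (lead_coef v) = 0.
      by move=> v0; rewrite lead_coefE -coef_map v0 coef0.
    by rewrite negbK /c rmorphM; case: ifP => _; rewrite l0 // mul0r.
  have [q0 hq] := hpq t Dt; apply: (mulfI q0).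
  rewrite mulrCA hq -slice_line -slice_line -hornerM eq_uw hornerM; ring.
have u0 : u != 0.
  have [e [be ce hpq]] := hd c c0; have [h _] := key e be ce hpq.
  by apply: contraNneq h => ->; rewrite map_poly0.
exists u, w; split=> // e be.
have Den : D (e n) by apply: be.
have en : upd e n (e n) = e by apply/funext => j; rewrite /upd; case:
  eqP => // ->.
rewrite -en -!ieval_slice.
have [Q0 hQ] := hPQ _ Den.
apply: (@identity_spreads n (fun e' => g (upd e' n (e n))) (PQ (e n)).2) => //.
- exact: separately_rational_slice.
- exact: depends_below_slice.
move=> e1 be1 Qe1.
have W0 : u.[iconst R n (e n)] * (PQ (e n)).1 -
          w.[iconst R n (e n)] * (PQ (e n)).2 = 0.
  apply/eqP; apply: contraT => W0.
  have [e2 [be2 ce2 hpq]] := hd _ (mulf_neq0 c0 W0).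
  move: ce2; rewrite rmorphM mulf_eq0 negb_or => /andP[ce2].
  rewrite rmorphB !rmorphM -hQ // ieval_slice ieval_slice.
  have [_ /(_ _ Den) <-] := key e2 be2 ce2 hpq.
  by move/eqP; case; ring.
move/(congr1 (ieval e1 n)): W0; rewrite rmorph0 rmorphB !rmorphM -hQ // => W0.
apply: (mulfI Qe1); apply/eqP; rewrite -subr_eq0; apply/eqP.
rewrite -[RHS]W0; ring.
by move=> i hi; apply: be; lia.
Qed.
End SeparatelyRational.

(** * Vanishing orders of polynomials in one and two variables *)
Section Orders.
Variable R : realType.
Implicit Types (p q : {poly R}) (W : {poly {poly R}}).

(** Polynomials in two variables are written with the first variable outermost.
    *)
Definition bev (s y : R) : {rmorphism {poly {poly R}} -> R} :=
  horner_eval y \o horner_eval s%:P.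

Lemma bevE s y W : bev s y W = (W.[s%:P]).[y].
Proof. by []. Qed.

Lemma poly_bounded p : exists2 K, 0 <= K & forall x, `|x| <= 1 -> `|p.[x]| <= K.
Proof.
elim/poly_ind: p => [|p c [K K0 hK]].
  by exists 0 => // x _; rewrite horner0 normr0.
exists (K + `|c|) => [|x x1]; first by rewrite addr_ge0.
rewrite hornerMXaddC (le_trans (ler_normD _ _)) // lerD2r normrM.
by rewrite -[K]mulr1 ler_pM // hK.
Qed.

Lemma bev_bounded W : exists2 K, 0 <= K &
  forall s y, `|s| <= 1 -> `|y| <= 1 -> `|bev s y W| <= K.
Proof.
elim/poly_ind: W => [|W c [K K0 hK]].
  by exists 0 => // s y _ _; rewrite rmorph0 normr0.
have [K' K'0 hK'] := poly_bounded c.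
exists (K + K') => [|s y s1 y1]; first by rewrite addr_ge0.
rewrite bevE hornerMXaddC hornerD hornerM hornerC.
rewrite (le_trans (ler_normD _ _)) // lerD // ?hK' // normrM.
by rewrite -[K]mulr1 ler_pM // -bevE hK.
Qed.

Lemma bev_lipschitz W : exists2 K, 0 <= K &
  forall s s' y, `|s| <= 1 -> `|s'| <= 1 -> `|y| <= 1 ->
    `|bev s y W - bev s' y W| <= K * `|s - s'|.
Proof.
elim/poly_ind: W => [|W c [K K0 hK]].
  by exists 0 => // s s' y _ _ _; rewrite !rmorph0 subr0 normr0 mul0r.
have [B B0 hB] := bev_bounded W.
exists (K + B) => [|s s' y s1 s1' y1]; first by rewrite addr_ge0.
have -> : bev s y (W * 'X + c%:P) - bev s' y (W * 'X + c%:P) =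
    (bev s y W - bev s' y W) * s + bev s' y W * (s - s').
  by rewrite !bevE !hornerMXaddC !hornerD !hornerM !hornerC; ring.
rewrite (le_trans (ler_normD _ _)) // !normrM mulrDl lerD //.
  by rewrite -[K * _]mulr1 ler_pM // hK.
by rewrite ler_wpM2r // hB.
Qed.

Lemma small_imp0 (c K d : R) : 0 < d -> 0 <= K ->
  (forall t, 0 < t < d -> `|c| <= K * t) -> c = 0.
Proof.
move=> d0 K0 h; apply/eqP; rewrite -normr_le0 leNgt; apply/negP => c0.
pose t := Num.min (d / 2) (`|c| / (2 * (K + 1))).
have t0 : 0 < t by rewrite lt_min !divr_gt0 // mulr_gt0 // ltr_wpDl.
have td : t < d by rewrite gt_min; apply/orP; left; lra.
have := h t; rewrite t0 td => /(_ isT).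
have : K * t <= K * (`|c| / (2 * (K + 1)))
  by rewrite ler_wpM2l // ge_min lexx orbT.
have -> : K * (`|c| / (2 * (K + 1))) = `|c| * (K / (2 * (K + 1))) by field; lra.
have : K / (2 * (K + 1)) < 1 by rewrite ltr_pdivrMr; lra.
move=> lt1 le1 le2; have : `|c| * (K / (2 * (K + 1))) < `|c| * 1
  by rewrite ltr_pM2l.
lra.
Qed.

Lemma poly_order p (K d : R) M : 0 < d ->
  (forall t, 0 < t < d -> `|p.[t]| <= K * t ^+ M) ->
  forall l, (l < M)%N -> p`_l = 0.
Proof.
move=> d0 h.
wlog [K0 d1] : K d d0 h / 0 <= K /\ d <= 1.
  move=> wl; apply: (wl `|K| (Num.min d 1)).
  - by rewrite lt_min d0 ltr01.
  - move=> t /andP[t0]; rewrite lt_min => /andP[td _].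
    apply: (le_trans (h t _)); first by rewrite t0.
    by apply: (ler_wpM2r (exprn_ge0 _ (ltW t0)) (ler_norm K)).
  - by rewrite normr_ge0 ge_min lexx orbT.
elim: M h => // M IH h.
have {}IH : forall l, (l < M)%N -> p`_l = 0.
  apply: IH => t /andP[t0 td]; apply: (le_trans (h t _)); rewrite ?t0 //.
  by rewrite ler_wpM2l // exprS ger_pMl ?exprn_gt0 //; lra.
move=> l; rewrite ltnS leq_eqVlt => /orP[/eqP->|/IH//].
have ep : p = drop_poly M p * 'X^M.
  rewrite -{1}[p](poly_take_drop M) [take_poly M p](_ : _ = 0) ?add0r //.
  by apply/polyP => i; rewrite coef_take_poly coef0; case: ifP => // /IH.
set q := drop_poly M p in ep.
have hq t : 0 < t < d -> `|q.[t]| <= K * t.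
  move=> td; have := h t td; have /andP[t0 _] := td.
  rewrite ep hornerM hornerXn normrM (ger0_norm (exprn_ge0 _ (ltW t0))).
  by rewrite exprS mulrA ler_pM2r // exprn_gt0.
have -> : p`_M = q`_0 by rewrite ep coefMXn ltnn subnn.
have [q' [c eq]] : exists q' c, q = q' * 'X + c%:P.
  by elim/poly_ind: (q) => [|q' c _]; [exists 0, 0;
    rewrite mul0r add0r | exists q', c].
have [B B0 hB] := poly_bounded q'.
rewrite eq coefD coefMX coefC /= add0r.
apply: (@small_imp0 c (K + B) d) => // [|t td]; first by rewrite addr_ge0.
have /andP[t0 t1] := td; have := hq t td; rewrite eq hornerMXaddC => h1.
have -> : c = (q'.[t] * t + c) - q'.[t] * t by ring.
rewrite (le_trans (ler_normB _ _)) // mulrDl lerD // normrM (gtr0_norm t0).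
by rewrite ler_pM2r // hB // gtr0_norm //; lra.
Qed.

(** Along the curve [(t ^ a, t ^ b)] the monomials of distinct weights do not
    interfere. *)
Lemma weighted_order W a b M (K d : R) : 0 < d ->
  (forall t, 0 < t < d -> `|bev (t ^+ a) (t ^+ b) W| <= K * t ^+ M) ->
  (forall i j i' j', (a * i + b * j < M)%N ->
     (a * i + b * j = a * i' + b * j')%N -> i = i' /\ j = j') ->
  forall i j, (a * i + b * j < M)%N -> W`_i`_j = 0.
Proof.
move=> d0 h inj i j ij.
pose U : {poly R} := \sum_(k < size W) \sum_(l < size W`_k)
  W`_k`_l *: 'X^(a * k + b * l).
have hU t : U.[t] = bev (t ^+ a) (t ^+ b) W.
  rewrite bevE (horner_coef W) /U !horner_sum; apply: eq_bigr => k _.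
  rewrite hornerM horner_exp hornerC (horner_coef W`_k) mulr_suml horner_sum.
  apply: eq_bigr => l _; rewrite hornerZ hornerXn exprD -!exprM; ring.
have {}h t : 0 < t < d -> `|U.[t]| <= K * t ^+ M by rewrite hU; exact: h.
have := poly_order d0 h ij; rewrite /U coef_sum.
have [si|si] := ltnP i (size W); last by rewrite (nth_default 0 si) coef0.
have [sj|sj] := ltnP j (size W`_i); last by rewrite (nth_default 0 sj).
rewrite (bigD1 (Ordinal si)) //= coef_sum (bigD1 (Ordinal sj)) //=.
rewrite coefZ coefXn eqxx mulr1.
rewrite [X in _ + X + _]big1 => [|l nl]; last first.
  rewrite coefZ coefXn; case: eqP => [e|]; rewrite ?mulr0 //.
  by have [_ e'] := inj _ _ _ _ ij e; case/eqP: nl; apply: val_inj.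
rewrite big1 ?addr0 // => k nk; rewrite coef_sum big1 // => l _.
rewrite coefZ coefXn; case: eqP => [e|]; rewrite ?mulr0 //.
by have [e' _] := inj _ _ _ _ ij e; case/eqP: nk; apply: val_inj.
Qed.

(** The monomials of degree below [N] have distinct orders along the curve
    [(t ^ N, t ^ N.+1)]. *)
Lemma bev_order W N (K d : R) : 0 < d ->
  (forall s y, 0 < s < d -> 0 < y < d ->
     `|bev s y W| <= K * Num.max s y ^+ N) ->
  forall i j, (i + j < N)%N -> W`_i`_j = 0.
Proof.
move=> d0 h i j ij.
wlog d1 : d d0 h / d <= 1.
  move=> wl; apply: (wl (Num.min d 1)).
  - by rewrite lt_min d0 ltr01.
  - by move=> s y; rewrite !lt_min => /and3P[s0 sd _] /and3P[y0 yd _]; apply: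
      h; apply/andP.
  - by rewrite ge_min lexx orbT.
have N0 : (0 < N)%N by lia.
apply: (@weighted_order W N N.+1 (N * N) K d) => //; last by nia.
  move=> t /andP[t0 td].
  have lt k : (0 < k)%N -> 0 < t ^+ k < d.
    move=> k0; rewrite exprn_gt0 //= (le_lt_trans _ td) // -{2}[t]expr1.
    by rewrite ler_wiXn2l //; lra.
  have -> : t ^+ (N * N) = Num.max (t ^+ N) (t ^+ N.+1) ^+ N.
    rewrite exprM max_l // ler_wiXn2l //; lra.
  by apply: h; apply: lt.
move=> k l k' l' lt e.
have lN : (l < N)%N by nia.
have l'N : (l' < N)%N by nia.
have : ((k + l) * N + l = (k' + l') * N + l')%N by nia.
move=> /(congr1 (modn^~ N)); rewrite !modnMDl !modn_small // => ll; split=> //.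
by apply/eqP; rewrite -(eqn_pmul2l N0); apply/eqP; nia.
Qed.
End Orders.

(** * From planes to the whole space *)
Section LocalAlgebra.
Variable R : realType.

Lemma dvdXn_coef (p : {poly R}) M :
  (forall j, (j < M)%N -> p`_j = 0) -> 'X^M %| p.
Proof.
move=> h; rewrite -[p](poly_take_drop M) [take_poly M p](_ : _ = 0).
  by rewrite add0r dvdp_mull.
by apply/polyP => j; rewrite coef_take_poly coef0; case: ifP => // /h.
Qed.

Lemma dvdXn_cancel (p q : {poly R}) e M : q.[0] != 0 ->
  'X^M %| ('X^e * q) * p -> 'X^(M - e) %| p.
Proof.
move=> q0; have [le|/ltnW lt _] := leqP e M; last first.
  by move: lt; rewrite -subn_eq0 => /eqP ->; rewrite expr0 dvd1p.
rewrite -{1}(subnK le) addnC exprD -mulrA dvdp_mul2l ?polyXn_eq0 //; last first.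
  by rewrite expf_neq0 // polyX_eq0.
rewrite Gauss_dvdpr // coprimep_expl //.
by rewrite coprimep_sym coprimep_def -[X in gcdp _ X]subr0 -polyC0
  -coprimep_def coprimep_XsubC.
Qed.

(** Compare the coefficients of the powers of the first variable. Those of
    [Q * S] vanish to a high order before the [k]-th, hence so do those of [S],
    up to a loss of [e] at each step. Therefore the [k]-th coefficient of
    [Q * S] vanishes at the origin, as [Q`_0] does, in contrast with [r`_k]. *)
Lemma no_local_relation (Q S : {poly {poly R}}) (r : {poly R}) k e q N :
  Q`_0 = 'X^e * q -> q.[0] != 0 -> (0 < e)%N ->
  (forall i, (i < k)%N -> r`_i = 0) -> r`_k != 0 ->
  (k + e * k < N)%N ->
  (forall i j, (i + j < N)%N -> (Q * S - map_poly polyC r)`_i`_j = 0) -> False.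
Proof.
move=> eQ q0 e0 r0 rk kN h.
have hdvd i : 'X^(N - i) %| (Q * S)`_i - (r`_i)%:P.
  apply: dvdXn_coef => j hj; have := h i j.
  by rewrite coefB coef_map /=; apply; lia.
have expand i : (Q * S)`_i = Q`_0 * S`_i + \sum_(l < i) Q`_(i - l) * S`_l.
  by rewrite coefMr big_ord_recr /= subnn addrC.
have SX i : (i < k)%N -> 'X^(N - i - e * i.+1) %| S`_i.
  elim/ltn_ind: i => i IH ik; have := hdvd i;
    rewrite r0 // subr0 expand eQ => hd.
  rewrite mulnS addnC subnDA; apply: (dvdXn_cancel q0).
  rewrite -[X in _ %| X](addrK (\sum_(l < i) Q`_(i - l) * S`_l)).
  apply: dvdp_sub; first by apply: dvdp_trans hd; apply: dvdp_exp2l; lia.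
  apply: (big_ind (fun p => 'X^(N - i - e * i) %| p)); rewrite ?dvdp0 //.
    by move=> x y; apply: dvdp_add.
  move=> l _; apply: dvdp_mull; apply: dvdp_trans (IH l _ _) => //.
    by apply: dvdp_exp2l; have := ltn_ord l; nia.
  exact: ltn_trans ik.
have ev0 M (p : {poly R}) : (0 < M)%N -> 'X^M %| p -> p.[0] = 0.
  move=> M0 /dvdpP[u ->]; rewrite hornerM hornerXn expr0n.
  by case: M M0 => //= M _; rewrite mulr0.
have Nk : (0 < N - k)%N by lia.
have := ev0 _ _ Nk (hdvd k); rewrite expand eQ hornerD hornerN hornerC hornerD.
rewrite 2!hornerM hornerXn expr0n eqn0Ngt e0 !mul0r add0r horner_sum.
rewrite big1 ?add0r => [/eqP|l _]; first by rewrite oppr_eq0 (negPf rk).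
rewrite hornerM (ev0 _ _ _ (SX l (ltn_ord l))) ?mulr0 //.
by have := ltn_ord l; nia.
Qed.
End LocalAlgebra.

Section Shear.
Variables (R : realType) (m : nat) (a w : 'rV[R]_m.+1).
Hypothesis w_last : w 0 ord_max != 0.

(** Affine coordinates centred at [a] whose last axis is directed by [w]. *)
Definition shear (e : nat -> R) : 'rV[R]_m.+1 :=
  a + row_of m.+1 (fun i => if (i < m)%N then e i else 0) + e m *: w.

Definition last_coord (x : 'rV[R]_m.+1) :=
  (x 0 ord_max - a 0 ord_max) / w 0 ord_max.

Definition unshear (x : 'rV[R]_m.+1) : nat -> R := fun i =>
  if (i < m)%N then coords x i - coords a i - last_coord x * coords w i
  else last_coord x.

Lemma shearK x : shear (unshear x) = x.
Proof.
apply/rowP => i; rewrite !mxE /unshear ltnn.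
have [im|mi] := ltnP i m.
  by rewrite !coordsE; ring.
have -> : i = ord_max by apply: val_inj; have := ltn_ord i; rewrite /=; lia.
by rewrite /last_coord; field.
Qed.

Lemma unshearK e i : (i < m.+1)%N -> unshear (shear e) i = e i.
Proof.
have le : last_coord (shear e) = e m.
  by rewrite /last_coord !mxE /= ltnn; field.
move=> hi; rewrite /unshear le; have [im|mi] := ltnP i m.
  rewrite /shear -[i]/(nat_of_ord (Ordinal hi)) !coordsE !mxE /= im; ring.
by congr e; lia.
Qed.

Lemma shear_pull (P : mpoly.mpoly m.+1 R) :
  exists p, forall e, ieval e m.+1 p = peval P (shear e).
Proof.
pose s i : ipoly R m.+1 := iconst R _ (coords a i) +
  (if (i < m)%N then ivar R m.+1 i else 0) + iconst R _ (coords w i) * ivar R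
    m.+1 m.
exists (isubst s (mpoly_ipoly P)) => e; rewrite ieval_isubst ieval_mpoly.
congr peval; apply/rowP => i.
rewrite !mxE !rmorphD rmorphM !ieval_iconst !coordsE (ieval_ivar e (ltnSn m)).
rewrite [e m * _]mulrC; congr (_ + _ + _).
by case: ifP => im; rewrite ?rmorph0 // ieval_ivar // ltnW.
Qed.

Lemma shear_push (p : ipoly R m.+1) :
  exists P : mpoly.mpoly m.+1 R, forall x, peval P x = ieval (unshear x) m.+1 p.
Proof.
pose l : ipoly R m.+1 := iconst R _ (w 0 ord_max)^-1 *
   (ivar R m.+1 m - iconst R _ (a 0 ord_max)).
pose s i := if (i < m)%N then ivar R m.+1 i - iconst R _ (coords a i) -
   l * iconst R _ (coords w i) else l.
have hl x : ieval (coords x) m.+1 l = last_coord x.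
  rewrite rmorphM rmorphB !ieval_iconst (ieval_ivar _ (ltnSn m)).
  by rewrite /last_coord mulrC (coordsE x ord_max).
exists (ipoly_mpoly (isubst s p)) => x; rewrite peval_ipoly ieval_isubst.
apply: eq_ieval => i hi; rewrite /s /unshear; case: ifP => im; last exact: hl.
by rewrite !rmorphB rmorphM !ieval_iconst hl ieval_ivar.
Qed.
End Shear.

(** A substitute for the continuity of [f]. *)
Definition identities_spread (R : realType) n (f : 'rV[R]_n -> R) :=
  forall W P Q : mpoly.mpoly n R,
  (exists x, peval W x != 0) ->
  (forall x, peval W x != 0 -> peval Q x * f x = peval P x) ->
  forall x, peval Q x * f x = peval P x.

Section Planes.
Variables (R : realType) (m : nat).
Hypothesis m0 : (0 < m)%N.
Notation n := m.+1.
Implicit Types (f : 'rV[R]_n -> R) (a w : 'rV[R]_n) (P Q : mpoly.mpoly n R).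

(** Near [a] on [Pi], [P] is a multiple of [Q] up to terms of degree [N]: the
    trace at order [N] of the divisibility of [P] by [Q] in the ring of power
    series. *)
Definition has_local_quotient P Q a (Pi : set 'rV[R]_n) N :=
  exists (T : mpoly.mpoly n R) (K d : R), 0 < d /\
    forall x, Pi x -> `|x - a| < d ->
      `|peval P x - peval Q x * peval T x| <= K * `|x - a| ^+ N.

(** The restriction to the plane spanned by [v] and by the last axis, with the
    coordinate along [v] outermost. *)
Definition to_plane (v : nat -> R) : {rmorphism ipoly R n -> {poly {poly R}}} :=
  iev (polyC \o polyC) (fun i => if (i < m)%N then (v i)%:P *:
    'X else ('X)%:P) n.

Lemma bev_to_plane v s y p : bev s y (to_plane v p) =
  ieval (fun i => if (i < m)%N then s * v i else y) n p.
Proof.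
apply: ieval_comp => [c|i hi]; first by rewrite bevE /= !hornerC.
rewrite bevE; case: ifP => _; last by rewrite hornerC hornerX.
by rewrite hornerZ hornerX hornerM !hornerC mulrC.
Qed.

Lemma to_plane_const v (r : ipoly R m) : exists r1 : {poly R},
  to_plane v r%:P = map_poly polyC r1 /\ r1.[1] = ieval v m r.
Proof.
exists (iev polyC (fun i => (v i)%:P * 'X) m r); split.
  rewrite /to_plane iev_polyC; apply/esym.
  apply: (@iev_comp _ _ _ _ _ (map_poly (polyC : R ->
    {poly R}))) => [c|i im] /=.
    by rewrite map_polyC.
  by rewrite im rmorphM /= map_polyC map_polyX mul_polyC.
apply: (@ieval_comp _ _ _ (horner_eval 1)) => [c|i _] /=.
  by rewrite /horner_eval hornerC.
by rewrite /horner_eval hornerM hornerC hornerX mulr1.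
Qed.

Lemma first_nonzero_coef (p : {poly R}) : p != 0 ->
  exists2 k, p`_k != 0 & forall i, (i < k)%N -> p`_i = 0.
Proof.
move=> p0; have ex : exists k, p`_k != 0.
  by exists (size p).-1; rewrite -lead_coefE lead_coef_eq0.
exists (ex_minn ex); case: ex_minnP => // k _ kmin i ik.
by apply: contraTeq ik => pi; rewrite -leqNgt kmin.
Qed.

Lemma divide_by_X (p : {poly R}) : p != 0 -> p.[0] = 0 ->
  exists e q, [/\ p = 'X^e * q, q.[0] != 0 & (0 < e)%N].
Proof.
move=> p0 p00; have [k pk kmin] := first_nonzero_coef p0.
exists k, (drop_poly k p); rewrite mulrC; split.
- rewrite -{1}[p](poly_take_drop k) [take_poly k p](_ : _ = 0) ?add0r //.
  by apply/polyP => i; rewrite coef_take_poly coef0; case: ifP => // /kmin.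
- by rewrite horner_coef0 coef_drop_poly.
by rewrite lt0n; apply: contraNneq pk => ->; rewrite -horner_coef0 p00.
Qed.

Lemma affine_plane_shear a w (v : nat -> R) : w 0 ord_max != 0 ->
  v 0%N != 0 -> exists Pi : set 'rV[R]_n, [/\ affine_plane Pi, Pi a &
    forall s y, Pi (shear a w (fun i => if (i < m)%N then s * v i else y))].
Proof.
move=> w0 v0; pose v' := row_of n (fun i => if (i < m)%N then v i else 0).
pose B : 'M[R]_(2, n) := \matrix_(i, j) (if i == 0 then v' else w) 0 j.
have tB t : t *m B = t 0 0 *: v' + t 0 1 *: w.
  apply/rowP => j; rewrite !mxE big_ord_recl big_ord1.
  have -> : lift ord0 ord0 = 1 :> 'I_2 by exact: val_inj.
  by rewrite !mxE /=; congr (t _ _ * _ + _); exact: val_inj.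
exists [set a + t *m B | t in [set: 'rV[R]_2]]; split.
- exists a, B; split=> //; apply: inj_row_free => t; rewrite tB => /rowP h.
  have t1 : t 0 1 = 0.
    move: (h ord_max); rewrite !mxE /= ltnn mulr0 add0r => /eqP.
    by rewrite mulf_eq0 (negPf w0) orbF => /eqP.
  have t0 : t 0 0 = 0.
    move: (h 0); rewrite !mxE /= m0 t1 mul0r addr0 => /eqP.
    by rewrite mulf_eq0 (negPf v0) orbF => /eqP.
  apply/rowP => j; rewrite mxE; case: j => [[|[|//]] hj].
    by rewrite -[RHS]t0; congr (t _ _); exact: val_inj.
  by rewrite -[RHS]t1; congr (t _ _); exact: val_inj.
- by exists 0 => //; rewrite mul0mx addr0.
move=> s y; exists (\row_j (if j == 0 then s else y)) => //.
rewrite tB /shear !mxE /= ltnn -addrA; congr (_ + (_ + _)).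
by apply/rowP => j; rewrite !mxE; case: ifP; rewrite ?mulr0.
Qed.

(** In shear coordinates, write [f = P1 / Q1] in lowest terms, with a Bezout
    identity [al * P1 + be * Q1 = r] where [r] does not involve the last
    variable. On a plane through [a] that contains the last axis and on which
    [r] is not zero, [P1] is a multiple [T * Q1] up to a high order, so that
    [(al * T + be) * Q1] is congruent to [r]. If [Q1] vanished at [a], this
    would contradict [no_local_relation]. *)
Theorem regular_of_planes f (P0 Q0 : mpoly.mpoly n R) :
  (exists x, peval Q0 x != 0) -> (forall x, peval Q0 x * f x = peval P0 x) ->
  identities_spread f ->
  (forall P Q a Pi N, (forall x, peval Q x * f x = peval P x) ->
     affine_plane Pi -> Pi a -> has_local_quotient P Q a Pi N) ->
  regular_on [set: 'rV[R]_n] f.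
Proof.
move=> Q0n0 hf spread flat a _.
(* on the last axis Q0 is not zero, which is inherited by its divisor q1 *)
have [w [w0 Q0w]] : exists w, w 0 ord_max != 0 /\ peval Q0 (a + w) != 0.
  have [x0 hx0] := Q0n0.
  have [|e he] := @ieval_neq0 R n (mpoly_ipoly Q0 *
      (ivar R n m - iconst R n (a 0 ord_max))).
    apply: mulf_neq0.
      apply: contraNneq hx0 => e.
      by have := ieval_mpoly Q0 (coords x0); rewrite e rmorph0 coordsK => <-.
    apply: contraTneq isT => /(congr1 (ieval (fun=> a 0 ord_max + 1) n)).
    rewrite rmorph0 rmorphB ieval_iconst ieval_ivar // addrAC subrr add0r.
    by move/eqP; rewrite oner_eq0.
  move: he; rewrite rmorphM mulf_eq0 negb_or ieval_mpoly rmorphB ieval_iconst.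
  rewrite ieval_ivar // => /andP[h1 h2]; exists (row_of n e - a).
  by rewrite [a + _]addrC subrK !mxE.
have [p hp] := shear_pull a w P0; have [q hq] := shear_pull a w Q0.
pose axis := fun i => if (i < m)%N then 0 else 1 : R.
have shear1 : shear a w axis = a + w.
  rewrite /shear /axis ltnn scale1r -addrA; congr (_ + _); apply/rowP => i.
  by rewrite !mxE; case: (i < m)%N; rewrite add0r.
have qaxis : ieval axis n q != 0 by rewrite hq shear1.
have q0 : q != 0 by apply: contraNneq qaxis => ->; rewrite rmorph0.
have [d [p1 [q1 [ep eq d0 cop]]]] := reduce_fraction (ipoly_factorial R n) p q0.
have [P1 hP1] := shear_push a w p1; have [Q1 hQ1] := shear_push a w q1.
have [D1 hD1] := shear_push a w d.
have hf1 : forall x, peval Q1 x * f x = peval P1 x.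
  apply: (spread D1) => [|x].
    have [e he] := ieval_neq0 d0; exists (shear a w e); rewrite hD1.
    rewrite (_ : ieval _ _ _ = ieval e n d) //.
    by apply: eq_ieval => i; exact: unshearK.
  rewrite hD1 hQ1 hP1 => dx; apply: (mulfI dx).
  rewrite mulrA -!rmorphM -ep -eq hp hq shearK //.
have center : unshear a w a = fun=> 0.
  have l0 : last_coord a w a = 0 by rewrite /last_coord subrr mul0r.
  by apply/funext => i; rewrite /unshear l0 mul0r !subrr; case: ifP.
exists P1, Q1; have [Q1a|Q1a] := eqVneq (peval Q1 a) 0; last first.
  by split=> // x _ Q1x; rewrite -hf1 mulrAC divff ?mul1r.
exfalso.
have q10 : q1 != 0 by apply: contraNneq q0 => e; rewrite eq e mulr0.
have [al [be [r [r0 bez]]]] := coprime_bezout (ipoly_factorial R m) q10 cop.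
have [v [v0 rv]] : exists v, v 0%N != 0 /\ ieval v m r != 0.
  have [|v] := @ieval_neq0 R m (ivar R m 0 * r).
    apply: mulf_neq0 => //.
    apply: contraTneq isT => /(congr1 (ieval (fun=> 1) m)).
    by rewrite rmorph0 ieval_ivar // => /eqP; rewrite oner_eq0.
  by rewrite rmorphM ieval_ivar // mulf_eq0 negb_or => /andP[]; exists v.
have [Pi [aPi Pia hPi]] := affine_plane_shear a w0 v0.
have [r1 [er r11]] := to_plane_const v r.
have r10 : r1 != 0 by apply: contraNneq rv => e; rewrite -r11 e horner0.
have [k rk kmin] := first_nonzero_coef r10.
pose Qh := to_plane v q1; pose Ph := to_plane v p1.
have [e [qe [eQ qe0 e0]]] :
  exists e qe, [/\ Qh`_0 = 'X^e * qe, qe.[0] != 0 & (0 < e)%N].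
  have h0 (y : R) : (Qh`_0).[y] = ieval (fun i => if (i < m)%N then 0 else y) n
    q1.
    rewrite -horner_coef0; transitivity (bev 0 y Qh); first
      by rewrite bevE polyC0.
    rewrite bev_to_plane.
    by apply: eq_ieval => i _; rewrite mul0r.
  apply: divide_by_X.
    apply: contraNneq qaxis => Qh0; rewrite eq rmorphM.
    by have := h0 1; rewrite Qh0 horner0 => <-; rewrite mulr0.
  rewrite h0 -[RHS]Q1a hQ1 center; apply: eq_ieval => i _.
  by case: ifP.
(* the order required by no_local_relation, which is independent of T *)
pose N := (k + e * k).+1.
have [T [K [dl [dl0 hT]]]] := flat P1 Q1 a Pi N hf1 aPi Pia.
have [t ht] := shear_pull a w T.
pose S := to_plane v (al * t + be).
apply: (@no_local_relation R Qh S r1 k e qe N) => //.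
have -> : Qh * S - map_poly polyC r1 = to_plane v al * (Qh * to_plane v t - Ph).
  by rewrite -er -bez /S /Qh /Ph !rmorphD !rmorphM; ring.
have [B B0 hB] := bev_bounded (to_plane v al).
pose x s y := shear a w (fun i => if (i < m)%N then s * v i else y).
pose C := `|row_of n (fun i => if (i < m)%N then v i else 0)| + `|w| + 1.
have C0 : 0 < C by rewrite ltr_wpDl // addr_ge0.
have xa s y : 0 < s -> 0 < y -> `|x s y - a| <= C * Num.max s y.
  move=> s0 y0.
  have -> : x s y - a = s *:
    row_of n (fun i => if (i < m)%N then v i else 0) + y *: w.
    rewrite /x /shear ltnn; apply/rowP => i; rewrite !mxE.
    by case: (i < m)%N; ring.
  rewrite (le_trans (ler_normD _ _)) // !normrZ (gtr0_norm s0) (gtr0_norm y0).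
  have sM : s <= Num.max s y by rewrite le_max lexx.
  have yM : y <= Num.max s y by rewrite le_max lexx orbT.
  rewrite /C !mulrDl mul1r -[X in X <= _]addr0 lerD //; last first.
    exact: le_trans (ltW s0) sM.
  by rewrite lerD // [_ * Num.max _ _]mulrC ler_wpM2r.
apply: (@bev_order R _ N (B * (`|K| * C ^+ N)) (Num.min 1 (dl / C))).
  by rewrite lt_min ltr01 divr_gt0.
move=> s y /andP[s0]; rewrite lt_min => /andP[s1 sd].
move=> /andP[y0]; rewrite lt_min => /andP[y1 yd].
rewrite rmorphM normrM -mulrA ler_pM //.
  by rewrite hB // gtr0_norm // ltW.
have xs : `|x s y - a| <= C * Num.max s y by exact: xa.
have M0 : 0 < Num.max s y by rewrite lt_max s0.
have := hT (x s y) (hPi s y); rewrite (le_lt_trans xs); last first.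
  by rewrite mulrC -ltr_pdivlMr // gt_max sd.
move=> /(_ isT) hx; rewrite [bev _ _ _](_ : _ = - (peval P1 (x s y) -
    peval Q1 (x s y) * peval T (x s y))); last first.
  have un p' : ieval (unshear a w (x s y)) n p' = bev s y (to_plane v p').
    by rewrite bev_to_plane; apply: eq_ieval => i; exact: unshearK.
  by rewrite hP1 hQ1 /x -ht -/(x s y) !un -bev_to_plane rmorphB rmorphM opprB.
rewrite normrN (le_trans hx) // -mulrA -exprMn.
rewrite (le_trans (ler_wpM2r _ (ler_norm K))) ?exprn_ge0 //.
rewrite ler_wpM2l // lerXn2r // nnegrE // mulr_ge0 ?ltW //.
Qed.
End Planes.

(** * Power series and Taylor estimates *)
Section Taylor.
Variable R : realType.

Lemma row_norm_le n (x : 'rV[R]_n) r : 0 <= r ->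
  (forall i, `|x 0 i| <= r) -> `|x| <= r.
Proof.
move=> r0 h; have -> : `|x| = mx_norm x by [].
by rewrite mx_normrE bigmax_le // => -[i j] _ /=; rewrite ord1.
Qed.

Lemma row_norm_ge n (x : 'rV[R]_n) i : `|x 0 i| <= `|x|.
Proof.
have -> : `|x| = mx_norm x by [].
by rewrite mx_normrE; apply:
  (@le_bigmax _ _ _ _ (fun ij => `|x ij.1 ij.2|) (0, i)).
Qed.

Lemma near_norm n (a : 'rV[R]_n) (P : 'rV[R]_n -> Prop) :
  (\forall x \near a, P x) <-> exists2 d, 0 < d & forall x, `|x - a| < d -> P x.
Proof.
split=> [/nbhs_normP[d d0 h]|[d d0 h]].
  by exists d => // x xa; apply: h; rewrite /= distrC.
by apply/nbhs_normP; exists d => // x /=; rewrite distrC; exact: h.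
Qed.

Section FsetSums.
Variables (I : choiceType) (x : I -> R).

Lemma partial_sumE (F : {fset I}) :
  summability.partial_sum x F = \sum_(i <- F) x i.
Proof. by rewrite /summability.partial_sum big_seq_fsetE. Qed.

Lemma partial_sum_cvgP (l : R) :
  summability.partial_sum x @ summability.totally --> l <->
  forall e, 0 < e -> exists A : {fset I}, forall F : {fset I},
    (A `<=` F)%fset -> `|l - \sum_(i <- F) x i| < e.
Proof.
have TF : Filter (@summability.totally I).
  exact: (@filter_filter _ _ (@summability.totally_filter I)).
split=> [/cvgrPdist_lt h e e0|h].
  have [A _ hA] := h e e0; exists A => F AF.
  by rewrite -partial_sumE; apply: hA.
apply/cvgrPdist_lt => e e0; have [A hA] := h e e0.
by exists A => // F AF /=; rewrite partial_sumE; apply: hA.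
Qed.

Lemma fset_sumU (A F : {fset I}) (y : I -> R) : [disjoint A & F]%fset ->
  \sum_(i <- (A `|` F)%fset) y i = \sum_(i <- A) y i + \sum_(i <- F) y i.
Proof.
move=> dAF; rewrite -big_cat; apply: perm_big; apply: uniq_perm.
- exact: fset_uniq.
- rewrite cat_uniq !fset_uniq andbT /=; apply/hasPn => i iF.
  by apply: contraL iF => iA; move/fdisjointP: dAF; apply.
by move=> i; rewrite mem_cat inE.
Qed.

(** Unconditional convergence is absolute: the positive and the negative terms
    can be added separately. *)
Lemma unconditional_absolute (l : R) :
  summability.partial_sum x @ summability.totally --> l ->
  exists B, forall F : {fset I}, \sum_(i <- F) `|x i| <= B.
Proof.
move=> /partial_sum_cvgP /(_ _ ltr01)[A hA].
have small (F : {fset I}) : [disjoint A & F]%fset -> `|\sum_(i <- F) x i| <= 2.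
  move=> dAF; have := hA _ (fsubsetUl A F); have := hA _ (fsubset_refl A).
  rewrite fset_sumU // => h1 h2.
  have -> : \sum_(i <- F) x i = (l - \sum_(i <- A) x i) -
    (l - (\sum_(i <- A) x i + \sum_(i <- F) x i)) by ring.
  by rewrite (le_trans (ler_normB _ _)) //; lra.
exists (\sum_(i <- A) `|x i| + 4) => F.
have split_sum (y : I -> R) (P : pred I) (G : {fset I}) :
    \sum_(i <- G | P i) y i = \sum_(i <- [fset i in G | P i]%fset) y i.
  by rewrite big_fset_condE.
have dis (P : pred I) : [disjoint A & [fset i in F `\` A | P i]]%fset.
  by apply/fdisjointP => i iA; rewrite !inE iA.
have : \sum_(i <- (F `\` A)%fset) `|x i| <= 4.
  rewrite (bigID (fun i => 0 <= x i)) /=.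
  have -> : \sum_(i <- (F `\` A)%fset | 0 <= x i) `|x i| =
     \sum_(i <- (F `\` A)%fset | 0 <= x i) x i.
    by apply: eq_bigr => i xi; rewrite ger0_norm.
  have -> : \sum_(i <- (F `\` A)%fset | ~~ (0 <= x i)) `|x i| =
     - \sum_(i <- (F `\` A)%fset | ~~ (0 <= x i)) x i.
    by rewrite -sumrN; apply: eq_bigr => i; rewrite -ltNge => xi;
      rewrite ltr0_norm.
  rewrite (split_sum _ (fun i => 0 <= x i)) (split_sum _ (fun i => ~~ (0 <= x
    i))).
  have := small _ (dis (fun i => 0 <= x i)); have :=
    small _ (dis (fun i => ~~ (0 <= x i))).
  rewrite !ler_norml; lra.
have : \sum_(i <- F) `|x i| <= \sum_(i <- (A `|` (F `\` A))%fset) `|x i|.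
  have -> : (A `|` (F `\` A) = F `|` (A `\` F))%fset.
    by apply/fsetP => i; rewrite !inE; case: (i \in A); case: (i \in F).
  rewrite fset_sumU ?lerDl ?sumr_ge0 //.
  by apply/fdisjointP => i iF; rewrite !inE iF.
rewrite fset_sumU; last by apply/fdisjointP => i iF; rewrite !inE iF.
lra.
Qed.
End FsetSums.

Variable n : nat.
Implicit Types (G : 'rV[R]_n -> R) (a : 'rV[R]_n) (m : {ffun 'I_n -> nat}).

Lemma monomial_bound m (y : 'rV[R]_n) r : `|y| <= r ->
  `|monomial m y| <= r ^+ (\sum_i m i).
Proof.
move=> yr; have r0 : 0 <= r by exact: le_trans yr.
rewrite normr_prod -prodrXr; apply: ler_prod => i _;
  rewrite normr_ge0 normrX /=.
by rewrite lerXn2r ?nnegrE // (le_trans (row_norm_ge y i)).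
Qed.

Lemma monomial_const m (r : R) : monomial m (const_mx r) = r ^+ (\sum_i m i).
Proof. by rewrite -prodrXr; apply: eq_bigr => i _; rewrite mxE. Qed.

Lemma small_multiindices M : exists X : {fset {ffun 'I_n -> nat}},
  forall m, (\sum_i m i < M)%N -> m \in X.
Proof.
exists [fset [ffun i => nat_of_ord ((g : {ffun 'I_n -> 'I_M}) i)] |
          g : {ffun 'I_n -> 'I_M} in predT]%fset => m hm.
have hi i : (m i < M)%N.
  by apply: leq_ltn_trans hm; rewrite (bigD1 i) //= leq_addr.
apply/imfsetP; exists [ffun i => Ordinal (hi i)] => //=.
by apply/ffunP => i; rewrite !ffunE.
Qed.

Lemma taylor_mpoly (X : {fset {ffun 'I_n -> nat}}) (c : {ffun 'I_n -> nat} ->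
  R) a :
  exists T : mpoly.mpoly n R, forall x,
    peval T x = \sum_(m <- X) c m * monomial m (x - a).
Proof.
exists (ipoly_mpoly (\sum_(m <- X) iconst R n (c m) *
  \prod_(i < n) (ivar R n i - iconst R n (a 0 i)) ^+ m i)) => x.
rewrite peval_ipoly rmorph_sum; apply: eq_bigr => m _.
rewrite rmorphM ieval_iconst rmorph_prod; congr (_ * _); apply: eq_bigr => i _.
by rewrite rmorphXn rmorphB ieval_iconst ieval_ivar // coordsE !mxE.
Qed.

(** The terms of the series at a point of the polydisc of radius [r] are
    summable; at distance [|x - a|] those of degree at least [M] are smaller by
    a factor [(|x - a| / r) ^ M]. *)
Lemma analytic_taylor G a M : analytic_at G a ->
  exists (T : mpoly.mpoly n R) (K d : R), 0 < d /\
    forall x, `|x - a| < d -> `|G x - peval T x| <= K * `|x - a| ^+ M.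
Proof.
move=> [c /near_norm[d d0 hd]].
have [r r0 rd] : exists2 r, 0 < r & r < d by exists (d / 2); lra.
have [B hB] : exists B, forall F : {fset {ffun 'I_n -> nat}},
    \sum_(m <- F) `|c m| * r ^+ (\sum_i m i) <= B.
  have near_a : `|a + const_mx r - a| < d.
    rewrite addrAC subrr add0r; apply: (@le_lt_trans _ _ r) => //.
    by apply: row_norm_le => [|i]; [exact: ltW | rewrite mxE gtr0_norm].
  have [B hB] := unconditional_absolute (hd _ near_a).
  exists B => F; apply: le_trans (hB F); rewrite le_eqVlt; apply/orP; left.
  apply/eqP/eq_bigr => m _; rewrite addrAC subrr add0r monomial_const normrM.
  by rewrite (ger0_norm (exprn_ge0 _ (ltW r0))).
have [X hX] := small_multiindices M.
have [T hT] := taylor_mpoly X c a.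
exists T, (B / r ^+ M), r; split=> // x xa.
have B0 : 0 <= B by have := hB fset0; rewrite big_seq_fset0.
have tail F : [disjoint X & F]%fset ->
    `|\sum_(m <- F) c m * monomial m (x - a)| <= B / r ^+ M * `|x - a| ^+ M.
  move=> dXF.
  have -> : B / r ^+ M * `|x - a| ^+ M = (`|x - a| / r) ^+ M * B.
    by rewrite expr_div_n [RHS]mulrC -mulrA [_^-1 * _]mulrC.
  apply: (le_trans (ler_norm_sum _ _ _)).
  apply: le_trans (ler_wpM2l _ (hB F)); last
    by rewrite exprn_ge0 // divr_ge0 // ltW.
  rewrite mulr_sumr big_seq [leRHS]big_seq; apply: ler_sum => m mF.
  rewrite normrM mulrCA ler_wpM2l // (le_trans (monomial_bound m (lexx _))) //.
  have Mm : (M <= \sum_i m i)%N.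
    rewrite leqNgt; apply/negP => /hX mX.
    by move/fdisjointP: dXF => /(_ m mX); rewrite mF.
  move: (\sum_i m i)%N Mm => k Mk.
  have -> : `|x - a| ^+ k = (`|x - a| / r) ^+ k * r ^+ k.
    by rewrite -exprMn divfK // lt0r_neq0.
  rewrite ler_wpM2r ?exprn_ge0 ?(ltW r0) //.
  rewrite -(subnK Mk) exprD ler_piMl ?exprn_ge0 ?divr_ge0 ?(ltW r0) //.
  by rewrite exprn_ile1 ?divr_ge0 ?(ltW r0) // ler_pdivrMr // mul1r ltW.
apply/ler_addgt0Pr => e e0.
have /partial_sum_cvgP /(_ e e0)[A hA] : summability.partial_sum
    (fun m => c m * monomial m (x - a)) @ summability.totally --> G x.
  by apply: hd; apply: lt_trans xa _.
have := hA _ (fsubsetUr X A); rewrite hT => h1.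
have eU : (X `|` A = X `|` (A `\` X))%fset.
  by apply/fsetP => i; rewrite !inE; case: (i \in X); case: (i \in A).
have dX : [disjoint X & A `\` X]%fset.
  by apply/fdisjointP => i iX; rewrite !inE iX.
move: h1; rewrite eU fset_sumU // => h1.
set S := \sum_(m <- X) _ in h1 *; set S' := \sum_(m <- _) _ in h1.
have -> : G x - S = S' + (G x - (S + S')) by ring.
rewrite (le_trans (ler_normD _ _)) // lerD ?(ltW h1) //.
exact: tail.
Qed.
End Taylor.

(** * Regular functions are analytic *)
Section RegularAnalytic.
Variables (R : realType) (n : nat).
Implicit Types (p q u : mpoly.mpoly n R) (r B : R).

Lemma bigop_pairs (I J : Type) (s : seq I) (t : seq J) (F : I * J -> R) :
  \sum_(x <- [seq (i, j) | i <- s, j <- t]) F x = \sum_(i <- s) \sum_(j <- t) F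
    (i, j).
Proof. by rewrite big_allpairs_dep. Qed.

(** A bound for the sum of the absolute values of the terms on the polydisc of
    radius [r]. *)
Definition norm_bound r p B := forall s : seq (multinom n), uniq s ->
  \sum_(m <- s) `|mcoeff m p| * r ^+ mdeg m <= B.

Lemma norm_bound_ge0 r p B : norm_bound r p B -> 0 <= B.
Proof. by move=> h; have := h [::] isT; rewrite big_nil. Qed.

Lemma norm_boundD r p q B B' :
  0 <= r -> norm_bound r p B -> norm_bound r q B' ->
    norm_bound r (p + q) (B + B').
Proof.
move=> r0 hp hq s us; apply: le_trans (lerD (hp s us) (hq s us)).
rewrite -big_split /=; apply: ler_sum => m _; rewrite -mulrDl mcoeffD.
by rewrite ler_wpM2r ?exprn_ge0 // ler_normD.
Qed.

Lemma norm_bound0 r : norm_bound r 0 0.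
Proof. by move=> s _; rewrite big1 // => m _; rewrite mcoeff0 normr0 mul0r. Qed.

Lemma norm_bound_sum r (I : Type) (s : seq I) (F : I -> mpoly.mpoly n R) (B :
  I -> R) :
  0 <= r -> (forall i, norm_bound r (F i) (B i)) ->
  norm_bound r (\sum_(i <- s) F i) (\sum_(i <- s) B i).
Proof.
move=> r0 h; elim: s => [|i s IH]; first by rewrite !big_nil; exact:
  norm_bound0.
by rewrite !big_cons; apply: norm_boundD.
Qed.

Lemma norm_bound_monomial r (c : R) m : 0 <= r ->
  norm_bound r (c *: mpolyX R m) (`|c| * r ^+ mdeg m).
Proof.
move=> r0 s us; have [ms|ms] := boolP (m \in s); last first.
  rewrite big_seq big1 ?mulr_ge0 ?exprn_ge0 // => k ks.
  rewrite mcoeffZ mcoeffX; case: eqP => [e|]; first by move: ms; rewrite e ks.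
  by rewrite mulr0 normr0 mul0r.
rewrite (bigD1_seq m) //= big1 ?addr0 => [|k /negPf km].
  by rewrite mcoeffZ mcoeffX eqxx mulr1.
by rewrite mcoeffZ mcoeffX eq_sym km mulr0 normr0 mul0r.
Qed.

Lemma norm_boundM r p q B B' : 0 <= r -> norm_bound r p B ->
  norm_bound r q B' ->
  norm_bound r (p * q) (B * B').
Proof.
move=> r0 hp hq s us; rewrite mpolyME.
have h := @norm_bound_sum r _ [seq (i, j) | i <- msupp p, j <- msupp q]
  (fun m => (mcoeff m.1 p * mcoeff m.2 q) *: mpolyX R (mnm_add m.1 m.2)) _ r0
  (fun m => norm_bound_monomial _ _ r0).
apply: (le_trans (h s us)).
rewrite bigop_pairs /=.
under eq_bigr do under eq_bigr do rewrite normrM mdegD exprD mulrACA.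
under eq_bigr do rewrite -mulr_sumr.
rewrite -mulr_suml ler_pM ?hp ?hq ?msupp_uniq ?sumr_ge0 // => m _;
  by rewrite mulr_ge0 ?exprn_ge0.
Qed.

Lemma norm_boundX r p B k : 0 <= r -> norm_bound r p B ->
  norm_bound r (p ^+ k) (B ^+ k).
Proof.
move=> r0 hp; elim: k => [|k IH]; last by rewrite !exprS; apply: norm_boundM.
rewrite !expr0; have := norm_bound_monomial 1 (@mnm0 n) r0.
by rewrite mpolyX0 scale1r normr1 mdeg0 expr0 mulr1.
Qed.

Definition order_ge k p := forall m, (mdeg m < k)%N -> mcoeff m p = 0.

Lemma order_geM k l p q : order_ge k p -> order_ge l q ->
  order_ge (k + l) (p * q).
Proof.
move=> hp hq m hm; rewrite mpolyME raddf_sum big1_seq // => -[m1 m2] _ /=.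
rewrite mcoeffZ mcoeffX; case: eqP => [e|_]; last by rewrite mulr0.
have [h1|h1] := ltnP (mdeg m1) k; first by rewrite hp // !mul0r.
rewrite hq ?mulr0 ?mul0r //.
by move: hm; rewrite -e mdegD; lia.
Qed.

Lemma order_geX p k : order_ge 1 p -> order_ge k (p ^+ k).
Proof.
move=> hp; elim: k => [|k IH] //; rewrite exprS -add1n; exact: order_geM.
Qed.

Lemma small_norm_bound u : mcoeff (@mnm0 n) u = 0 ->
  exists2 r, 0 < r & norm_bound r u (1 / 2).
Proof.
move=> u0; pose B := \sum_(m <- msupp u) `|mcoeff m u|.
have B0 : 0 <= B by rewrite sumr_ge0.
exists (1 / (2 * (B + 1))); first by rewrite divr_gt0 // mulr_gt0 // ltr_wpDl.
set r := _ / _; have r0 : 0 < r by rewrite divr_gt0 // mulr_gt0 // ltr_wpDl.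
have r1 : r <= 1 by rewrite ler_pdivrMr ?mulr_gt0 ?ltr_wpDl // mul1r; lra.
have Br : B * r <= 1 / 2 by rewrite mulrA ler_pdivrMr ?mulr_gt0 ?ltr_wpDl //;
  lra.
move=> s us; apply: le_trans Br; rewrite /B mulr_suml.
rewrite (bigID (fun m => m \in msupp u)) /= [X in _ + X]big1 ?addr0; last first.
  by move=> m /memN_msupp_eq0 ->; rewrite normr0 mul0r.
rewrite -big_filter; apply:
  (@le_trans _ _ (\sum_(m <- [seq m <- s | m \in msupp u]) `|mcoeff m u| * r)).
  apply: ler_sum => m _; have [->|m0] := eqVneq m (@mnm0 n).
    by rewrite u0 normr0 !mul0r.
  rewrite ler_wpM2l // -{2}[r]expr1 ler_wiXn2l ?(ltW r0) //.
  by rewrite lt0n mdeg_eq0.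
rewrite [leRHS](bigID (fun m => m \in s)) /= -[leLHS]addr0 lerD //; last first.
  by rewrite sumr_ge0 // => m _; rewrite mulr_ge0 // ltW.
rewrite -[leRHS]big_filter le_eqVlt; apply/orP; left; apply/eqP/perm_big.
apply: uniq_perm; rewrite ?filter_uniq ?msupp_uniq // => m.
by rewrite !mem_filter andbC.
Qed.

Definition multinom_of (m : {ffun 'I_n -> nat}) : multinom n :=
  Multinom [tuple m i | i < n].
Definition ffun_of (m : multinom n) : {ffun 'I_n -> nat} := [ffun i => m i].

Lemma multinom_ofK : cancel multinom_of ffun_of.
Proof. by move=> m; apply/ffunP => i; rewrite ffunE mnmE. Qed.

Lemma ffun_ofK : cancel ffun_of multinom_of.
Proof. by move=> m; apply/mnmP => i; rewrite mnmE ffunE. Qed.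

Lemma mdeg_multinom_of m : mdeg (multinom_of m) = (\sum_i m i)%N.
Proof. by rewrite mdegE; apply: eq_bigr => i _; rewrite mnmE. Qed.

Lemma peval_monomials p (F : {fset {ffun 'I_n -> nat}}) x :
  (forall m, m \in msupp p -> ffun_of m \in F) ->
  peval p x = \sum_(m <- F) mcoeff (multinom_of m) p * monomial m x.
Proof.
move=> h; rewrite /peval mevalE.
have -> : \sum_(m <- msupp p) mcoeff m p * \prod_(i < n) x 0 i ^+ m i =
  \sum_(m <- [seq ffun_of m | m <- msupp p]) mcoeff (multinom_of m) p *
    monomial m x.
  rewrite [RHS]big_map; apply: eq_bigr => m _; rewrite ffun_ofK; congr (_ * _).
  by rewrite /monomial; apply: eq_bigr => i _; rewrite ffunE.
rewrite [RHS](bigID (fun m => multinom_of m \in msupp p)) /=.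
rewrite [X in _ = _ + X]big1 ?addr0 => [|m /memN_msupp_eq0 ->]; last
  by rewrite mul0r.
rewrite -[RHS]big_filter; apply/perm_big/uniq_perm.
- by rewrite map_inj_uniq ?msupp_uniq //; exact: can_inj ffun_ofK.
- by rewrite filter_uniq // fset_uniq.
move=> m; rewrite mem_filter; apply/mapP/andP => [[k kp ->]|[mp _]].
  by rewrite ffun_ofK kp h.
by exists (multinom_of m); rewrite ?multinom_ofK.
Qed.

Lemma sum_norm_bound r p B (F : {fset {ffun 'I_n -> nat}}) x : 0 <= r ->
  norm_bound r p B -> `|x| <= r ->
  \sum_(m <- F) `|mcoeff (multinom_of m) p * monomial m x| <= B.
Proof.
move=> r0 hp xr.
have := hp [seq multinom_of m | m <- enum_fset F].
rewrite map_inj_uniq ?fset_uniq; last exact: can_inj multinom_ofK.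
move=> /(_ isT); apply: le_trans; rewrite big_map; apply: ler_sum => m _.
by rewrite normrM ler_wpM2l // mdeg_multinom_of monomial_bound.
Qed.

Lemma peval_bound r p B x : 0 <= r -> norm_bound r p B -> `|x| <= r ->
  `|peval p x| <= B.
Proof.
move=> r0 hp xr.
rewrite (@peval_monomials p [fset ffun_of m | m in msupp p]%fset) => [|m mp].
  exact: le_trans (ler_norm_sum _ _ _) (sum_norm_bound _ r0 hp xr).
by rewrite in_imfset.
Qed.

Lemma norm_bound_exists r p : 0 <= r -> exists B, norm_bound r p B.
Proof.
move=> r0; exists (\sum_(m <- msupp p) `|mcoeff m p| * r ^+ mdeg m).
rewrite {1}[p]mpolyE; apply: norm_bound_sum => // m.
exact: norm_bound_monomial.
Qed.
Lemma translate_mpoly p (b : 'rV[R]_n) :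
  exists q, forall h, peval q h = peval p (b + h).
Proof.
pose s i := iconst R n (coords b i) + ivar R n i.
exists (ipoly_mpoly (mpoly_eval (iconst R n) s p)) => h.
rewrite peval_ipoly mpoly_evalP; last exact: ieval_iconst.
congr peval; apply/rowP => i.
by rewrite !mxE rmorphD ieval_iconst ieval_ivar // !coordsE.
Qed.

Lemma peval0 p : peval p 0 = mcoeff (@mnm0 n) p.
Proof.
have hm (m : multinom n) : m != @mnm0 n -> monomial (ffun_of m) (0 :
  'rV[R]_n) = 0.
  rewrite -mdeg_eq0 mdegE sum_nat_eq0 negb_forall => /existsP[i mi].
  rewrite /monomial (bigD1 i) //= mxE ffunE expr0n.
  by move: mi; rewrite implyTb => /negPf ->; rewrite mul0r.
rewrite (@peval_monomials p (ffun_of (@mnm0 n) |` [fset ffun_of m | m in msupp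
  p])%fset).
  rewrite (big_fsetD1 (ffun_of (@mnm0 n))) ?in_fset1U ?eqxx //=.
  rewrite ffun_ofK [monomial _ _]big1 ?mulr1 => [|i _]; last first.
    by rewrite ffunE -[RHS](expr0 ((0 : 'rV[R]_n) 0 i)) mnmE.
  rewrite big_seq big1 ?addr0 // => m; rewrite !inE => /andP[m0 _].
  rewrite -[m]multinom_ofK hm ?mulr0 //.
  by apply: contraNneq m0 => <-; rewrite multinom_ofK.
by move=> m mp; rewrite in_fset1U in_imfset ?orbT.
Qed.

(** Near [b], [1 - u] is an invertible denominator, by the geometric series. *)
Lemma normalized_denominator p (b : 'rV[R]_n) : peval p b != 0 ->
  exists u r, [/\ 0 < r, mcoeff (@mnm0 n) u = 0, norm_bound r u (1 / 2) &
    forall h, peval p (b + h) = peval p b * (1 - peval u h)].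
Proof.
move=> pb; have [q hq] := translate_mpoly p b.
pose u : mpoly n R := 1 - (peval p b)^-1 *: q.
have hu h : peval u h = 1 - (peval p b)^-1 * peval p (b + h).
  by rewrite -hq /u /peval mevalB meval1 mevalZ.
have u0 : mcoeff (@mnm0 n) u = 0.
  by rewrite -peval0 hu addr0 mulVf // subrr.
have [r r0 hr] := small_norm_bound u0.
exists u, r; split=> // h; rewrite hu opprB addrCA subrr addr0 mulrA divff //.
by rewrite mul1r.
Qed.

Lemma geometric_sum_le k l : (k <= l)%N ->
  \sum_(k <= j < l) (1 / 2 : R) ^+ j <= 2 * (1 / 2) ^+ k.
Proof.
move=> kl; suff -> : \sum_(k <= j < l) (1 / 2 :
  R) ^+ j = 2 * (1/2) ^+ k - 2 * (1/2) ^+ l.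
  by rewrite gerBl mulr_ge0 // exprn_ge0.
rewrite (eq_bigr (fun j => - (2 * (1 / 2) ^+ j.+1 - - (- (2 * (1 / 2) ^+ j))))).
  rewrite sumrN; under eq_bigr do rewrite opprK.
  by rewrite telescope_sumr // opprB.
by move=> j _; rewrite exprS; field.
Qed.

(** The Taylor coefficients of a quotient are those of the partial sums of the
    geometric series of its normalized denominator. *)
Theorem fraction_analytic (P Q : mpoly.mpoly n R) (b : 'rV[R]_n) :
  peval Q b != 0 ->
  analytic_at (fun x => peval P x / peval Q x) b.
Proof.
move=> Qb; have [u [r [r0 u0 hu hQ]]] := normalized_denominator Qb.
have [P1 hP1] := translate_mpoly P b.
pose P2 : mpoly n R := (peval Q b)^-1 *: P1.
have [B hB] := norm_bound_exists P2 (ltW r0).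
have B0 := norm_bound_ge0 hB.
have ord_u : order_ge 1 u.
  by move=> m; rewrite ltnS leqn0 mdeg_eq0 => /eqP ->.
have hterm k : norm_bound r (P2 * u ^+ k) (B * (1 / 2) ^+ k).
  by apply: norm_boundM (ltW r0) hB _; apply: norm_boundX (ltW r0) hu.
pose c (m : {ffun 'I_n -> nat}) : R :=
  \sum_(0 <= k < (\sum_i m i).+1) mcoeff (multinom_of m) (P2 * u ^+ k).
have cE (m : {ffun 'I_n -> nat}) L : (\sum_i m i < L)%N ->
    c m = \sum_(0 <= k < L) mcoeff (multinom_of m) (P2 * u ^+ k).
  move=> hL; rewrite (big_cat_nat _ hL) //= [X in _ + X]big_nat_cond.
  rewrite [X in _ + X]big1 ?addr0 // => k /andP[/andP[hk _] _].
  have o : order_ge (0 + k) (P2 * u ^+ k) by apply: order_geM => [m'|];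
    [| exact: order_geX].
  by apply: o; rewrite mdeg_multinom_of add0n.
exists c; apply/near_norm; exists r => // x xr.
set h := x - b; have -> : x = b + h by rewrite /h addrC subrK.
have hr : `|h| <= r by exact: ltW.
have u12 : `|peval u h| <= 1 / 2 by exact: peval_bound (ltW r0) hu hr.
have u1 : 1 / 2 <= 1 - peval u h by move: u12; rewrite ler_norml; lra.
have eG : peval P (b + h) / peval Q (b + h) = peval P2 h / (1 - peval u h).
  rewrite hQ -hP1 /P2 /peval mevalZ; field.
  by rewrite Qb; lra.
apply/partial_sum_cvgP => e e0.
have [K hK] : exists K, 4 * B * (1 / 2) ^+ K < e.
  have hcv : (fun K => (1 / 2 : R) ^+ K) @ \oo --> 0.
    by apply: cvg_expr; rewrite gtr0_norm; lra.
  have /cvgrPdist_lt /(_ (e / (4 * B + 1))) : (fun K => (1 / 2 :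
    R) ^+ K) @ \oo --> 0 by [].
  have B1 : 0 < 4 * B + 1 by lra.
  move=> /(_ (divr_gt0 e0 B1))[K _ /(_ K (leqnn K))] /=.
  rewrite sub0r normrN gtr0_norm ?exprn_gt0 // ltr_pdivlMr // => hK.
  exists K; apply: le_lt_trans hK; rewrite mulrC ler_wpM2l ?exprn_ge0 //; lra.
(* the coefficients of degree below K of the series are those of S *)
pose S := \sum_(0 <= k < K) P2 * u ^+ k.
exists [fset ffun_of m | m in msupp S]%fset => F hF.
have eS : peval S h = \sum_(m <- F) mcoeff (multinom_of m) S * monomial m h.
  apply: peval_monomials => m mS; apply: (fsubsetP hF).
  by rewrite in_imfset.
have [L [KL hL]] : exists L, (K <= L)%N /\ forall m : {ffun 'I_n -> nat},
    m \in F -> (\sum_i m i < L)%N.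
  have [L hL] : exists L, forall m : {ffun 'I_n -> nat},
      m \in enum_fset F -> (\sum_i m i < L)%N.
    elim: (enum_fset F) => [|m0 s [L hL]]; first by exists 0%N.
    exists (maxn L (\sum_i m0 i).+1) => m;
      rewrite inE leq_max => /orP[/eqP->|/hL->//].
    by rewrite ltnSn orbT.
  exists (maxn K L); rewrite leq_maxl; split=> // m mF.
  by rewrite leq_max hL ?orbT.
have tail : `|\sum_(m <- F) c m * monomial m h - peval S h| <= 2 * B * (1 / 2)
  ^+ K.
  rewrite eS -sumrB.
  have -> : \sum_(m <- F) (c m * monomial m h - mcoeff (multinom_of m) S *
    monomial m h) =
     \sum_(K <= k < L) \sum_(m <- F) mcoeff (multinom_of m) (P2 * u ^+ k) *
       monomial m h.
    rewrite exchange_big /= big_seq [RHS]big_seq; apply: eq_bigr => m mF.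
    rewrite -mulrBl (cE m L (hL m mF)) (big_cat_nat _ KL) //= /S raddf_sum.
    by rewrite addrAC subrr add0r mulr_suml.
  apply: (le_trans (ler_norm_sum _ _ _)).
  apply: (@le_trans _ _ (\sum_(K <= k < L) B * (1 / 2) ^+ k)).
    apply: ler_sum => k _; apply: (le_trans (ler_norm_sum _ _ _)).
    exact: sum_norm_bound (ltW r0) (hterm k) hr.
  by rewrite -mulr_sumr [2 * B]mulrC -mulrA ler_wpM2l // geometric_sum_le.
have main : `|peval P2 h / (1 - peval u h) - peval S h| <= 2 * B * (1 / 2) ^+ K.
  have -> : peval P2 h / (1 - peval u h) - peval S h =
      peval (P2 * u ^+ K) h / (1 - peval u h).
    have -> : peval S h = (peval P2 h - peval (P2 * u ^+ K) h) / (1 - peval u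
      h).
      apply: (canRL (mulfK _)); first lra.
      rewrite /peval raddf_sum /= mulr_suml -/(peval _ _).
      rewrite (eq_bigr (fun k => - (peval (P2 * u ^+ k.+1) h - peval (P2 * u ^+
        k) h))).
        by rewrite sumrN telescope_sumr // opprB expr0 mulr1.
      by move=> k _; rewrite /peval !mevalM !rmorphXn /= exprS; ring.
    by field; lra.
  rewrite normrM normfV (gtr0_norm (x := 1 - _)); last lra.
  rewrite ler_pdivrMr; last lra.
  have := peval_bound (ltW r0) (hterm K) hr => /le_trans; apply.
  have : 0 <= B * (1 / 2) ^+ K by rewrite mulr_ge0 // exprn_ge0.
  by set z := B * _ => z0; rewrite -mulrA -/z; nra.
rewrite eG; set z1 := peval P2 h / _ in main *; set z2 :=
  \sum_(m <- F) _ in tail *.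
have -> : z1 - z2 = (z1 - peval S h) - (z2 - peval S h) by ring.
rewrite (le_lt_trans (ler_normB _ _)) //; lra.
Qed.

Theorem regular_real_analytic (A : set 'rV[R]_n) f :
  regular_on A f -> real_analytic_on A f.
Proof.
move=> reg a Aa; have [P [Q [Qa hf]]] := reg a Aa.
exists [set x | peval Q x != 0], (fun x => peval P x / peval Q x); split.
- split=> //; rewrite openE => b Qb; apply/near_norm.
  have [u [r [r0 u0 hu hQ]]] := normalized_denominator Qb.
  exists r => // x /ltW xb; have -> : x = b + (x - b) by rewrite addrC subrK.
  have := peval_bound (ltW r0) hu xb; rewrite ler_norml => hx.
  by rewrite /= hQ mulf_neq0 //; lra.
- by move=> b; exact: fraction_analytic.
by move=> x [Ax Qx]; rewrite hf.
Qed.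
End RegularAnalytic.

(** * Plane algebraic curves have dimension one *)
Section PolynomialFunctions.
Variables (R : realType) (n : nat).
Implicit Types (g h : 'rV[R]_n -> R) (V Z : set 'rV[R]_n).

Definition polyfun g := exists P : mpoly.mpoly n R, forall x, peval P x = g x.

Lemma polyfun_const c : polyfun (fun=> c).
Proof. by exists (mpolyC n c) => x; rewrite /peval mevalC. Qed.

Lemma polyfun_coord i : polyfun (fun x => x 0 i).
Proof. by exists (mpolyX R (mnm1 i)) => x; rewrite /peval mevalXU. Qed.

Lemma polyfunD g h : polyfun g -> polyfun h -> polyfun (fun x => g x + h x).
Proof. by move=> [P hP] [Q hQ]; exists (P + Q) => x;
  rewrite /peval mevalD -hP -hQ. Qed.

Lemma polyfunM g h : polyfun g -> polyfun h -> polyfun (fun x => g x * h x).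
Proof. by move=> [P hP] [Q hQ]; exists (P * Q) => x;
  rewrite /peval mevalM -hP -hQ. Qed.

Lemma polyfunB g h : polyfun g -> polyfun h -> polyfun (fun x => g x - h x).
Proof. by move=> [P hP] [Q hQ]; exists (P - Q) => x;
  rewrite /peval mevalB -hP -hQ. Qed.

Lemma polyfun_sum (I : Type) (s : seq I) (F : I -> 'rV[R]_n -> R) :
  (forall i, polyfun (F i)) -> polyfun (fun x => \sum_(i <- s) F i x).
Proof.
move=> hF; elim: s => [|i s IH].
  by under [X in polyfun X]eq_fun do rewrite big_nil; exact: polyfun_const.
under [X in polyfun X]eq_fun do rewrite big_cons; exact: polyfunD.
Qed.

Lemma polyfun_prod (I : Type) (s : seq I) (F : I -> 'rV[R]_n -> R) :
  (forall i, polyfun (F i)) -> polyfun (fun x => \prod_(i <- s) F i x).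
Proof.
move=> hF; elim: s => [|i s IH].
  by under [X in polyfun X]eq_fun do rewrite big_nil; exact: polyfun_const.
under [X in polyfun X]eq_fun do rewrite big_cons; exact: polyfunM.
Qed.

Lemma polyfun_affine m (a : 'rV[R]_n) (M : 'M[R]_(n, m)) j :
  polyfun (fun x => ((x - a) *m M) 0 j).
Proof.
under [X in polyfun X]eq_fun do rewrite mxE.
apply: polyfun_sum => i; apply: polyfunM; last exact: polyfun_const.
under [X in polyfun X]eq_fun do rewrite mxE.
apply: polyfunD; [exact: polyfun_coord | exact: polyfun_const].
Qed.

Lemma polyfun_bev (W : {poly {poly R}}) g h :
  polyfun g -> polyfun h -> polyfun (fun x => bev (g x) (h x) W).
Proof.
move=> hg hh; elim/poly_ind: W => [|W c IH].
  by under [X in polyfun X]eq_fun do rewrite rmorph0; exact: polyfun_const.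
under [X in polyfun X]eq_fun do
  rewrite bevE hornerMXaddC hornerD hornerM hornerC -bevE.
apply: polyfunD; first exact: polyfunM.
elim/poly_ind: c => [|c d IHc].
  by under [X in polyfun X]eq_fun do rewrite horner0; exact: polyfun_const.
under [X in polyfun X]eq_fun do rewrite hornerMXaddC.
by apply: polyfunD; [exact: polyfunM | exact: polyfun_const].
Qed.

Lemma algebraic_zeros (I : Type) (g : I -> 'rV[R]_n -> R) :
  (forall i, polyfun (g i)) -> algebraic_set [set x | forall i, g i x = 0].
Proof.
move=> hg; exists [set P | exists i, forall x, peval P x = g i x].
apply/seteqP; split=> x /= h; first by move=> P [i ->].
by move=> i; have [P hP] := hg i; rewrite -hP; apply: h; exists i.
Qed.

Lemma algebraic_setI V Z :
  algebraic_set V -> algebraic_set Z -> algebraic_set (V `&` Z).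
Proof.
move=> [S ->] [T ->]; exists (S `|` T); apply/seteqP; split=> x /=.
  by move=> [h1 h2] P [/h1|/h2].
by move=> h; split=> P hP; apply: h; [left | right].
Qed.

Lemma algebraic_zero g : polyfun g -> algebraic_set [set x | g x = 0].
Proof.
move=> hg; have := @algebraic_zeros unit (fun=> g) (fun=> hg).
by congr algebraic_set; apply/seteqP; split=> x /= h // ; apply: h.
Qed.

Lemma sum_sqr_eq0 (x : 'rV[R]_n) : \sum_i x 0 i ^+ 2 = 0 -> x = 0.
Proof.
move=> /eqP; rewrite psumr_eq0 => [/allP h|i _]; last exact: sqr_ge0.
apply/rowP => i; rewrite mxE; apply/eqP.
by have := h i; rewrite mem_index_enum sqrf_eq0; apply.
Qed.

Lemma algebraic_finite V : finite_set V -> algebraic_set V.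
Proof.
move=> /finite_fsetP[F ->].
have hp : polyfun (fun x => \prod_(w <- enum_fset F) \sum_i (x - w) 0 i ^+ 2).
  apply: polyfun_prod => w; apply: polyfun_sum => i.
  under [X in polyfun X]eq_fun do rewrite mxE expr2.
  by apply: polyfunM; apply: polyfunD; [exact: polyfun_coord | exact:
    polyfun_const
    | exact: polyfun_coord | exact: polyfun_const].
have := algebraic_zero hp; congr algebraic_set; apply/seteqP; split=> x /=.
  move/eqP; rewrite prodf_seq_eq0 => /hasP[w wF /= /eqP/sum_sqr_eq0/eqP].
  by rewrite subr_eq0 => /eqP ->.
move=> xF; apply/eqP; rewrite prodf_seq_eq0; apply/hasP; exists x => //=.
by rewrite subrr big1 // => i _; rewrite mxE expr0n.
Qed.

Lemma irreducible_prime Z g h : irreducible_algebraic Z -> polyfun g ->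
  polyfun h ->
  (forall x, Z x -> g x * h x = 0) ->
  (forall x, Z x -> g x = 0) \/ (forall x, Z x -> h x = 0).
Proof.
move=> [aZ _ irr] hg hh gh.
have sub k : Z = Z `&` [set x | k x = 0] -> forall x, Z x -> k x = 0.
  by move=> e x Zx; have [] : (Z `&` [set x | k x = 0]) x by rewrite -e.
have [|||eg|eh] := irr (Z `&` [set x | g x = 0]) (Z `&` [set x | h x = 0]).
- by apply: algebraic_setI => //; exact: algebraic_zero.
- by apply: algebraic_setI => //; exact: algebraic_zero.
- apply/seteqP; split=> x; last by case=> -[].
  move=> Zx; have /eqP := gh x Zx; rewrite mulf_eq0 => /orP[]/eqP h0;
    [left|right] => //.
- by left; apply: sub.
by right; apply: sub.
Qed.

Lemma algebraic_separation V Z : algebraic_set V -> ~ Z `<=` V ->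
  exists g, [/\ polyfun g, forall x, V x ->
    g x = 0 & exists2 x, Z x & g x != 0].
Proof.
move=> [S ->] nZ; apply: contrapT => h; apply: nZ => x Zx P SP.
apply/eqP; apply: contrapT => /negP Px; apply: h; exists (peval P); split.
- by exists P.
- by move=> y; apply.
by exists x.
Qed.

Lemma irreducible_set1 z : irreducible_algebraic [set z : 'rV[R]_n].
Proof.
split; [exact/algebraic_finite/finite_set1 | by exists z |].
move=> V1 V2 _ _ e; have : (V1 `|` V2) z by rewrite -e.
have sub i (Vi : set 'rV[R]_n) : i = (V1 `|` V2) -> Vi `<=` i -> Vi z ->
  [set z] = Vi.
  move=> -> sub Vz; apply/seteqP; split=> x; first by move=> ->.
  by move=> /sub; rewrite -e.
by case=> [/(sub _ V1 erefl)|/(sub _ V2 erefl)] h; [left | right]; apply: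
  h => x; [left|right].
Qed.

(** A finite set with at least two points splits off a point. *)
Lemma irreducible_chain_infinite Z0 Z1 : irreducible_algebraic Z0 ->
  irreducible_algebraic Z1 -> Z0 `<` Z1 -> infinite_set Z1.
Proof.
move=> [_ [w Z0w] _] [_ _ irr] [sub nsub] fin.
have [z [Z1z Z0z]] : exists z, Z1 z /\ ~ Z0 z.
  apply: contrapT => h; apply: nsub => z Z1z; apply: contrapT => Z0z.
  by apply: h; exists z.
have [|||e|e] := irr [set z] (Z1 `\ z).
- exact/algebraic_finite/finite_set1.
- by apply/algebraic_finite/(sub_finite_set _ fin) => x [].
- apply/seteqP; split=> x; last by case=> [->|[]].
  by move=> Zx; have [->|nx] := pselect (x = z); [left | right; split].
- by apply: Z0z; have := sub _ Z0w; rewrite e => <-.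
have [_ nzz] : (Z1 `\ z) z by rewrite -e.
exact: nzz.
Qed.
End PolynomialFunctions.

Section PlaneCurves.
Variables (R : realType) (n : nat).
Variables (a : 'rV[R]_n) (N : 'M[R]_(2, n)) (M : 'M[R]_(n, 2)).
Hypothesis NM : N *m M = 1%:M.
Variable F : {poly {poly R}}.

(** Thus the curve has finitely many points on the lines where the second
    coordinate is constant. *)
Hypothesis F_slice : forall y, map_poly (horner_eval y) F != 0.

Definition vec2 (s y : R) : 'rV[R]_2 := \row_j (if j == 0 then s else y).

Lemma vec2_eta (v : 'rV[R]_2) : v = vec2 (v 0 0) (v 0 1).
Proof.
apply/rowP => j; rewrite mxE; case: eqP => [->//|]; case: j => [[|[|//]]] hj.
  by case; exact: val_inj.
by move=> _; congr (v 0 _); exact: val_inj.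
Qed.

Lemma vec2_0 s y : vec2 s y 0 0 = s. Proof. by rewrite mxE. Qed.
Lemma vec2_1 s y : vec2 s y 0 1 = y. Proof. by rewrite mxE. Qed.

(** The image of a set of coordinates in the affine plane with origin [a] and
    basis the rows of [N]; the matrix [M] recovers the coordinates. *)
Definition planar (D : set 'rV[R]_2) : set 'rV[R]_n :=
  [set a + v *m N | v in D].

Let C := planar [set v | bev (v 0 0) (v 0 1) F = 0].
Let X (x : 'rV[R]_n) := ((x - a) *m M) 0 0.
Let Y (x : 'rV[R]_n) := ((x - a) *m M) 0 1.

Lemma planar_coordsK v : (a + v *m N - a) *m M = v.
Proof. by rewrite addrC addKr -mulmxA NM mulmx1. Qed.

Lemma curve_mem x : C x <-> bev (X x) (Y x) F = 0 /\ x = a + vec2 (X x) (Y x)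
  *m N.
Proof.
split=> [[v Fv <-]|[h e]]; rewrite /X /Y ?planar_coordsK -?vec2_eta //.
by exists (vec2 (X x) (Y x)); rewrite /= ?vec2_0 ?vec2_1.
Qed.

Let polyX : polyfun X. Proof. exact: polyfun_affine. Qed.
Let polyY : polyfun Y. Proof. exact: polyfun_affine. Qed.

Lemma curve_algebraic : algebraic_set C.
Proof.
have p1 : polyfun (fun x => bev (X x) (Y x) F) by exact: polyfun_bev.
have p2 i : polyfun (fun x => x 0 i - (a + vec2 (X x) (Y x) *m N) 0 i).
  apply: polyfunB; first exact: polyfun_coord.
  under [W in polyfun W]eq_fun do rewrite mxE [(_ *m _) _ _]mxE big_ord_recl
    big_ord1.
  apply: polyfunD; first exact: polyfun_const.
  under [W in polyfun W]eq_fun do rewrite ![vec2 _ _ _ _]mxE.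
  by apply: polyfunD; apply: polyfunM => //; exact: polyfun_const.
have := algebraic_setI (algebraic_zero p1) (algebraic_zeros p2).
congr algebraic_set; apply/seteqP; split=> x.
  move=> [h1 h2]; apply/curve_mem; split=> //; apply/rowP => i.
  by apply/eqP; rewrite -subr_eq0 h2.
by move=> /curve_mem[h1 h2]; split=> // i; rewrite -h2 subrr.
Qed.

Lemma plane_restrict (g : 'rV[R]_n -> R) : polyfun g ->
  exists W, forall s y, bev s y W = g (a + vec2 s y *m N).
Proof.
move=> [P hP].
pose c i : {poly {poly R}} := (coords a i)%:P%:P +
  (coords (row 0 N) i)%:P *: 'X + (coords (row 1 N) i *: 'X)%:P.
exists (mpoly_eval (polyC \o polyC) c P) => s y.
rewrite mpoly_evalP => [|d]; last by rewrite bevE /= !hornerC.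
rewrite -hP; congr peval; apply/rowP => i.
rewrite mxE bevE !hornerD !hornerC hornerZ hornerX !hornerM !hornerC.
rewrite hornerZ hornerX !coordsE !mxE big_ord_recl big_ord1 !mxE /=.
have -> : lift ord0 ord0 = 1 :> 'I_2 by exact: val_inj.
by rewrite mulrC [_ * y]mulrC addrA.
Qed.

Lemma curve_restrict (g : 'rV[R]_n -> R) : polyfun g ->
  exists W, forall x, C x -> bev (X x) (Y x) W = g x.
Proof.
move=> /plane_restrict[W hW]; exists W => x /curve_mem[_ ex].
by rewrite hW -ex.
Qed.

Lemma slice_bev (y s : R) W : (map_poly (horner_eval y) W).[s] = bev s y W.
Proof.
rewrite bevE -[RHS]/(horner_eval y W.[s%:P]) -horner_map /=; congr (_.[_]).
by rewrite /horner_eval hornerC.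
Qed.

Lemma curve_line_finite (c : {poly R}) : c != 0 ->
  finite_set (C `&` [set x | c.[Y x] = 0]).
Proof.
move=> c0; apply: (@sub_finite_set _ _ (\bigcup_(y in [set y | c.[y] = 0])
   [set a + vec2 s y *m N | s in [set s | (map_poly (horner_eval y) F).[s] =
     0]])).
  move=> x [/curve_mem[Fx ex] cx]; exists (Y x) => //; exists (X x) => //=.
  by rewrite slice_bev.
apply: bigcup_finite; first exact: roots_finite.
by move=> y _; apply: finite_image; apply: roots_finite.
Qed.

(** The remainder of the pseudo-division of [W] by [G] vanishes on [S] and has
    a smaller degree than [G]. *)
Lemma minimal_divides (S : set 'rV[R]_n) (G W : {poly {poly R}}) :
  G != 0 -> (forall x, S x -> bev (X x) (Y x) G = 0) ->
  (forall x, S x -> bev (X x) (Y x) W = 0) ->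
  (forall W', W' != 0 -> (forall x, S x -> bev (X x) (Y x) W' = 0) ->
     (size G <= size W')%N) ->
  exists k Q, (lead_coef G ^+ k)%:P * W = Q * G.
Proof.
move=> G0 hG hW minG.
have := Pdiv.Idomain.divp_eq W G; set k := scalp W G => e.
exists k, (W %/ G); rewrite mul_polyC e [W %% G](_ : _ = 0) ?addr0 //.
apply/eqP; apply: contraT => r0.
have := minG _ r0; rewrite leqNgt Pdiv.CommonIdomain.ltn_modpN0 //;
  apply => x Sx.
have -> : W %% G = lead_coef G ^+ k *: W - W %/ G * G by rewrite e addrC addKr.
by rewrite rmorphB rmorphM hG // mulr0 subr0 -mul_polyC rmorphM hW // mulr0.
Qed.

Lemma bev_polyC (c : {poly R}) s y : bev s y c%:P = c.[y].
Proof. by rewrite bevE hornerC. Qed.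

Lemma infinite_not_line (S : set 'rV[R]_n) (c : {poly R}) : S `<=` C ->
  infinite_set S -> (forall x, S x -> c.[Y x] = 0) -> c = 0.
Proof.
move=> SC iS hc; apply/eqP; apply: contraT => c0; case: iS.
by apply: sub_finite_set (curve_line_finite c0) => x Sx; split; [apply:
  SC | apply: hc].
Qed.

(** Let [G1] and [G2] be nonzero polynomials of minimal degree in the ideals of
    [Z1] and [Z2]. They have the same degree, since [G1] divides the product of
    [G2] by a polynomial in the second coordinate, which has finitely many
    zeros on [C], and the ideal of [Z2] is prime. But then [G2] divides the
    elements of both ideals, again up to such factors, and the ideals coincide.
    *)
Lemma chain_length_le1 Z0 Z1 Z2 :
  irreducible_algebraic Z0 -> irreducible_algebraic Z1 ->
  irreducible_algebraic Z2 -> Z0 `<` Z1 -> Z1 `<` Z2 -> Z2 `<=` C -> False.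
Proof.
move=> i0 i1 i2 Z01 [Z12 nZ21] Z2C.
have inf1 := irreducible_chain_infinite i0 i1 Z01.
have inf2 : infinite_set Z2 by move=> f2; apply: inf1; exact: sub_finite_set f2.
have Z1C : Z1 `<=` C by exact: subset_trans Z2C.
have F0 : F != 0 by apply: contraNneq (F_slice 0) => ->; rewrite map_poly0.
pose I (S : set 'rV[R]_n) W := W != 0 /\ forall x, S x -> bev (X x) (Y x) W = 0.
have FC S : S `<=` C -> I S F.
  by move=> SC; split=> // x /SC /curve_mem[].
have [G1 [[G10 hG1] min1]] :=
  @exists_minimal _ (I Z1) (fun W => size W) F (FC Z1 Z1C).
have [G2 [[G20 hG2] min2]] :=
  @exists_minimal _ (I Z2) (fun W => size W) F (FC Z2 Z2C).
have prime W W' : (forall x, Z2 x -> bev (X x) (Y x) (W * W') = 0) ->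
    (forall x, Z2 x -> bev (X x) (Y x) W = 0) \/
    (forall x, Z2 x -> bev (X x) (Y x) W' = 0).
  move=> h; apply: (irreducible_prime i2).
  - exact: polyfun_bev.
  - exact: polyfun_bev.
  - by move=> x Z2x; rewrite -rmorphM h.
have lead_ne G k : G != 0 ->
    ~ (forall x, Z2 x -> bev (X x) (Y x) (lead_coef G ^+ k)%:P = 0).
  move=> G0 h; have /eqP : lead_coef G ^+ k = 0.
    by apply: (infinite_not_line Z2C inf2) => x /h; rewrite bev_polyC.
  by rewrite expf_eq0 lead_coef_eq0 (negPf G0) andbF.
have size1 : (1 < size G1)%N.
  rewrite ltnNge; apply/negP => /size1_polyC e; move: G10 hG1;
    rewrite e => c0 h.
  move/negP: c0; apply; apply/eqP; congr polyC.
  by apply: (infinite_not_line Z1C inf1) => x /h; rewrite bev_polyC.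
have [g [pg g1 [z Z2z gz]]] := algebraic_separation (let: And3 h _ _ :=
  i1 in h) nZ21.
have [A hA] := curve_restrict pg.
have A1 x : Z1 x -> bev (X x) (Y x) A = 0.
  by move=> Z1x; rewrite hA ?g1 //; apply: Z1C.
have nA2 : ~ forall x, Z2 x -> bev (X x) (Y x) A = 0.
  by move=> h; move: gz; rewrite -hA ?h ?eqxx //; apply: Z2C.
have le12 : (size G1 <= size G2)%N.
  by apply: min1; split=> // x /Z12; exact: hG2.
have [eq12|lt12] := eqVneq (size G1) (size G2).
  have [||k [Q e]] := @minimal_divides Z1 G2 A G20 _ A1.
  - by move=> x /Z12; exact: hG2.
  - by move=> W' W'0 h; rewrite -eq12; apply: min1.
  have [|h|//] := prime (lead_coef G2 ^+ k)%:P A.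
    by move=> x Z2x; rewrite e rmorphM hG2 ?mulr0.
  exact: lead_ne h.
have [||k [Q e]] := @minimal_divides Z1 G1 G2 G10 hG1.
- by move=> x /Z12; exact: hG2.
- by move=> W' W'0 h; apply: min1.
have sz : size G2 = (size Q + size G1).-1.
  have l0 : lead_coef G1 ^+ k != 0 by rewrite expf_neq0 // lead_coef_eq0.
  rewrite -size_mul //; last first.
    apply: contraTneq isT => Q0; move: e; rewrite Q0 mul0r => /eqP.
    by rewrite mulf_eq0 polyC_eq0 (negPf l0) (negPf G20).
  by rewrite -e mul_polyC size_scale.
have Q0 : Q != 0.
  apply: contraNneq G20 => Q0; move/eqP: e; rewrite Q0 mul0r mulf_eq0.
  by rewrite polyC_eq0 expf_eq0 lead_coef_eq0 (negPf G10) andbF.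
have Qs : (0 < size Q)%N by rewrite size_poly_gt0.
have [|h|h] := prime Q G1.
- by move=> x Z2x; rewrite -e rmorphM hG2 ?mulr0.
- have := min2 Q; rewrite sz => /(_ (conj Q0 h)); lia.
have := min2 G1; move=> /(_ (conj G10 h)) le21.
by move: lt12; rewrite eqn_leq le12 le21.
Qed.

(** Let [G] be of minimal degree among the polynomials with infinitely many
    zeros on [C], and [Z1] the set of these zeros where the leading coefficient
    of [G] is not zero. A polynomial with infinitely many zeros on [Z1]
    vanishes on [Z1], by [minimal_divides]: the Zariski closure of [Z1] is
    irreducible. *)
Lemma infinite_irreducible_subset : infinite_set C ->
  exists Z, [/\ irreducible_algebraic Z, Z `<=` C & infinite_set Z].
Proof.
move=> infC.
pose I W := W != 0 /\ infinite_set (C `&` [set x | bev (X x) (Y x) W = 0]).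
have IF : I F.
  split; first by apply: contraNneq (F_slice 0) => ->; rewrite map_poly0.
  by apply: contra_not infC; apply: sub_finite_set => x Cx; split=> //;
    case/curve_mem: Cx.
have [G [[G0 infG] minG]] := @exists_minimal _ I (fun W => size W) F IF.
pose Z1 := (C `&` [set x | bev (X x) (Y x) G = 0]) `\`
           (C `&` [set x | (lead_coef G).[Y x] = 0]).
have inf1 : infinite_set Z1.
  by apply: infinite_setD => //; apply: curve_line_finite;
    rewrite lead_coef_eq0.
have Z1C : Z1 `<=` C by move=> x [[]].
have key g : polyfun g -> infinite_set (Z1 `&` [set x | g x = 0]) ->
    forall x, Z1 x -> g x = 0.
  move=> pg ig; have [W hW] := curve_restrict pg.
  have [|||k [Q e]] := @minimal_divides (Z1 `&` [set x | g x = 0]) G W G0.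
  - by move=> x [[[]]].
  - by move=> x [/Z1C Cx gx]; rewrite hW.
  - move=> W' W'0 h; apply: minG; split=> //.
    apply: contra_not ig; apply: sub_finite_set => x [Z1x gx]; split;
      first exact: Z1C.
    by apply: h.
  move=> x Z1x; have [[Cx Gx] nl] := Z1x; rewrite -hW //.
  have : bev (X x) (Y x) ((lead_coef G ^+ k)%:P * W) = 0.
    by rewrite e rmorphM [bev _ _ G]Gx mulr0.
  rewrite rmorphM => /eqP; rewrite mulf_eq0 => /orP[|/eqP//].
  rewrite bev_polyC horner_exp expf_eq0 => /andP[_ /eqP l0].
  by case: nl.
pose Z := [set x | forall P : mpoly n R, (forall y, Z1 y -> peval P y = 0) ->
  peval P x = 0].
have Z1Z : Z1 `<=` Z by move=> x Z1x P; apply.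
have aZ : algebraic_set Z by exists [set P | forall y, Z1 y -> peval P y = 0].
have infZ : infinite_set Z by move=> fZ; apply: inf1; exact: sub_finite_set fZ.
have sub V : algebraic_set V -> infinite_set (Z1 `&` V) -> Z `<=` V.
  move=> [S ->] iV x Zx P SP; apply: Zx; apply: key; first by exists P.
  by apply: contra_not iV; apply: sub_finite_set => y [Z1y h]; split=> //;
    exact: h.
exists Z; split=> //; last first.
  have [S eC] := curve_algebraic.
  move=> x Zx; rewrite eC => P SP; apply: Zx => y Z1y.
  by have := Z1C _ Z1y; rewrite eC; apply.
split=> //; first by have [x Zx] := infinite_setN0 infZ; exists x.
move=> V1 V2 a1 a2 e.
have [f1|i1] := pselect (finite_set (Z1 `&` V1)); last first.
  left; apply/seteqP; split; first exact: sub.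
  by rewrite e => x Vx; left.
right; apply/seteqP; split; last by rewrite e => x Vx; right.
apply: sub => // f2; apply: inf1.
apply: (@sub_finite_set _ _ ((Z1 `&` V1) `|` (Z1 `&` V2))); last
  by rewrite finite_setU.
by move=> x Z1x; have := Z1Z x Z1x; rewrite e => -[]; [left|right].
Qed.

Theorem planar_algebraic_curve : infinite_set C -> algebraic_curve C.
Proof.
move=> infC; split; first exact: curve_algebraic.
split.
  have [Z [irrZ ZC infZ]] := infinite_irreducible_subset infC.
  have [z Zz] := infinite_setN0 infZ.
  exists (fun i => if i == 0%N then [set z] else Z); split=> i.
    case: eqP => _ _; split=> //; first exact: irreducible_set1.
    by move=> x ->; apply: ZC.
  rewrite ltnS leqn0 => /eqP -> /=; split; first by move=> x ->.
  by move=> sub; apply: infZ; apply: sub_finite_set sub _; exact: finite_set1.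
move=> [|[|e]] // [Z [hZ sZ]]; exfalso.
have [[i0 _] [i1 _] [i2 s2]] := And3 (hZ 0%N isT) (hZ 1%N isT) (hZ 2%N isT).
exact: (chain_length_le1 i0 i1 i2 (sZ 0%N isT) (sZ 1%N isT) s2).
Qed.
End PlaneCurves.

(** * The test curves *)
Section Arcs.
Variable R : realType.

(** Up to the weight [p * q], the set [D] contains the arc of [x ^ p = y ^ q]
    given by [(t ^ q, t ^ p)]. *)
Definition cuspidal_arc (p q : nat) (D : set 'rV[R]_2) :=
  forall t : R, 0 < t < 1 / 2 -> exists x, [/\ 0 <= x <= t ^+ q,
    `|x - t ^+ q| <= 2 * t ^+ (p * q) & D (vec2 x (t ^+ p))].

Lemma E_curve_arc p q : cuspidal_arc p q (E_curve p q).
Proof.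
move=> t /andP[t0 _]; exists (t ^+ q); split;
  rewrite ?lexx ?exprn_ge0 ?(ltW t0) //.
  by rewrite subrr normr0 mulr_ge0 // exprn_ge0 // ltW.
by rewrite /E_curve /= vec2_0 vec2_1 -!exprM mulnC subrr.
Qed.

(** The intermediate value theorem gives [x]; the perturbation of the equation
    is of weight at least [2 * p * q]. *)
Lemma C_curve_arc p q : (0 < p)%N -> (p < q)%N ->
  cuspidal_arc p q (C_curve p q).
Proof.
move=> p0 pq t /andP[t0 t12]; have t1 : t <= 1 by lra.
have q0 : (0 < q)%N by lia.
pose Y := t ^+ (p * q).
have Y0 : 0 < Y by rewrite exprn_gt0.
have Y12 : Y <= 1 / 2.
  apply: (@le_trans _ _ (t ^+ 1)); last by rewrite expr1 ltW.
  by rewrite ler_wiXn2l ?(ltW t0) //; nia.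
have tq0 : 0 < t ^+ q by rewrite exprn_gt0.
have tqp : (t ^+ q) ^+ p = Y by rewrite -exprM mulnC.
have tp2q : (t ^+ p) ^+ (2 * q) = Y ^+ 2 by rewrite -!exprM; congr (_ ^+ _);
  lia.
have tpq : (t ^+ p) ^+ q = Y by rewrite -exprM.
have tq2q : (t ^+ q) ^+ (2 * q) <= Y ^+ 2.
  by rewrite -!exprM ler_wiXn2l ?(ltW t0) //; nia.
pose P : {poly R} := 'X^p + 'X^(2 * q) - (Y - Y ^+ 2)%:P.
have hP x : P.[x] = x ^+ p + x ^+ (2 * q) - (Y - Y ^+ 2).
  by rewrite /P hornerD hornerN hornerC hornerD !hornerXn.
have [||x /andP[x0 xt] /rootP] := @poly_ivt R P 0 (t ^+ q); first exact: ltW.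
  rewrite !hP !expr0n tqp; have -> : (p == 0)%N = false by lia.
  have -> : (2 * q == 0)%N = false by lia.
  have : 0 <= (t ^+ q) ^+ (2 * q) by rewrite exprn_ge0 // ltW.
  by rewrite /= ; nra.
rewrite hP => hx; exists x; split; rewrite ?x0 ?xt //; last first.
  by rewrite /C_curve /= vec2_0 vec2_1 tpq tp2q; lra.
rewrite distrC ger0_norm ?subr_ge0 // -/Y.
apply: (@le_trans _ _ (2 * t ^+ q * Y)); last first.
  rewrite -mulrA ler_wpM2l // -[leRHS]mul1r ler_wpM2r ?(ltW Y0) //.
  by rewrite exprn_ile1 ?(ltW t0).
rewrite lerBlDr -lerBlDl leNgt; apply/negP => lt.
have e1 : t ^+ q - 2 * t ^+ q * Y = t ^+ q * (1 - 2 * Y) by ring.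
have a0 : 0 <= 1 - 2 * Y by lra.
have a1 : 1 - 2 * Y <= 1 by lra.
have h1 : x ^+ p <= Y * (1 - 2 * Y).
  apply: (@le_trans _ _ ((t ^+ q * (1 - 2 * Y)) ^+ p)).
    by rewrite lerXn2r ?nnegrE ?mulr_ge0 ?(ltW tq0) // -e1 ltW.
  rewrite exprMn tqp ler_wpM2l ?(ltW Y0) // -[leRHS]expr1.
  by rewrite ler_wiXn2l.
have h2 : x ^+ (2 * q) < Y ^+ 2.
  apply: lt_le_trans tq2q; rewrite ltrXn2r ?nnegrE ?(ltW tq0) //; first
    by rewrite muln_eq0 negb_or; lia.
  by apply: (lt_le_trans lt); rewrite e1 ler_piMr // ltW.
move: hx h1 h2; move: (x ^+ p) (x ^+ (2 * q)) => z1 z2.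
by nra.
Qed.

Lemma bev_high_order (W : {poly {poly R}}) N :
  (forall i j, (i + j < N)%N -> W`_i`_j = 0) ->
  exists2 K, 0 <= K & forall s y r, `|s| <= r -> `|y| <= r -> r <= 1 ->
    `|bev s y W| <= K * r ^+ N.
Proof.
move=> h; exists (\sum_(i < size W) \sum_(j < size W`_i) `|W`_i`_j|).
  by rewrite sumr_ge0 // => i _; rewrite sumr_ge0.
move=> s y r sr yr r1; have r0 : 0 <= r by exact: le_trans sr.
rewrite bevE (horner_coef W) horner_sum mulr_suml.
apply: le_trans (ler_norm_sum _ _ _) (ler_sum _ _) => i _.
rewrite hornerM horner_exp hornerC horner_coef mulr_suml mulr_suml.
apply: le_trans (ler_norm_sum _ _ _) (ler_sum _ _) => j _.
have [ij|ij] := ltnP (i + j) N; first by rewrite h // !mul0r normr0 mul0r.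
rewrite !normrM !normrX -mulrA ler_wpM2l //.
apply: (@le_trans _ _ (r ^+ (i + j))); last by rewrite ler_wiXn2l.
by rewrite addnC exprD ler_pM ?exprn_ge0 // lerXn2r ?nnegrE.
Qed.

Lemma vec2_row_norm n (A : 'M[R]_(2, n)) : exists2 K, 0 <= K &
  forall s y r, `|s| <= r -> `|y| <= r -> `|vec2 s y *m A| <= K * r.
Proof.
pose K := \sum_j (`|A 0 j| + `|A 1 j|).
have K0 : 0 <= K by rewrite sumr_ge0 // => j _; rewrite addr_ge0.
exists K => // s y r sr yr; have r0 : 0 <= r by exact: le_trans sr.
apply: row_norm_le => [|j]; first by rewrite mulr_ge0.
rewrite mxE big_ord_recl big_ord1 (_ : lift ord0 ord0 = 1); last exact: val_inj.
rewrite vec2_0 vec2_1 (le_trans (ler_normD _ _)) // !normrM.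
apply: (@le_trans _ _ ((`|A 0 j| + `|A 1 j|) * r)).
  by rewrite mulrDl lerD // mulrC ler_wpM2l.
by rewrite ler_wpM2r // /K (bigD1 j) //= lerDl sumr_ge0.
Qed.

Lemma row_mul_norm m n (A : 'M[R]_(m, n)) : exists2 K, 0 <= K &
  forall (x : 'rV[R]_m) j, `|(x *m A) 0 j| <= K * `|x|.
Proof.
exists (\sum_j \sum_i `|A i j|).
  by rewrite sumr_ge0 // => j _; rewrite sumr_ge0.
move=> x j; rewrite (bigD1 j) //= mulrDl -[leLHS]addr0 lerD //; last first.
  by rewrite mulr_ge0 // sumr_ge0 // => k _; rewrite sumr_ge0.
rewrite mxE mulr_suml; apply:
  le_trans (ler_norm_sum _ _ _) (ler_sum _ _) => i _.
by rewrite normrM mulrC ler_wpM2l // row_norm_ge.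
Qed.

Lemma weight_unique p q k l k' l' : (0 < p)%N -> coprime p q ->
  (q * k + p * l < p * q)%N -> (q * k + p * l = q * k' + p * l')%N ->
  k = k' /\ l = l'.
Proof.
move=> p0 cpq lt e.
have half i j i' j' : (i < p)%N -> (i' <= i)%N ->
    (q * i + p * j = q * i' + p * j')%N -> i = i'.
  move=> ip le e1.
  have dv : (p %| q * (i - i'))%N.
    have -> : (q * (i - i') = p * (j' - j))%N by nia.
    exact: dvdn_mulr.
  rewrite Gauss_dvdr // in dv; have : (i - i' = 0)%N.
    by apply/eqP; apply: contraTT dv => nz; rewrite gtnNdvd ?lt0n //; lia.
  by lia.
have kp : (k < p)%N by nia.
have k'p : (k' < p)%N by nia.
have kk : k = k'.
  have [le|/ltnW le] := leqP k' k; first exact: half kp le e.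
  exact/esym/(half _ _ _ _ k'p le (esym e)).
by split=> //; apply/eqP; rewrite -(eqn_pmul2l p0); apply/eqP; rewrite kk in e;
  lia.
Qed.

(** Let [T] be the Taylor polynomial of order [q] of an analytic extension of
    [f]. Along the arc [P - Q * T] is of order [p * q]. The monomials of weight
    [q * i + p * j] below [p * q] do not interfere by [weight_unique], so that
    their coefficients in [P - Q * T] are zero; they include all the monomials
    of degree below [p]. *)
Lemma curve_quotient n (a : 'rV[R]_n) (N : 'M[R]_(2, n)) (M : 'M[R]_(n, 2))
    (D : set 'rV[R]_2) p q (P Q : mpoly n R) f :
  N *m M = 1%:M -> prime p -> (p < q)%N -> coprime p q -> D 0 ->
  cuspidal_arc p q D -> real_analytic_on (planar a N D) f ->
  (forall x, peval Q x * f x = peval P x) ->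
  exists (T : mpoly n R) (K d : R), 0 < d /\
    forall x, planar a N setT x -> `|x - a| < d ->
      `|peval P x - peval Q x * peval T x| <= K * `|x - a| ^+ p.
Proof.
move=> NM pp pq cpq D0 arc ana hf.
have p0 := prime_gt0 pp.
have aC : planar a N D a by exists 0 => //; rewrite mul0mx addr0.
have [U [G [oU anG eG]]] := ana a aC.
have [T [K [d [d0 hT]]]] := analytic_taylor q (anG a (oU.2)).
have /near_norm[d1 d10 hU] : \forall x \near a, U x by exact: open_nbhs_nbhs oU.
exists T.
have polP (S : mpoly n R) : polyfun (peval S) by exists S.
have [QW hQW] := plane_restrict a N (polP Q).
have [H hH] := plane_restrict a N (polyfunB (polP P) (polyfunM (polP Q) (polP
  T))).
have [BQ BQ0 hBQ] := bev_bounded QW.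
have [L L0 hL] := bev_lipschitz H.
have [K1 K10 hK1] := vec2_row_norm N.
have low i j : (q * i + p * j < p * q)%N -> H`_i`_j = 0.
  pose d2 := Num.min (1 / 2) (Num.min d d1 / (K1 + 1)).
  apply: (@weighted_order R H q p (p * q) (BQ * (`|K| * K1 ^+ q) + L * 2) d2).
  - by rewrite lt_min divr_gt0 //= divr_gt0 ?lt_min ?d0 //; lra.
  - move=> t /andP[t0]; rewrite lt_min => /andP[t12 td].
    have [|x [/andP[x0 xt] hx Dx]] := arc t; first by rewrite t0.
    have t1 : t <= 1 by lra.
    have tp0 : 0 <= t ^+ p by rewrite exprn_ge0 // ltW.
    have tq0 : 0 <= t ^+ q by rewrite exprn_ge0 // ltW.
    have tp1 : t ^+ p <= 1 by rewrite exprn_ile1 // ltW.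
    have tqp : t ^+ q <= t ^+ p by rewrite ler_wiXn2l ?(ltW t0) // ltnW.
    have ntp : `|t ^+ p| <= 1 by rewrite ger0_norm.
    have nx : `|x| <= t ^+ p by rewrite ger0_norm // (le_trans xt).
    set z := a + vec2 x (t ^+ p) *m N.
    have za : `|z - a| <= K1 * t ^+ p.
      by rewrite /z addrC addKr; apply: hK1 => //; rewrite ger0_norm.
    have lt_d : `|z - a| < Num.min d d1.
      apply: (le_lt_trans za); move: td; rewrite ltr_pdivlMr; last by lra.
      apply: le_lt_trans; rewrite mulrC; apply: ler_pM => //; last
        by rewrite lerDl.
      by rewrite -[leRHS]expr1 ler_wiXn2l ?(ltW t0).
    move: lt_d; rewrite lt_min => /andP[zd zd1].
    have Cz : planar a N D z by exists (vec2 x (t ^+ p)).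
    have fz : f z = G z by rewrite eG //; split=> //; apply: hU.
    have h1 : `|bev x (t ^+ p) H| <= BQ * (`|K| * K1 ^+ q) * t ^+ (p * q).
      rewrite hH -/z -hf -mulrBr normrM -mulrA ler_pM //.
        by rewrite -hQW hBQ // (le_trans nx).
      rewrite fz (le_trans (hT z zd)) // (le_trans (ler_wpM2r _ (ler_norm K)))
        ?exprn_ge0 //.
      rewrite -mulrA ler_wpM2l // exprM -exprMn lerXn2r ?nnegrE // mulr_ge0 //.
    rewrite -[bev _ _ H](subrK (bev x (t ^+ p) H)) mulrDl addrC.
    rewrite (le_trans (ler_normD _ _)) // lerD //.
    have : `|t ^+ q - x| <= 2 * t ^+ (p * q) by rewrite distrC.
    move/(ler_wpM2l L0); rewrite mulrA; apply: le_trans; apply: hL => //.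
      by rewrite ger0_norm // (le_trans tqp).
    exact: le_trans nx tp1.
  by move=> k l k' l'; exact: weight_unique.
have [K2 K20 hK2] : exists2 K2, 0 <= K2 & forall s y r, `|s| <= r ->
  `|y| <= r ->
    r <= 1 -> `|bev s y H| <= K2 * r ^+ p.
  by apply: bev_high_order => i j ij; apply: low; nia.
have [K3 K30 hK3] := row_mul_norm M.
exists (K2 * (K3 + 1) ^+ p), (K3 + 1)^-1; split.
  by rewrite invr_gt0 ltr_wpDl.
move=> _ [v _ <-] /ltW; rewrite addrC addKr => vd.
have ev : v = (v *m N) *m M by rewrite -mulmxA NM mulmx1.
have r1 : (K3 + 1) * `|v *m N| <= 1.
  by rewrite mulrC -ler_pdivlMr ?ltr_wpDl // div1r.
have vj j : `|v 0 j| <= (K3 + 1) * `|v *m N|.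
  by rewrite {1}ev (le_trans (hK3 _ _)) // ler_wpM2r // lerDl.
have := hK2 _ _ _ (vj 0) (vj 1) r1; rewrite hH -vec2_eta exprMn mulrA.
by [].
Qed.
End Arcs.

Section Charts.
Variables (R : realType) (n : nat).
Implicit Types (a : 'rV[R]_n) (Q : set 'rV[R]_n).

(** The chart is affine with linear part [M] on [Q]; its bijectivity makes
    [B *m M] invertible for every basis [B] of the direction of [Q]. *)
Lemma plane_chart Q h a : affine_plane Q -> affine_iso_on Q h -> Q a ->
  exists (N : 'M[R]_(2, n)) M, [/\ N *m M = 1%:M, Q = planar a N setT &
    forall v, h (a + v *m N) = h a + v].
Proof.
move=> [x0 [B [rB eQ]]] [[M [b hM]] [hfun hinj hsurj]] Qa.
have Qt t : Q (x0 + t *m B) by rewrite eQ; exists t.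
have [t0 _ ea] : [set x0 + t *m B | t in setT] a by rewrite -eQ.
have uBM : B *m M \in unitmx.
  rewrite -row_free_unit; apply: inj_row_free => t tBM.
  have : x0 + t *m B = x0 + 0 *m B.
    apply: hinj; rewrite ?inE //.
    by rewrite !hM // !mulmxDl -!mulmxA tBM mul0mx.
  by rewrite mul0mx => /addrI tB0; apply: (row_free_inj rB); rewrite tB0 mul0mx.
exists (invmx (B *m M) *m B), M.
have NM : (invmx (B *m M) *m B) *m M = 1%:M by rewrite -mulmxA mulVmx.
have hv v : a + v *m (invmx (B *m M) *m B) = x0 + (t0 + v *m invmx (B *m M)) *m
  B.
  by rewrite -ea mulmxDl addrA mulmxA.
split=> //.
  rewrite eQ; apply/seteqP; split=> x /=.
    move=> [t _ <-]; exists ((t - t0) *m (B *m M)) => //.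
    by rewrite hv -mulmxA mulmxV // mulmx1 [t0 + _]addrC subrK.
  by move=> [v _ <-]; rewrite hv; exists (t0 + v *m invmx (B *m M)).
move=> v; rewrite hM ?hv // -hv hM // mulmxDl -mulmxA NM mulmx1.
by rewrite addrAC.
Qed.

Definition E_poly p q : {poly {poly R}} := 'X^p - ('X^q)%:P.
Definition C_poly p q : {poly {poly R}} :=
  'X^p - ('X^q)%:P + 'X^(2 * q) + ('X^(2 * q))%:P.

Lemma bev_E_poly p q s y : bev s y (E_poly p q) = s ^+ p - y ^+ q.
Proof. by rewrite bevE hornerD hornerN hornerXn hornerC -polyC_exp !hornerE.
  Qed.

Lemma bev_C_poly p q s y :
  bev s y (C_poly p q) = s ^+ p - y ^+ q + s ^+ (2 * q) + y ^+ (2 * q).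
Proof.
by rewrite bevE !hornerD hornerN !hornerXn !hornerC -!polyC_exp !hornerE.
Qed.

Lemma E_curveE p q :
  E_curve p q = [set v : 'rV[R]_2 | bev (v 0 0) (v 0 1) (E_poly p q) = 0].
Proof. by apply/seteqP; split=> v; rewrite /E_curve /mkset bev_E_poly. Qed.

Lemma C_curveE p q :
  C_curve p q = [set v : 'rV[R]_2 | bev (v 0 0) (v 0 1) (C_poly p q) = 0].
Proof. by apply/seteqP; split=> v; rewrite /C_curve /mkset bev_C_poly. Qed.

Lemma E_poly_slice p q y : (0 < p)%N ->
  map_poly (horner_eval y) (E_poly p q) != 0.
Proof.
move=> p0; rewrite rmorphB /= map_polyXn map_polyC /=.
apply/eqP => /(congr1 (fun P : {poly R} => P`_p)).
rewrite coef0 coefB coefXn eqxx coefC (gtn_eqF p0) subr0 => /eqP.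
by rewrite oner_eq0.
Qed.

Lemma C_poly_slice p q y : (0 < p)%N -> (p < q)%N ->
  map_poly (horner_eval y) (C_poly p q) != 0.
Proof.
move=> p0 pq; rewrite !rmorphD rmorphN /= !map_polyXn !map_polyC /=.
apply/eqP => /(congr1 (fun P : {poly R} => P`_(2 * q))).
rewrite coef0 !coefD coefN !coefXn eqxx !coefC.
have -> : (2 * q == p)%N = false by lia.
have -> : (2 * q == 0)%N = false by lia.
by rewrite oppr0 !add0r addr0 => /eqP; rewrite oner_eq0.
Qed.

Lemma infinite_inj (T : Type) (A : set T) (g : nat -> T) :
  injective g -> (forall k, A (g k)) -> infinite_set A.
Proof.
move=> ig Ag fA; apply: infinite_nat.
have -> : [set: nat] = g @^-1` A by apply/seteqP; split=> k // _; exact: Ag.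
by apply: finite_preimage => // k l _ _; exact: ig.
Qed.

Lemma planar_inj a (N : 'M[R]_(2, n)) M : N *m M = 1%:M ->
  injective (fun v => a + v *m N).
Proof.
move=> NM v w /addrI e; have := congr1 (mulmx^~ M) e.
by rewrite /= -!mulmxA NM !mulmx1.
Qed.

Lemma arc_infinite a (N : 'M[R]_(2, n)) M D p q : N *m M = 1%:M -> (0 < p)%N ->
  cuspidal_arc p q D -> infinite_set (planar a N D).
Proof.
move=> NM p0 arc.
pose t k : R := 1 / (k.+3)%:R.
have t0 k : 0 < t k by rewrite divr_gt0.
have t12 k : t k < 1 / 2.
  by rewrite ltr_pM2l // ltf_pV2 ?posrE // ltr_nat.
have hx k : exists x, D (vec2 x (t k ^+ p)).
  by have [|x [_ _ Dx]] := arc (t k); [rewrite t0 t12 | exists x].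
have [x Dx] := choice hx.
apply: (@infinite_inj _ _ (fun k => a + vec2 (x k) (t k ^+ p) *m N));
  last first.
  by move=> k; exists (vec2 (x k) (t k ^+ p)).
move=> k l /(planar_inj NM) /(congr1 (fun v : 'rV[R]_2 => v 0 1)).
rewrite !vec2_1 => /eqP;
  rewrite eqrXn2 ?ltW // => /eqP/(mulfI (oner_neq0 _))/invr_inj.
by move/eqP; rewrite eqr_nat => /eqP[].
Qed.

Variables (phi : set 'rV[R]_n -> 'rV[R]_n -> 'rV[R]_2) (k : nat).
Hypothesis hphi : plane_charts phi.

Lemma planar_collection_mem (F : nat -> nat -> set 'rV[R]_2) Q a N M p q :
  affine_plane Q -> N *m M = 1%:M -> Q = planar a N setT ->
  (forall v, phi Q (a + v *m N) = phi Q a + v) ->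
  Lambda k (p, q) -> algebraic_curve (planar a N (F p q)) ->
  planar_collection phi k F (planar a N (F p q)).
Proof.
move=> aQ NM eQ hv L ac; split=> //; exists Q, p, q; split=> //.
  by rewrite eQ => x [v Fv <-]; exists v.
exists (phi Q a); apply/seteqP; split=> x /=.
  by move=> [_ [v Fv <-] <-]; exists v.
by move=> [v Fv <-]; exists (a + v *m N) => //; exists v.
Qed.

Lemma planar_collection_inv (F : nat -> nat -> set 'rV[R]_2) C :
  planar_collection phi k F C -> exists a N M p q, [/\ N *m M = 1%:M,
    Lambda k (p, q) & C = planar a N (F p q)].
Proof.
move=> [_ [Q [p [q [aQ CQ L [c ec]]]]]].
have iso := hphi.1 Q aQ; have [_ [_ hinj hsurj]] := iso.
have [a Qa ha] := hsurj c I.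
have [N [M [NM eQ hv]]] := plane_chart aQ iso Qa.
exists a, N, M, p, q; split=> //; apply/seteqP; split=> x.
  move=> Cx; have := CQ x Cx; rewrite eQ => -[v _ ev].
  have : (phi Q @` C) (phi Q x) by exists x.
  rewrite ec -ev hv ha => -[w Fw /addrI <-].
  by exists w.
move=> [v Fv <-].
have : [set c + v | v in F p q] (c + v) by exists v.
rewrite -ec => -[y Cy]; rewrite -ha -hv => /hinj; rewrite !inE => <- //.
  exact: CQ.
by rewrite eQ; exists v.
Qed.
End Charts.

(** * Lines, circles and rational curves *)
Section Collections.
Variables (R : realType) (m k : nat).
Notation n := m.+1.
Variable phi : set 'rV[R]_n -> 'rV[R]_n -> 'rV[R]_2.
Hypothesis hphi : plane_charts phi.

(** The pair [(p, q)] is chosen after [N]: large exponents test high orders. *)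
Lemma collection_quotient (F : nat -> nat -> set 'rV[R]_2)
    (W : nat -> nat -> {poly {poly R}}) f :
  (forall p q, F p q = [set v : 'rV[R]_2 | bev (v 0 0) (v 0 1) (W p q) = 0]) ->
  (forall p q y, (0 < p)%N -> (p < q)%N ->
    map_poly (horner_eval y) (W p q) != 0) ->
  (forall p q, (0 < p)%N -> (p < q)%N -> F p q 0) ->
  (forall p q, (0 < p)%N -> (p < q)%N -> cuspidal_arc p q (F p q)) ->
  (forall C, planar_collection phi k F C -> real_analytic_on C f) ->
  forall P Q a Pi N, (forall x, peval Q x * f x = peval P x) ->
    affine_plane Pi -> Pi a -> has_local_quotient P Q a Pi N.
Proof.
move=> FE slice F0 arc ana P Q a Pi N hf aPi Pia.
have [A [M [AM ePi hv]]] := plane_chart aPi (hphi.1 Pi aPi) Pia.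
have [p Np pp] := prime_above N.
have [q pq qp] := prime_above (p * k + p).
have p0 := prime_gt0 pp.
have lt_pq : (p < q)%N by lia.
have cpq : coprime p q by rewrite prime_coprime // dvdn_prime2 //; lia.
have anaC : real_analytic_on (planar a A (F p q)) f.
  apply/ana/(planar_collection_mem aPi AM ePi hv); first by split=> //=; lia.
  have := @arc_infinite _ _ a _ _ _ _ _ AM p0 (arc p q p0 lt_pq); rewrite FE.
  by apply: (planar_algebraic_curve AM) => // y; apply: slice.
have [T [K [d [d0 hT]]]] :=
    curve_quotient AM pp lt_pq cpq (F0 p q p0 lt_pq) (arc p q p0 lt_pq) anaC hf.
exists T, `|K|, (Num.min d 1); split; first by rewrite lt_min d0 ltr01.
move=> x Pix; rewrite lt_min => /andP[xd x1].
rewrite ePi in Pix; apply: (le_trans (hT x Pix xd)).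
apply: (le_trans (ler_wpM2r _ (ler_norm K))); first by rewrite exprn_ge0.
by rewrite ler_wpM2l // ler_wiXn2l ?(ltW x1) ?(ltnW Np).
Qed.
End Collections.

Section LinesAndCircles.
Variables (R : realType) (n : nat).
Hypothesis n2 : (1 < n)%N.
Implicit Types (L C : set 'rV[R]_n) (a b v x z : 'rV[R]_n).

Lemma line_planar L : axis_parallel_line L -> exists a (N : 'M[R]_(2, n)) M,
  N *m M = 1%:M /\ L = planar a N [set v | bev (v 0 0) (v 0 1) 'X = 0].
Proof.
move=> [a [i ->]].
have [j ji] : exists j : 'I_n, j != i.
  have lt0 : (0 < n)%N by exact: ltnW.
  have [e|ne] := eqVneq i (Ordinal lt0); last by exists (Ordinal lt0);
    rewrite eq_sym.
  by exists (Ordinal n2); rewrite e.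
pose N : 'M[R]_(2, n) := \matrix_(r, l) (l == if r == 0 then j else i)%:R.
exists a, N, N^T; split.
  apply/matrixP => r s; rewrite !mxE (bigD1 (if r == 0 then j else i)) //=.
  rewrite big1 ?addr0 => [|l /negPf hl]; last by rewrite !mxE hl mul0r.
  rewrite !mxE eqxx mul1r; congr (_%:R).
  have h1 (u : 'I_2) : u != 0 -> u = 1.
    by case: u => [[|[|//]]] hu // _; exact: val_inj.
  have [er|/h1 er] := eqVneq r 0; have [es|/h1 es] := eqVneq s 0;
    by rewrite ?er ?es ?eqxx //= ?(negPf ji) // eq_sym (negPf ji).
have row1 t : vec2 0 t *m N = t *: delta_mx 0 i.
  by apply/rowP => l; rewrite !mxE big_ord_recl big_ord1 !mxE /= mul0r add0r.
apply/seteqP; split=> x.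
  move=> [t _ <-]; exists (vec2 0 t); last by rewrite row1.
  by rewrite /mkset bevE hornerX hornerC vec2_0.
move=> [v hv <-]; exists (v 0 1) => //; rewrite -row1 [v in RHS]vec2_eta.
by move: hv; rewrite /mkset bevE hornerX hornerC => ->.
Qed.

Lemma line_algebraic_curve L : axis_parallel_line L -> algebraic_curve L.
Proof.
move=> /line_planar[a [N [M [NM ->]]]].
apply: (planar_algebraic_curve NM).
  by move=> y; rewrite map_polyX polyX_eq0.
apply: (@infinite_inj _ _ (fun k => a + vec2 0 k%:R *m N)) => [k l|k].
  move/(planar_inj NM)/(congr1 (fun v : 'rV[R]_2 => v 0 1)).
  by rewrite !vec2_1 => /eqP; rewrite eqr_nat => /eqP.
by exists (vec2 0 k%:R) => //; rewrite /mkset bevE hornerX hornerC vec2_0.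
Qed.

(** A proper algebraic subset of [C] gives a nonzero polynomial in the
    parameter, and the product of two of them is not zero. *)
Lemma parametrized_irreducible C a (N : 'M[R]_(2, n)) (al be : {poly R}) :
  algebraic_set C ->
  (forall x, C x <-> exists t, x = a + vec2 al.[t] be.[t] *m N) ->
  irreducible_algebraic C.
Proof.
move=> aC hC; split=> //.
  by exists (a + vec2 al.[0] be.[0] *m N); apply/hC; exists 0.
have pull g : polyfun g -> exists p : {poly R}, forall t,
    p.[t] = g (a + vec2 al.[t] be.[t] *m N).
  move=> /(plane_restrict a N)[W hW].
  have [p hp] : exists p : {poly R}, forall t, p.[t] = bev al.[t] be.[t] W.
    elim/poly_ind: W {hW} => [|W c [p hp]].
      by exists 0 => t; rewrite horner0 rmorph0.
    exists (p * al + (c \Po be)) => t.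
    by rewrite bevE hornerMXaddC !hornerD !hornerM hornerC -bevE -hp
      horner_comp.
  by exists p => t; rewrite hp hW.
move=> V1 V2 a1 a2 e; apply: contrapT => /not_orP[n1 n2'].
have sep V : algebraic_set V -> V `<=` C -> C <> V -> exists p : {poly R},
    p != 0 /\ forall t, V (a + vec2 al.[t] be.[t] *m N) -> p.[t] = 0.
  move=> aV VC nV; have [|g [pg gV [x Cx gx]]] := algebraic_separation aV (Z :=
    C).
    by move=> CV; apply: nV; apply/seteqP.
  have [p hp] := pull g pg; exists p; split.
    have [t ex] := (hC x).1 Cx.
    by apply: contraNneq gx => p0; rewrite ex -hp p0 horner0.
  by move=> t Vt; rewrite hp gV.
have [|p1 [p10 h1]] := sep V1 a1 _ n1; first by rewrite e => x; left.
have [|p2 [p20 h2]] := sep V2 a2 _ n2'; first by rewrite e => x; right.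
have /eqP : p1 * p2 = 0.
  apply: (@poly_eq_on R setT) => [|t _].
    by apply: uncountable_infinite; apply: interval_uncountable.
  have : C (a + vec2 al.[t] be.[t] *m N) by apply/hC; exists t.
  rewrite hornerM horner0 e => -[/h1->|/h2->]; rewrite ?mul0r ?mulr0 //.
by rewrite mulf_eq0 (negPf p10) (negPf p20).
Qed.

Lemma line_irreducible L : axis_parallel_line L -> irreducible_curve L.
Proof.
move=> aL; split; first exact: line_algebraic_curve.
have [[aL' _] [a [N [M [NM eL]]]]] := (line_algebraic_curve aL, line_planar aL).
apply: (@parametrized_irreducible _ a N 0 'X) => // x; rewrite eL; split.
  move=> [v hv <-]; exists (v 0 1); rewrite horner0 hornerX {1}[v]vec2_eta.
  by move: hv; rewrite /mkset bevE hornerX hornerC => ->.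
move=> [t ->]; exists (vec2 0 t); rewrite ?horner0 ?hornerX //.
by rewrite /mkset bevE hornerX hornerC vec2_0.
Qed.

(** Bezout coefficients for the coprime exponents give the parameter. *)
Lemma E_curve_parametrized p q (s y : R) : (0 < p)%N -> (0 < q)%N ->
  coprime p q ->
  s ^+ p = y ^+ q -> exists t, s = t ^+ q /\ y = t ^+ p.
Proof.
move=> p0 q0 cpq e.
have [y0|y0] := eqVneq y 0.
  exists 0; rewrite !expr0n !gtn_eqF // y0; split=> //.
  by move: e; rewrite y0 expr0n gtn_eqF // => /eqP;
    rewrite expf_eq0 => /andP[_ /eqP].
have s0 : s != 0.
  apply: contraNneq y0 => s0; move: e;
    rewrite s0 expr0n gtn_eqF // => /esym/eqP.
  by rewrite expf_eq0 => /andP[].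
have [u v euv _] := egcdnP p q0; rewrite gcdnC (eqP cpq) in euv.
have sp : s ^+ (v * p) != 0 by rewrite expf_neq0.
have yp : y ^+ (v * p) != 0 by rewrite expf_neq0.
exists (s ^+ u / y ^+ v); rewrite !expr_div_n -!exprM; split.
  rewrite euv exprD expr1.
  have -> : y ^+ (v * q) = s ^+ (v * p) by rewrite mulnC exprM -e -exprM mulnC.
  by rewrite mulrAC divff ?mul1r.
have -> : s ^+ (u * p) = y ^+ (u * q) by rewrite mulnC exprM e -exprM mulnC.
by rewrite euv exprD expr1 mulrAC divff ?mul1r.
Qed.

Lemma H_irreducible (phi : set 'rV[R]_n -> 'rV[R]_n -> 'rV[R]_2) k C :
  plane_charts phi -> (0 < k)%N -> H_collection phi k C -> irreducible_curve C.
Proof.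
move=> hphi k0 HC; have aC := HC.1; split=> //.
have [a [N [M [p [q [NM [/= pp pq lt] eC]]]]]] := planar_collection_inv hphi HC.
have [p0 q0] := (prime_gt0 pp, prime_gt0 pq).
have cpq : coprime p q by rewrite prime_coprime // dvdn_prime2 //; nia.
apply: (@parametrized_irreducible _ a N ('X^q) ('X^p)); first exact: aC.1.
move=> x; rewrite eC; split.
  move=> [v /eqP]; rewrite subr_eq0 => /eqP /(E_curve_parametrized p0 q0 cpq).
  by move=> [t [es ey]] <-; exists t; rewrite !hornerXn -es -ey -vec2_eta.
move=> [t ->]; exists (vec2 (t ^+ q) (t ^+ p)); rewrite ?hornerXn //.
by rewrite /E_curve /mkset vec2_0 vec2_1 -!exprM mulnC subrr.
Qed.
End LinesAndCircles.

(** * Rationality from the restrictions to lines and circles *)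
Section OneVariable.
Variables (R : realType) (D : set R).
Hypothesis infD : infinite_set D.

(** A fraction with a denominator of minimal degree has no pole on [D]. *)
Lemma locally_rational (h : R -> R) :
  (forall t0, D t0 -> exists p q : {poly R}, q.[t0] != 0 /\
     forall t, D t -> q.[t] != 0 -> q.[t] * h t = p.[t]) ->
  exists p q : {poly R}, forall t, D t -> q.[t] != 0 /\ q.[t] * h t = p.[t].
Proof.
move=> loc.
pose I (pq : {poly R} * {poly R}) := pq.2 != 0 /\
  forall t, D t -> pq.2.[t] != 0 -> pq.2.[t] * h t = pq.1.[t].
have [x0 Dx0] := infinite_setN0 infD; have [p0 [q0 [q00 h0]]] := loc x0 Dx0.
have I0 : I (p0, q0).
  by split=> //; apply: contraNneq q00 => /= ->; rewrite horner0.
have cross pq pq' : I pq -> I pq' -> pq.1 * pq'.2 = pq'.1 * pq.2.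
  move=> [n1 h1] [n2 h2].
  have iD : infinite_set (D `\` [set t | (pq.2 * pq'.2).[t] = 0]).
    by apply: infinite_setD => //; apply: roots_finite; rewrite mulf_neq0.
  apply: (poly_eq_on iD) => t [Dt /eqP]; rewrite hornerM mulf_eq0 negb_or.
  by move=> /andP[t1 t2]; rewrite !hornerM -h1 // -h2 //; ring.
have [[p q] [[/= qn0 hq] minq]] :=
  @exists_minimal _ I (fun pq => size pq.2) _ I0.
exists p, q => t Dt; have [qt|qt] := eqVneq q.[t] 0; last by split=> //; exact:
  hq.
exfalso; have [p' [q' [q't h']]] := loc t Dt.
have I' : I (p', q').
  by split=> //; apply: contraNneq q't => /= ->; rewrite horner0.
have e := cross (p, q) (p', q') (conj qn0 hq) I'; rewrite /= in e.
have pt : p.[t] = 0.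
  have := congr1 (fun u : {poly R} => u.[t]) e;
    rewrite /= !hornerM qt mulr0 => /eqP.
  by rewrite mulf_eq0 (negPf q't) orbF => /eqP.
have /factor_theorem[p1 ep] : root p t by apply/rootP.
have /factor_theorem[q1 eq] : root q t by apply/rootP.
have X0 : 'X - t%:P != 0 :> {poly R} by rewrite polyXsubC_eq0.
have q10 : q1 != 0 by apply: contraNneq qn0 => q10; rewrite eq q10 mul0r.
have e1 : p1 * q' = p' * q1.
  by apply: (mulIf X0); move: e; rewrite ep eq mulrAC mulrA.
have : I (p1, q1).
  split=> // t1 Dt1 /= q1t1; have [et|nt] := eqVneq t1 t.
    rewrite et; apply: (mulfI q't).
    have := congr1 (fun u : {poly R} => u.[t]) e1;
      rewrite /= !hornerM [p1.[t] * _]mulrC => ->.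
    by rewrite -h' // ; ring.
  have Xt : ('X - t%:P).[t1] != 0 by rewrite hornerXsubC subr_eq0.
  apply: (mulIf Xt); rewrite -[RHS]hornerM -ep -hq //; rewrite eq hornerM;
    first by ring.
  by rewrite mulf_neq0.
by move=> /minq /=; rewrite eq size_Mmonic ?monicXsubC // size_XsubC addn2 /=
  ltnn.
Qed.

Lemma mpoly_along n (num : nat -> {poly R}) (w : {poly R}) (S : mpoly n R) :
  exists N (b : {poly R}), forall t, w.[t] != 0 ->
    b.[t] = w.[t] ^+ N * peval S (row_of n (fun i => (num i).[t] / w.[t])).
Proof.
have [N [b hb]] := ieval_fraction polyC num w (mpoly_ipoly S).
exists N, b => t wt; rewrite -[LHS]/(horner_eval t b) hb.
- by rewrite ieval_mpoly.
- by move=> c; rewrite /= /horner_eval hornerC.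
by [].
Qed.

(** The local fractions that represent [f] pull back to fractions in the
    parameter. *)
Lemma regular_along n (C : set 'rV[R]_n) f (num : nat -> {poly R}) (w :
  {poly R}) :
  regular_on C f ->
  (forall t, D t -> w.[t] != 0 /\ C (row_of n (fun i => (num i).[t] / w.[t])))
    ->
  exists p q : {poly R}, forall t, D t -> q.[t] != 0 /\
    q.[t] * f (row_of n (fun i => (num i).[t] / w.[t])) = p.[t].
Proof.
move=> reg hC.
pose x t := row_of n (fun i => (num i).[t] / w.[t]).
apply: (@locally_rational (fun t => f (x t))) => t0 Dt0.
have [w0 Ct0] := hC t0 Dt0; have [P [Q [Q0 hf]]] := reg _ Ct0.
have frac (S : mpoly n R) := mpoly_along num w S.
have [N [bP hP]] := frac P; have [N' [bQ hQ]] := frac Q.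
exists (w ^+ N' * bP), (w ^+ N * bQ); split.
  by rewrite hornerM horner_exp hQ // !mulf_neq0 ?expf_neq0.
move=> t Dt; have [wt Ct] := hC t Dt.
rewrite !hornerM !horner_exp hQ // hP // => h.
have Qt : peval Q (x t) != 0 by apply: contraNneq h => ->; rewrite !mulr0.
by rewrite hf //; field.
Qed.
End OneVariable.

Section FromLines.
Variables (R : realType) (n : nat) (f : 'rV[R]_n -> R).
Hypothesis reg : forall L, axis_parallel_line L -> regular_on L f.

Let uT : ~ countable [set: R]. Proof. exact: interval_uncountable. Qed.

Lemma lines_separately_rational :
  separately_rational setT n (fun e => f (row_of n e)).
Proof.
move=> e i hi _; pose i' := Ordinal hi.
pose L := [set row_of n e + t *: delta_mx 0 i' | t in [set: R]].
have aL : axis_parallel_line L by exists (row_of n e), i'.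
pose num j : {poly R} := if j == i then 'X else (e j)%:P.
have eu t : row_of n (fun j => (num j).[t] / (1 :
  {poly R}).[t]) = row_of n (upd e i t).
  apply/rowP => j; rewrite !mxE hornerC divr1 /num /upd.
  by case: eqP => _; rewrite ?hornerX ?hornerC.
have [||t _|p [q h]] := @regular_along R setT _ n L f num 1.
- exact: uncountable_infinite.
- exact: reg.
- rewrite eu hornerC oner_neq0; split=> //; exists (t - e i) => //.
  apply/rowP => j; rewrite !mxE eqxx /= /upd -val_eqE /=.
  by case: eqP => [->|_]; rewrite ?mulr1 ?mulr0 ?addr0 // addrC subrK.
by exists p, q => t Dt; have := h t Dt; rewrite eu.
Qed.

Lemma row_of_depends (g : 'rV[R]_n -> R) :
  depends_below n (fun e => g (row_of n e)).
Proof. by move=> e e' h; congr g; apply/rowP => i; rewrite !mxE h. Qed.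

Lemma rational_of_lines : exists P Q : mpoly n R,
  (exists x, peval Q x != 0) /\ forall x, peval Q x * f x = peval P x.
Proof.
have [Q [P [Q0 h]]] := separately_rational_is_rational uT
  lines_separately_rational
  (row_of_depends f).
exists (ipoly_mpoly P), (ipoly_mpoly Q); split.
  have [e he] := ieval_neq0 Q0; exists (row_of n e); rewrite peval_ipoly.
  by rewrite (eq_ieval (e' := e)) // => i hi; rewrite coords_row.
by move=> x; rewrite !peval_ipoly -{2}[x]coordsK; apply: h.
Qed.

Lemma identities_spread_lines : identities_spread f.
Proof.
move=> W P Q [x0 W0] h x.
have := @identity_spreads R setT uT n (fun e => f (row_of n e)) (mpoly_ipoly W)
  (mpoly_ipoly Q) (mpoly_ipoly P) lines_separately_rational (row_of_depends f).
move=> /(_ _ _ (coords x)); rewrite !ieval_mpoly coordsK; apply => //.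
  apply: contraNneq W0 => e; rewrite -[x0]coordsK -ieval_mpoly e rmorph0 //.
by move=> e _; rewrite !ieval_mpoly; exact: h.
Qed.
End FromLines.

Section Circles.
Variables (R : realType) (n : nat).
Implicit Types (b v z x : 'rV[R]_n).

Definition dot b v := \sum_i b 0 i * v 0 i.
Definition sq b := \sum_i b 0 i ^+ 2.

Lemma sq_combination b v (s y : R) :
  sq (s *: b + y *: v) = s ^+ 2 * sq b + 2 * s * y * dot b v + y ^+ 2 * sq v.
Proof.
rewrite /sq /dot !mulr_sumr -!big_split /=; apply: eq_bigr => i _.
by rewrite !mxE; ring.
Qed.

Lemma sqZ (s : R) b : sq (s *: b) = s ^+ 2 * sq b.
Proof. by rewrite /sq mulr_sumr; apply: eq_bigr => i _; rewrite mxE exprMn. Qed.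

Lemma sq_gt0 b : b != 0 -> 0 < sq b.
Proof.
move=> b0; rewrite lt_neqAle sumr_ge0 ?andbT => [|i _]; last exact: sqr_ge0.
by apply: contraNneq b0 => /esym/sum_sqr_eq0 ->.
Qed.

Lemma vec2_rows b v s y :
  vec2 s y *m (\matrix_(i, j) (if i == 0 then b else v) 0 j) = s *: b + y *:
    v :> 'rV_n.
Proof.
by apply/rowP => j; rewrite !mxE big_ord_recl big_ord1 !mxE.
Qed.

(** The circle is the image of the line [b + t *: v] under the inversion, moved
    to pass through [z]. *)
Lemma circle_through z b v : dot b v = 0 -> b != 0 -> v != 0 ->
  exists2 C, euclidean_circle C & forall al be : R,
    al ^+ 2 * sq b + be ^+ 2 * sq v = al -> C (z + al *: b + be *: v).
Proof.
move=> bv b0 v0; have B0 := sq_gt0 b0; have V0 := sq_gt0 v0.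
pose B : 'M[R]_(2, n) := \matrix_(i, j) (if i == 0 then b else v) 0 j.
pose c := z + (2 * sq b)^-1 *: b.
pose r := Num.sqrt (1 / (4 * sq b)).
pose Q := [set z + t *m B | t in [set: 'rV[R]_2]].
exists ([set x | euclidean_norm (x - c) = r] `&` Q).
  exists Q, c, r; split=> //; last by rewrite sqrtr_gt0 divr_gt0 ?mulr_gt0.
    exists z, B; split=> //; apply: inj_row_free => t;
      rewrite [t]vec2_eta vec2_rows.
    move=> /(congr1 sq); rewrite sq_combination bv mulr0 addr0.
    have -> : sq (0 : 'rV[R]_n) = 0 by rewrite /sq big1 // => i _;
      rewrite mxE expr0n.
    have h1 := mulr_ge0 (sqr_ge0 (t 0 0)) (ltW B0).
    have h2 := mulr_ge0 (sqr_ge0 (t 0 1)) (ltW V0).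
    move/eqP; rewrite paddr_eq0 // [_ * sq b == 0]mulf_eq0 [_ * sq v ==
      0]mulf_eq0 !sqrf_eq0.
    rewrite (gt_eqF B0) (gt_eqF V0) !orbF => /andP[/eqP-> /eqP->].
    by apply/rowP => j; rewrite !mxE; case: ifP.
  by exists (vec2 (2 * sq b)^-1 0) => //; rewrite vec2_rows scale0r addr0.
move=> al be h; split; last first.
  by exists (vec2 al be) => //; rewrite vec2_rows addrA.
rewrite /euclidean_norm /r /=; congr Num.sqrt.
rewrite -/(sq _) (_ : _ - c = (al - (2 * sq b)^-1) *: b + be *: v); last first.
  have id (z1 b1 v1 w : R) : z1 + al * b1 + be * v1 - (z1 + w * b1) =
      (al - w) * b1 + be * v1 by ring.
  by apply/rowP => i; rewrite /c !mxE id.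
rewrite sq_combination bv mulr0 addr0.
have -> : be ^+ 2 * sq v = al - al ^+ 2 * sq b.
  by rewrite -[X in _ = X - _]h addrAC subrr add0r.
by field; rewrite gt_eqF.
Qed.
End Circles.

Lemma positive_near (R : realType) k (p : nat -> {poly R}) :
  (forall i, (i < k)%N -> 0 < (p i).[1]) ->
  exists2 d, 0 < d & forall s, 1 <= s < 1 + d -> forall i, (i < k)%N ->
    0 < (p i).[s].
Proof.
elim: k => [|k IH] h; first by exists 1.
have [|d d0 hd] := IH; first by move=> i ik; apply: h; lia.
have [q [c eq]] : exists q c, p k \Po ('X + 1) = q * 'X + c%:P.
  by elim/poly_ind: (p k \Po _) => [|q' c _]; [exists 0, 0;
    rewrite mul0r add0r | exists q', c].
have ev x : (p k).[x + 1] = q.[x] * x + c.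
  have := congr1 (fun u : {poly R} => u.[x]) eq.
  by rewrite /= horner_comp !hornerE.
have c0 : 0 < c by have := h k (ltnSn k); rewrite -[1]add0r ev mulr0 add0r.
have [B B0 hB] := poly_bounded q.
exists (Num.min d (Num.min 1 (c / (B + 1)))).
  by rewrite !lt_min d0 ltr01 divr_gt0 // ltr_wpDl.
move=> s /andP[s1]; rewrite -ltrBlDl !lt_min => /and3P[sd s2 sB] i.
rewrite ltnS leq_eqVlt => /orP[/eqP->|ik]; last first.
  by apply: hd => //; rewrite s1 /=; lra.
rewrite -[s](subrK 1) ev; set x := s - 1 in s2 sB *.
have x0 : 0 <= x by rewrite subr_ge0.
have x1 : `|x| <= 1 by rewrite ger0_norm // ltW.
have := hB x x1; rewrite ler_norml => /andP[hq _].
have sB' : x * (B + 1) < c by rewrite -ltr_pdivlMr // ltr_wpDl.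
have := ler_wpM2r x0 hq; lra.
Qed.

Section FromCircles.
Variables (R : realType) (n : nat) (f : 'rV[R]_n -> R).
Hypothesis n2 : (1 < n)%N.
Hypothesis reg : forall C, euclidean_circle C -> regular_on C f.

Let D : set R := [set t | 0 < t].
Let uD : ~ countable D.
Proof.
apply: interval_uncountable => t /=; rewrite in_itv /= => /andP[t1 _].
by rewrite /D /=; lra.
Qed.

Definition inversion (e : nat -> R) := fun i => e i / sq (row_of n e).

Lemma sq_row_gt0 e : box D n e -> 0 < sq (row_of n e).
Proof.
move=> De; apply: sq_gt0; apply/eqP => /rowP /(_ (Ordinal n2)).
rewrite !mxE => e0; have := De 1%N n2; rewrite /D /=.
by rewrite e0 ltxx.
Qed.

Lemma inversion_box e : box D n e -> box D n (inversion e).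
Proof.
move=> De i hi; rewrite /D /= divr_gt0 //; first exact: De.
exact: sq_row_gt0.
Qed.

Lemma inversionK e : box D n e -> inversion (inversion e) = e.
Proof.
move=> De; have s0 := sq_row_gt0 De; apply/funext => i.
have -> : inversion (inversion e) i = inversion e i / sq (row_of n (inversion
  e)) by [].
have -> : sq (row_of n (inversion e)) = (sq (row_of n e))^-1.
  have -> : row_of n (inversion e) = (sq (row_of n e))^-1 *: row_of n e.
    by apply/rowP => j; rewrite !mxE mulrC.
  rewrite sqZ.
  by field; rewrite gt_eqF.
by rewrite /inversion invrK divfK // gt_eqF.
Qed.

(** The inversion maps a line that avoids the origin into a circle; the
    axis-parallel lines through the open orthant avoid the origin. *)
Lemma circles_separately_rational :
  separately_rational D n (fun e => f (row_of n (inversion e))).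
Proof.
move=> e i hi De; pose i' := Ordinal hi.
pose b := row_of n (upd e i 0); pose v : 'rV[R]_n := delta_mx 0 i'.
have sqv : sq v = 1.
  rewrite /sq (bigD1 i') //= big1 ?addr0 => [|j /negPf ji];
    rewrite mxE ?eqxx ?expr1n //.
  by rewrite ji andbF expr0n.
have bv : dot b v = 0.
  rewrite /dot big1 // => j _; rewrite !mxE eqxx /= /upd -val_eqE /=.
  by case: eqP => _; rewrite ?mul0r ?mulr0.
have v0 : v != 0.
  apply/eqP => v0; move/eqP: sqv; rewrite v0 /sq big1 => [|j _].
    by rewrite eq_sym oner_eq0.
  by rewrite mxE expr0n.
have b0 : b != 0.
  have [j [hj ji]] : exists j, (j < n)%N /\ j != i.
    have [->|i0] := eqVneq i 0%N; first by exists 1%N.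
    by exists 0%N; rewrite eq_sym i0 (ltnW n2).
  apply/eqP => /rowP /(_ (Ordinal hj)); rewrite !mxE /upd (negPf ji) => e0.
  by have := De j hj; rewrite /D /= e0 ltxx.
have [C aC hC] := circle_through 0 bv b0 v0.
pose num j : {poly R} := if j == i then 'X else (e j)%:P.
pose w : {poly R} := (sq b)%:P + 'X^2.
have wE t : w.[t] = sq b + t ^+ 2 by rewrite /w hornerD hornerC hornerXn.
have w0 t : 0 < w.[t] by rewrite wE ltr_pwDl ?sqr_ge0 ?sq_gt0.
have eu t : row_of n (upd e i t) = 1 *: b + t *: v.
  apply/rowP => j; rewrite !mxE eqxx /= /upd -val_eqE /=.
  by case: eqP => _ /=; rewrite ?mulr0 ?mulr1 ?mul1r ?add0r ?addr0.
have sqE t : sq (row_of n (upd e i t)) = w.[t].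
  by rewrite eu sq_combination bv sqv wE; ring.
have ei t : row_of n (fun j => (num j).[t] / w.[t]) = row_of n (inversion (upd
  e i t)).
  apply/rowP => j; rewrite !mxE /inversion sqE /num /upd.
  by case: eqP => _; rewrite ?hornerX ?hornerC.
have [|||p [q h]] := @regular_along R D _ n C f num w.
- exact: uncountable_infinite.
- exact: reg.
- move=> t Dt; rewrite gt_eqF // ei; split=> //.
  have -> : row_of n (inversion (upd e i t)) = 0 + (w.[t])^-1 *:
    b + (t / w.[t]) *: v.
    have -> : row_of n (inversion (upd e i t)) = (w.[t])^-1 *:
      row_of n (upd e i t).
      by apply/rowP => j; rewrite !mxE /inversion sqE mulrC.
    by rewrite eu scale1r scalerDr scalerA add0r [_ / _]mulrC.
  by apply: hC; rewrite sqv wE; field; rewrite -wE gt_eqF.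
by exists p, q => t Dt; have := h t Dt; rewrite ei.
Qed.

Lemma rational_on_orthant : exists P Q :
  mpoly n R, (exists x, peval Q x != 0) /\
  forall e, box D n e -> peval Q (row_of n e) * f (row_of n e) = peval P
    (row_of n e).
Proof.
have dep : depends_below n (fun e => f (row_of n (inversion e))).
  move=> e e' h; congr f; have er : row_of n e = row_of n e'.
    by apply/rowP => j; rewrite !mxE h.
  by apply/rowP => j; rewrite !mxE /inversion er h.
have [Q [P [Q0 hQP]]] :=
  separately_rational_is_rational uD circles_separately_rational dep.
pose w : ipoly R n := \sum_(i < n) ivar R n i ^+ 2.
have wE e : ieval e n w = sq (row_of n e).
  rewrite rmorph_sum; apply: eq_bigr => i _.
  by rewrite rmorphXn ieval_ivar // mxE.
have inv_poly (S : ipoly R n) : exists N S', forall e, box D n e ->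
    ieval e n S' = sq (row_of n e) ^+ N * ieval (inversion e) n S.
  have [N [S' hS']] := ieval_fraction (iconst R n) (ivar R n) w S.
  exists N, S' => e De; rewrite (hS' (ieval e n)).
  - rewrite wE; congr (_ * _); apply: eq_ieval => i hi.
    by rewrite ieval_ivar.
  - exact: ieval_iconst.
  by rewrite wE gt_eqF // sq_row_gt0.
have [N [Q1 hQ1]] := inv_poly Q; have [N' [P1 hP1]] := inv_poly P.
have ev S e : peval (ipoly_mpoly S) (row_of n e) = ieval e n S.
  by rewrite peval_ipoly; apply: eq_ieval => i hi; rewrite coords_row.
exists (ipoly_mpoly (P1 * w ^+ N)), (ipoly_mpoly (Q1 * w ^+ N')); split.
  have [e [De Qe]] := @avoid_zeros R D n (fun=> Q) uD (fun=> Q0).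
  have bD : box D n e by move=> i _; exact: De.
  exists (row_of n (inversion e)); rewrite ev rmorphM rmorphXn wE hQ1;
    last exact: inversion_box.
  have s0 := sq_row_gt0 (inversion_box bD).
  by rewrite inversionK // !mulf_neq0 ?expf_neq0 ?(Qe 0%N) // gt_eqF.
move=> e De; rewrite !ev !rmorphM !rmorphXn wE hQ1 // hP1 //.
rewrite -hQP; last exact: inversion_box.
by rewrite inversionK //; ring.
Qed.

(** Every point lies on a circle that meets the orthant at a prescribed generic
    point. *)
Lemma orthant_spreads (W P Q : mpoly n R) : (exists x, peval W x != 0) ->
  (forall e, box D n e -> peval W (row_of n e) != 0 ->
     peval Q (row_of n e) * f (row_of n e) = peval P (row_of n e)) ->
  forall z, peval Q z * f z = peval P z.
Proof.
move=> [x0 Wx0] h z.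
pose i0 := Ordinal (ltnW n2); pose i1 := Ordinal n2.
have [u [uD' Wu u0 u1]] : exists u :
  'rV[R]_n, [/\ forall i, 0 < u 0 i, peval W u != 0,
    u 0 i0 - z 0 i0 != 0 & u 0 i1 - z 0 i1 != 0].
  pose lin i : ipoly R n := ivar R n i - iconst R n (coords z i).
  have linE e i : (i < n)%N -> ieval e n (lin i) = e i - coords z i.
    by move=> hi; rewrite rmorphB ieval_ivar // ieval_iconst.
  have lin0 i : (i < n)%N -> lin i != 0.
    move=> hi; apply: contraTneq isT => e.
    have := linE (fun=> coords z i + 1) i hi; rewrite e rmorph0 => /esym/eqP.
    by rewrite addrAC subrr add0r oner_eq0.
  have c0 : mpoly_ipoly W * lin 0%N * lin 1%N != 0.
    rewrite !mulf_neq0 ?lin0 // ?(ltnW n2) //.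
    by apply: contraNneq Wx0 => e; rewrite -[x0]coordsK -ieval_mpoly e rmorph0.
  have [e [De he]] := avoid_zeros uD (fun=> c0).
  move: (he 0%N); rewrite !rmorphM !mulf_eq0 !negb_or ieval_mpoly.
  rewrite !linE // ?(ltnW n2) // => /andP[/andP[h1 h2] h3].
  exists (row_of n e); split=> //; first by move=> i; rewrite mxE; exact: De.
    by rewrite mxE -(coordsE z i0).
  by rewrite mxE -(coordsE z i1).
pose d := u - z; pose mu := (sq d)^-1.
have d0 : d != 0 by apply: contraNneq u0 => /rowP /(_ i0); rewrite !mxE => ->.
have sd := sq_gt0 d0.
have mu0 : mu != 0 by rewrite invr_neq0 // gt_eqF.
pose b : 'rV[R]_n := \row_i (if i == i0 then mu * d 0 i else 0).
pose v : 'rV[R]_n := \row_i (if i == i0 then 0 else mu * d 0 i).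
have ebv : b + v = mu *: d.
  by apply/rowP => i; rewrite !mxE; case: eqP; rewrite ?addr0 ?add0r.
have bv : dot b v = 0.
  by rewrite /dot big1 // => i _; rewrite !mxE; case: eqP;
    rewrite ?mul0r ?mulr0.
have b0 : b != 0.
  apply: contraNneq u0 => /rowP /(_ i0); rewrite !mxE eqxx => /eqP.
  by rewrite mulf_eq0 (negPf mu0).
have v0 : v != 0.
  apply: contraNneq u1 => /rowP /(_ i1); rewrite !mxE => /eqP.
  by rewrite mulf_eq0 (negPf mu0).
have [C aC hC] := circle_through z bv b0 v0.
have B0 := sq_gt0 b0; have V0 := sq_gt0 v0.
have [w wE] : exists w : {poly R}, forall t, w.[t] = sq b * t ^+ 2 + sq v.
  exists (sq b *: 'X^2 + (sq v)%:P) => t.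
  by rewrite hornerD hornerZ hornerXn hornerC.
have w0 t : 0 < w.[t] by rewrite wE ltr_wpDl // mulr_ge0 ?sqr_ge0 // ltW.
pose num i : {poly R} := coords z i *: w + coords b i *: 'X^2 + coords v i *:
  'X.
pose x t := row_of n (fun i => (num i).[t] / w.[t]).
have xE t : x t = z + (t ^+ 2 / w.[t]) *: b + (t / w.[t]) *: v.
  apply/rowP => i; rewrite /x mxE /num !hornerD !hornerZ hornerXn hornerX
    !coordsE.
  have wt : w.[t] != 0 by rewrite gt_eqF.
  have id (a1 a2 a3 w1 : R) : w1 != 0 -> (a1 * w1 + a2 * t ^+ 2 + a3 * t) / w1 =
      a1 + t ^+ 2 / w1 * a2 + t / w1 * a3 by move=> hw; field.
  by rewrite id // !mxE.
have Cx t : C (x t).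
  rewrite xE; apply: hC; have wt : w.[t] != 0 by rewrite gt_eqF.
  transitivity (t ^+ 2 * (sq b * t ^+ 2 + sq v) / w.[t] ^+ 2); first by field.
  by rewrite -wE; field.
have [||t _|p [q hpq]] := @regular_along R setT _ n C f num w.
- by apply: uncountable_infinite; apply: interval_uncountable.
- exact: reg.
- by split; [rewrite gt_eqF | exact: Cx].
have xu : x 1 = u.
  have w1 : w.[1] = mu.
    have <- : sq (1 *: b + 1 *: v) = w.[1].
      by rewrite sq_combination bv wE; ring.
    by rewrite !scale1r ebv sqZ /mu expr2 -mulrA mulVf ?mulr1 // gt_eqF.
  rewrite xE w1 expr1n div1r -addrA -scalerDr ebv scalerA mulVf // scale1r.
  by rewrite /d addrC subrK.
have x0z : x 0 = z by rewrite xE expr0n /= !mul0r !scale0r !addr0.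
have wn0 t : w.[t] != 0 by rewrite gt_eqF.
have [NQ [Qh hQ]] := mpoly_along num w Q.
have [NP [Ph hP]] := mpoly_along num w P.
have [NW [Wh hW]] := mpoly_along num w W.
have [|dl dl0 pos] := @positive_near R n num.
  move=> i hi; have := uD' (Ordinal hi); rewrite -xu /x mxE /= => h1.
  by rewrite -(divfK (wn0 1) (num i).[1]) mulr_gt0.
have infA : infinite_set ([set t | 1 < t < 1 + dl] `\` [set t | Wh.[t] = 0]).
  apply: infinite_setD; last first.
    apply: roots_finite; apply: contraNneq Wu => Wh0; rewrite -xu.
    have := hW 1 (wn0 1); rewrite Wh0 horner0 => /esym/eqP.
    by rewrite mulf_eq0 expf_eq0 (negPf (wn0 1)) andbF.
  apply: (@infinite_inj _ _ (fun k : nat => 1 + dl / k.+2%:R)) => [k l|k] /=.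
    move=> /addrI /(mulfI (lt0r_neq0 dl0)) /invr_inj /eqP.
    by rewrite eqr_nat => /eqP[].
  by rewrite ltrDl divr_gt0 //= ltrD2l ltr_pdivrMr // ltr_pMr // ltr1n.
have /(congr1 (fun s : {poly R} => s.[0])) :
    (w ^+ NP * Qh) * p = (w ^+ NQ * Ph) * q.
  apply: (poly_eq_on infA) => t [/andP[t1 td] /eqP Wt].
  have [q0 hpq'] := hpq t I.
  have e : peval Q (x t) * f (x t) = peval P (x t).
    apply: h => [i hi|].
      by rewrite /D /= divr_gt0 //; apply: pos => //; rewrite ltW.
    by apply: contraNneq Wt => Wx; rewrite hW // Wx mulr0.
  by rewrite !hornerM !horner_exp hQ // hP // -/(x t) -e -hpq' -/(x t); ring.
have [q0 hpq0] := hpq 0 I.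
rewrite !hornerM !horner_exp hQ // hP // -hpq0 -/(x 0) x0z => e.
have wq : w.[0] ^+ NP * w.[0] ^+ NQ * q.[0] != 0
  by rewrite !mulf_neq0 ?expf_neq0.
apply: (mulfI wq).
transitivity (w.[0] ^+ NP * (w.[0] ^+ NQ * peval Q z) * (q.[0] * f z));
  first by ring.
by rewrite e; ring.
Qed.

Lemma identities_spread_circles : identities_spread f.
Proof. by move=> W P Q W0 h; apply: (orthant_spreads W0) => e _; apply: h. Qed.

Lemma rational_of_circles : exists P Q : mpoly n R,
  (exists x, peval Q x != 0) /\ forall x, peval Q x * f x = peval P x.
Proof.
have [P [Q [Q0 h]]] := rational_on_orthant; exists P, Q; split=> //.
apply: (@orthant_spreads (mpolyC n 1)) => [|e De _]; last exact: h.
by exists 0; rewrite /peval mevalC oner_neq0.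
Qed.
End FromCircles.

(** * The equivalences *)
Section CircleCurve.
Variables (R : realType) (n : nat).

Lemma circle_algebraic_curve (C : set 'rV[R]_n) :
  euclidean_circle C -> algebraic_curve C.
Proof.
move=> [Q [c [r [[x0 [B [rB eQ]]] Qc r0 ->]]]].
have [M BM] := row_freeP rB.
pose F : {poly {poly R}} :=
  \sum_j ((B 0 j)%:P *: 'X + (B 1 j *: 'X)%:P) ^+ 2 - (r ^+ 2)%:P%:P.
have bevF s y : bev s y F = sq (vec2 s y *m B) - r ^+ 2.
  rewrite /F rmorphB rmorph_sum [bev _ _ _%:P]bev_polyC hornerC; congr (_ - _).
  apply: eq_bigr => j _; rewrite rmorphXn; congr (_ ^+ 2).
  rewrite bevE hornerD hornerZ hornerX !hornerC hornerD hornerM !hornerC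
    hornerZ hornerX.
  rewrite !mxE big_ord_recl big_ord1 vec2_0 (_ : lift ord0 ord0 = 1);
    last exact: val_inj.
  by rewrite vec2_1 [_ * B 0 j]mulrC [_ * B 1 j]mulrC.
have rowB v : v *m B = 0 -> v = 0.
  by move=> h; apply: (row_free_inj rB); rewrite h mul0mx.
have eC : [set x | euclidean_norm (x - c) = r] `&` Q =
    planar c B [set v | bev (v 0 0) (v 0 1) F = 0].
  have memQ x : Q x <-> exists v, x = c + v *m B.
    move: Qc; rewrite eQ => -[t0 _ <-]; split=> [[t _ <-]|[v ->]].
      by exists (t - t0); rewrite mulmxBl -addrA [t0 *m B + _]addrC subrK.
    by exists (t0 + v) => //; rewrite mulmxDl addrA.
  have normE v : euclidean_norm (c + v *m B - c) = Num.sqrt (sq (v *m B)).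
    by rewrite addrAC subrr add0r.
  apply/seteqP; split=> x.
    move=> [+ /memQ[v ex]]; rewrite /mkset => hx; exists v; last by rewrite ex.
    rewrite /mkset bevF -vec2_eta.
    rewrite -hx ex normE sqr_sqrtr ?subrr // sumr_ge0 // => i _; exact: sqr_ge0.
  move=> [v]; rewrite /mkset bevF -vec2_eta => /eqP;
    rewrite subr_eq0 => /eqP e <-.
  split; last by apply/memQ; exists v.
  by rewrite /= normE e sqrtr_sqr gtr0_norm.
rewrite eC; apply: (planar_algebraic_curve BM) => [y|].
  apply: contraTneq isT => Fy.
  have h s : sq (vec2 s y *m B) = r ^+ 2.
    apply/eqP; rewrite -subr_eq0 -bevF -slice_bev Fy horner0 //.
  have vecE s : vec2 s y *m B = s *: (vec2 1 0 *m B) + 1 *: (vec2 0 y *m B).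
    rewrite !scalemxAl -mulmxDl; congr (_ *m _); apply/rowP => j; rewrite !mxE.
    by case: eqP => _; ring.
  have : sq (vec2 1 0 *m B) = 0.
    set A := sq _; pose D := dot (vec2 1 0 *m B) (vec2 0 y *m B).
    pose E := sq (vec2 0 y *m B).
    have h' s : s ^+ 2 * A + 2 * s * 1 * D + 1 ^+ 2 * E = r ^+ 2.
      by rewrite -sq_combination -vecE h.
    have := h' 0; have := h' 1; have := h' (-1); lra.
  move/sum_sqr_eq0/rowB/rowP => /(_ 0); rewrite !mxE eqxx => /eqP.
  by rewrite oner_eq0.
pose u (k : nat) : 'rV[R]_2 := vec2 1 k%:R.
have u0 k : u k *m B != 0.
  apply/eqP => /rowB /rowP /(_ 0); rewrite !mxE eqxx => /eqP.
  by rewrite oner_eq0.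
have su k := sq_gt0 (u0 k).
pose l k := r / Num.sqrt (sq (u k *m B)).
have l0 k : 0 < l k by rewrite divr_gt0 // sqrtr_gt0.
apply: (@infinite_inj _ _ (fun k => c + (l k *: u k) *m B)) => [k k'|k].
  move=> /(planar_inj BM) e.
  have e0 : l k = l k'.
    by have := congr1 (fun v : 'rV[R]_2 => v 0 0) e; rewrite !mxE eqxx !mulr1.
  have := congr1 (fun v : 'rV[R]_2 => v 0 1) e; rewrite !mxE /= e0.
  by move=> /(mulfI (lt0r_neq0 (l0 k'))) /eqP; rewrite eqr_nat => /eqP.
exists (l k *: u k) => //;
  rewrite /mkset bevF -vec2_eta -scalemxAl sqZ /l expr_div_n.
by rewrite sqr_sqrtr ?(ltW (su k)) // divfK ?subrr // gt_eqF.
Qed.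
End CircleCurve.

Lemma regular_on_subset (R : realType) n (A C : set 'rV[R]_n) f :
  C `<=` A -> regular_on A f -> regular_on C f.
Proof.
move=> CA h a Ca; have [P [Q [Qa hf]]] := h a (CA a Ca).
by exists P, Q; split=> // x Cx; apply/hf/CA.
Qed.

Section Characterizations.
Variables (R : realType) (n k : nat).
Hypothesis n2 : (1 < n)%N.
Variable phi : set 'rV[R]_n -> 'rV[R]_n -> 'rV[R]_2.
Hypothesis hphi : plane_charts phi.
Variable f : 'rV[R]_n -> R.

Lemma regular_of_lines :
  (forall C, axis_parallel_line C -> regular_on C f) ->
  (forall C, H_collection phi k C -> real_analytic_on C f) ->
  regular_on [set: 'rV[R]_n] f.
Proof.
case: n n2 phi hphi f => // m m1 ph hph g lines ana.
have [P [Q [Q0 hQ]]] := rational_of_lines lines.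
apply: (regular_of_planes _ Q0 hQ); first by lia.
  exact: identities_spread_lines.
apply: (collection_quotient hph (F := E_curve) (W := @E_poly R)) ana => p q.
- exact: E_curveE.
- by move=> y p0 _; exact: E_poly_slice.
- by move=> p0 pq; rewrite /E_curve /= !mxE !expr0n !gtn_eqF ?subrr //; lia.
by move=> p0 pq; exact: E_curve_arc.
Qed.

Lemma regular_of_circles :
  (forall C, euclidean_circle C -> regular_on C f) ->
  (forall C, G_collection phi k C -> real_analytic_on C f) ->
  regular_on [set: 'rV[R]_n] f.
Proof.
case: n n2 phi hphi f => // m m1 ph hph g circles ana.
have [P [Q [Q0 hQ]]] := rational_of_circles m1 circles.
apply: (regular_of_planes _ Q0 hQ); first by lia.
  exact: identities_spread_circles.
apply: (collection_quotient hph (F := C_curve) (W := @C_poly R)) ana => p q.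
- exact: C_curveE.
- by move=> y p0 pq; exact: C_poly_slice.
- move=> p0 pq; have q0 : (0 < q)%N by lia.
  by rewrite /C_curve /= !mxE !expr0n !gtn_eqF ?muln_gt0 ?q0 // subrr !addr0.
by move=> p0 pq; exact: C_curve_arc.
Qed.
End Characterizations.

Theorem theorem1p4 (R : realType) (k n : nat) (hk : (1 <= k)%N) (hn : (2 <= n)%N)
    (phi : set 'rV[R]_n -> 'rV[R]_n -> 'rV[R]_2) (hphi : plane_charts phi)
    (f : 'rV[R]_n -> R) :
  [<->
    (* (a) *) regular_on [set: 'rV[R]_n]%classic f;
    (* (b) *) forall C, irreducible_curve C -> regular_on C f;
    (* (c) *) forall C, algebraic_curve C ->
                euclidean_circle C \/ G_collection phi k C -> regular_on C f;
    (* (d) *) (forall C, euclidean_circle C -> regular_on C f) /\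
              (forall C, G_collection phi k C -> real_analytic_on C f);
    (* (e) *) forall C, algebraic_curve C ->
                axis_parallel_line C \/ H_collection phi k C -> regular_on C f;
    (* (f) *) (forall C, axis_parallel_line C -> regular_on C f) /\
              (forall C, H_collection phi k C -> real_analytic_on C f)].
Proof.
have circ C : euclidean_circle C -> algebraic_curve C.
  exact: circle_algebraic_curve.
have sub C : regular_on [set: 'rV[R]_n]%classic f -> regular_on C f.
  exact: regular_on_subset.
have of_lines := regular_of_lines hn hphi (f := f).
have of_circles := regular_of_circles hn hphi (f := f).
tfae.
- by move=> reg C _; exact: sub.
- move=> reg C _ _; apply/sub/(of_lines k) => D HD.
    by apply: reg; exact: line_irreducible.
  by apply/regular_real_analytic/reg; exact: H_irreducible hphi hk HD.
- move=> reg; split=> C HC; first by apply: reg; [exact: circ | left].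
  by apply/regular_real_analytic/reg; [exact: HC.1 | right].
- by move=> [reg ana] C _ _; apply/sub/(of_circles k).
- move=> reg; split=> C HC; first by apply: reg; [exact: line_algebraic_curve | left].
  by apply/regular_real_analytic/reg; [exact: HC.1 | right].
by move=> [reg ana]; exact: (of_lines k).
Qed.
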